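(* Let $f:\mathbb{R}\to\mathbb{C}$ be a bounded continuous function with $f(0)=1$ and \[ \int_{-\infty}^{\infty}\frac{|f(t)|}{1+|t|}\,dt<\infty . \] For $z\in\mathbb{C}\setminus\mathbb{R}$ define the Cauchy transform \[ k_f(z)=\frac{i}{\pi}\int_{-\infty}^{\infty}\frac{f(t)}{z-t}\,dt . \] Then $f$ is a characteristic function if and only if: (i) the function $y\mapsto k_f(iy)$ is completely monotonic on $(0,\infty)$, and (ii) the function $y\mapsto -k_f(iy)$ is absolutely monotonic on $(-\infty,0)$.
   Context: A function $f:\mathbb{R}\to\mathbb{C}$ is a characteristic function if there is a probability measure $\sigma$ on $\mathbb{R}$ with $f(x)=\int_{-\infty}^{\infty}e^{ixt}\,d\sigma(t)$ for all $x\in\mathbb{R}$. A function $\omega:(a,b)\to\mathbb{R}$ ($-\infty\le a<b\le\infty$) is completely monotonic if it is infinitely differentiable and $(-1)^n\omega^{(n)}(x)\ge 0$ for all $x\in(a,b)$ and all $n=0,1,2,\dots$. A function $\omega$ is absolutely monotonic on $(a,b)$ if $x\mapsto\omega(-x)$ is completely monotonic on $(-b,-a)$, equivalently $\omega$ is infinitely differentiable with $\omega^{(n)}(x)\ge0$ for all $x\in(a,b)$ and all $n\ge 0$. (In particular, conditions (i) and (ii) require the respective functions to be real-valued.) *)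

(* Defs.v *)
From HB Require Import structures.
From mathcomp Require Import all_boot all_order all_algebra.
From mathcomp Require Import complex.
From mathcomp Require Import all_classical all_reals all_analysis.
Set Implicit Arguments. Unset Strict Implicit. Unset Printing Implicit Defensive.
Import Order.TTheory GRing.Theory Num.Theory.
Import numFieldNormedType.Exports.
Local Open Scope classical_set_scope.
Local Open Scope ring_scope.
Local Open Scope complex_scope.

Section defs.
Context {R : realType}.

Definition cintegral d (T : measurableType d) (mu : {measure set T -> \bar R})
  (g : T -> R[i]) : R[i] :=
  (Rintegral mu setT (fun t => complex.Re (g t))) +i* (Rintegral mu setT (fun t => complex.Im (g t))).

Definition cabs (z : R[i]) : R := Num.sqrt (complex.Re z ^+ 2 + complex.Im z ^+ 2).

Definition expi (s : R) : R[i] := cos s +i* sin s.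

Definition characteristic_function (f : R -> R[i]) : Prop :=
  exists sigma : probability R R,
    forall x : R, f x = cintegral sigma (fun t => expi (x * t)).

Definition cauchy_transform (f : R -> R[i]) (z : R[i]) : R[i] :=
  'i / (pi%:C) * cintegral (@lebesgue_measure R) (fun t => f t / (z - t%:C)).

Definition completely_monotonic (a b : \bar R) (w : R -> R) : Prop :=
  forall (n : nat) (x : R), (a < x%:E < b)%E ->
    derivable (derive1n n w) x 1 /\ 0 <= (-1) ^+ n * derive1n n w x.

Definition absolutely_monotonic (a b : \bar R) (w : R -> R) : Prop :=
  completely_monotonic (- b)%E (- a)%E (fun x => w (- x)).

End defs.

(* Main.v *)
(* Put w = y + it and G_n(y) = \int Re (f(t) w^-n) dt.  The n-th derivative of Re k_f(iy) is
   (-1)^n n! G_{n+1}(y) / pi, so (i) says that all G_n with n >= 1 are nonnegative and that the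
   analogous moments of -i f vanish; (ii) is the same condition for the conjugate of f.

   If f is the Fourier transform of sigma, write w^-(n+1) as the Laplace transform of
   q^n / n!; after damping by exp (- eps |t|), Fubini turns G_{n+1}(y) into an average of
   Poisson integrals of sigma, which are nonnegative; then let eps go to 0.

   Conversely, Phi_n(y) = \sum_{k=1}^n y^(k-1) G_k(y) has derivative - n y^(n-1) G_{n+1}(y) <= 0.
   Its kernel is (1 - (y/w)^n) / (it), so Phi_n(n/s) tends to
   \int Re (f(t) (1 - exp (- ist)) / (it)) dt, which is therefore nondecreasing in s >= 0: it is
   2 pi times the distribution function on the positive half-line of the measure sought, and the
   same construction for the conjugate of f gives the negative half-line.  Damping that measure by
   exp (- y |s|) convolves f with the Poisson kernel; letting y go to 0 yields total mass f(0) = 1 by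
   monotone convergence and Fourier transform f by dominated convergence. *)
Require Import Defs.
From HB Require Import structures.
From mathcomp Require Import all_boot all_order all_algebra.
From mathcomp Require Import complex.
From mathcomp Require Import all_classical all_reals all_analysis.
From mathcomp Require Import measurable_realfun ring lra.
Import Order.TTheory GRing.Theory Num.Theory.
Import numFieldNormedType.Exports.
Local Open Scope classical_set_scope.
Local Open Scope ring_scope.
Local Open Scope complex_scope.
Set Implicit Arguments. Unset Strict Implicit. Unset Printing Implicit Defensive.

(** * Real-valued integrals *)

Section Integrals.
Context {d : measure_display} {T : measurableType d} {R : realType}
  (mu : {measure set T -> \bar R}).

(** The kernels paired with f up to the construction of the measures are all bounded by C / (1 +
    |t|), with C locally uniform in their parameters. This is exactly the weight against which f is
    integrable, and it licenses each exchange of the integral with a derivative, a limit or a second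
    integral. A bare exponential has no such decay, so it is never paired with f: one half of the
    proof damps it, the other replaces exp (- ist) by its primitive in s and so builds a
    distribution function, not a density.

    Phi_n(y) is the Taylor polynomial of G_1 about y, evaluated at 0; moving the centre of a Taylor
    polynomial leaves a single term, whence the one-term derivative. The choice y = n/s is that of
    the Post-Widder inversion of Laplace transforms: (y/w)^n is (1 + ist/n)^(-n).

    Positive y sees only positive s, since 1/w is the Laplace transform of exp (- ist) over s > 0;
    this is why two conditions are needed. Reality of k_f also has a role: it makes the integral of
    f(t) (1 - exp (- ist)) / (it) real, so that the real part used for monotonicity is the whole
    integral. *)

Lemma integrable_bounded_by (f g : T -> R) : measurable_fun setT f ->
  mu.-integrable setT (EFin \o g) -> (forall x, `|f x| <= g x) ->
  mu.-integrable setT (EFin \o f).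
Proof.
move=> mf ig fg; apply: le_integrable ig => //; first exact/measurable_EFinP.
by move=> x _ /=; rewrite lee_fin (le_trans (fg x))// ler_norm.
Qed.

Lemma measurable_integrable (f : T -> R) : mu.-integrable setT (EFin \o f) ->
  measurable_fun setT f.
Proof. by move=> /measurable_int/measurable_EFinP. Qed.

Lemma Rintegral_dominated_cvg (f_ : nat -> T -> R) (f g : T -> R) :
  (forall n, measurable_fun setT (f_ n)) -> measurable_fun setT f ->
  {ae mu, forall x, f_ ^~ x @ \oo --> f x} ->
  mu.-integrable setT (EFin \o g) ->
  (forall n x, `|f_ n x| <= g x) ->
  Rintegral mu setT (f_ n) @[n --> \oo] --> Rintegral mu setT f.
Proof.
move=> mf_ mf cvf ig fg.
have mf'_ n : measurable_fun setT (EFin \o f_ n) by exact/measurable_EFinP.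
have mf' : measurable_fun setT (EFin \o f) by exact/measurable_EFinP.
have cvf' : {ae mu, forall x, setT x -> (EFin \o f_ n) x @[n --> \oo] --> (EFin \o f) x}.
  apply: filterS cvf => x cvx _ /=.
  by apply: cvg_EFin => //; exact: nearW.
have fg' : {ae mu, forall x n, setT x -> (`|(EFin \o f_ n) x| <= (EFin \o g) x)%E}.
  by apply: aeW => x n _ /=; rewrite lee_fin.
have [intf _ cv] := dominated_convergence measurableT mf'_ mf' cvf' ig fg'.
rewrite /Rintegral; apply: fine_cvg.
rewrite fineK; first exact: cv.
exact: integrable_fin_num.
Qed.

Lemma is_derive_Rintegral (f df : R -> T -> R) (g : T -> R) (a u v : R) :
  a \in `]u, v[ ->
  (forall x, x \in `]u, v[ -> mu.-integrable setT (EFin \o f x)) ->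
  (forall x t, x \in `]u, v[ -> is_derive x 1 (f ^~ t) (df x t)) ->
  mu.-integrable setT (EFin \o g) ->
  (forall x t, x \in `]u, v[ -> `|df x t| <= g t) ->
  is_derive a 1 (fun x => Rintegral mu setT (f x)) (Rintegral mu setT (df a)).
Proof.
move=> auv intf derf ig dfg.
have g0 t : 0 <= g t by rewrite (le_trans _ (dfg a t auv)).
have d1 x t : x \in `]u, v[ -> partial1of2 f x t = df x t.
  by move=> xuv; rewrite partial1of2E; have H := derf x t xuv; rewrite derive_val.
have H1 : forall x t, `]u, v[%classic x -> setT t -> derivable (f ^~ t) x 1.
  by move=> x t xuv _; have H := derf x t xuv; exact: ex_derive.
have H2 : forall x t, `]u, v[%classic x -> setT t -> `|partial1of2 f x t| <= g t.
  by move=> x t xuv _; rewrite d1//; exact: dfg.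
have H0 : `]u, v[%classic a by [].
have Hd := derivable_under_integral measurableT H0 intf H1 g0 ig H2.
have He := differentiation_under_integral measurableT H0 intf H1 g0 ig H2.
apply: DeriveDef => //.
rewrite -derive1E He; apply: eq_Rintegral => t _.
exact: d1.
Qed.

End Integrals.

Lemma Rintegral_Fubini (d1 d2 : measure_display) (T1 : measurableType d1)
    (T2 : measurableType d2) (R : realType)
    (m1 : {sigma_finite_measure set T1 -> \bar R})
    (m2 : {sigma_finite_measure set T2 -> \bar R}) (f : T1 -> T2 -> R) :
  (m1 \x m2)%E.-integrable setT (fun z => (f z.1 z.2)%:E) ->
  (forall x, m2.-integrable setT (EFin \o f x)) ->
  (forall y, m1.-integrable setT (EFin \o f ^~ y)) ->
  Rintegral m1 setT (fun x => Rintegral m2 setT (f x)) =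
  Rintegral m2 setT (fun y => Rintegral m1 setT (f ^~ y)).
Proof.
move=> intf int2 int1; have := Fubini intf => /= E.
rewrite /Rintegral; congr fine.
have E1 x : ((fine (\int[m2]_y (f x y)%:E))%:E = \int[m2]_y (f x y)%:E)%E.
  by rewrite fineK//; exact: (integrable_fin_num measurableT (int2 x)).
have E2 y : ((fine (\int[m1]_x (f x y)%:E))%:E = \int[m1]_x (f x y)%:E)%E.
  by rewrite fineK//; exact: (integrable_fin_num measurableT (int1 y)).
transitivity (\int[m1]_x \int[m2]_y (f x y)%:E)%E; first exact: eq_integral.
by rewrite E; apply: eq_integral => y _; rewrite E2.
Qed.

(** Domination by a product of two integrable functions gives integrability on the product space and
    of every section at once, by Tonelli; all the double integrals below but one are of this
    kind. *)
Lemma Rintegral_Fubini_prod (d1 d2 : measure_display) (T1 : measurableType d1)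
    (T2 : measurableType d2) (R : realType)
    (m1 : {sigma_finite_measure set T1 -> \bar R})
    (m2 : {sigma_finite_measure set T2 -> \bar R}) (f : T1 -> T2 -> R)
    (a : T1 -> R) (b : T2 -> R) :
  measurable_fun setT (fun z => f z.1 z.2) ->
  m1.-integrable setT (EFin \o a) -> m2.-integrable setT (EFin \o b) ->
  (forall x y, `|f x y| <= a x * b y) ->
  Rintegral m1 setT (fun x => Rintegral m2 setT (f x)) =
  Rintegral m2 setT (fun y => Rintegral m1 setT (f ^~ y)).
Proof.
move=> mf ia ib fab.
have fab' x y : `|f x y| <= `|a x| * `|b y|.
  by rewrite -normrM (le_trans (fab x y))// ler_norm.
have m1f y : measurable_fun setT (f ^~ y).
  apply: (measurableT_comp mf (g := fun x => (x, y))).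
  exact/measurable_fun_pair.
have m2f x : measurable_fun setT (f x).
  apply: (measurableT_comp mf (g := fun y => (x, y))).
  exact/measurable_fun_pair.
have i2 x : m2.-integrable setT (EFin \o f x).
  apply: (integrable_bounded_by (g := fun y => a x * b y)) => //=.
  by have := @integrableZl _ _ _ m2 _ measurableT (a x) _ ib.
have i1 y : m1.-integrable setT (EFin \o f ^~ y).
  apply: (integrable_bounded_by (g := fun x => b y * a x)) => //=.
    by have := @integrableZl _ _ _ m1 _ measurableT (b y) _ ia.
  by move=> x; rewrite mulrC.
apply: Rintegral_Fubini => //.
have mf' : measurable_fun setT (fun z : T1 * T2 => (f z.1 z.2)%:E).
  exact/measurable_EFinP.
apply/(integrable12ltyP _ _ mf') => /=.
have ib' : (\int[m2]_y (`|b y|)%:E < +oo)%E.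
  by have /integrableP[_] := ib.
have ib0 : (0 <= \int[m2]_y (`|b y|)%:E)%E by apply: integral_ge0.
have fin : (\int[m2]_y (`|b y|)%:E)%E \is a fin_num by rewrite ge0_fin_numE.
pose B := fine (\int[m2]_y (`|b y|)%:E)%E.
have iaB : m1.-integrable setT (EFin \o (fun x => B * `|a x|)).
  have := @integrableZl _ _ _ m1 _ measurableT B _ (integrable_norm ia).
  by [].
have /integrableP[_] := iaB; apply: le_lt_trans.
apply: ge0_le_integral => //.
- by move=> x _; apply: integral_ge0.
- apply: (measurable_fun_fubini_tonelli_F (fun z => `|(f z.1 z.2)%:E|)%E) => //.
  exact: measurableT_comp.
- by apply: measurableT_comp => //; exact: measurable_int iaB.
move=> x _ /=.
have -> : (`|B * `|a x| |%:E = \int[m2]_y (`|a x|%:E * `|b y|%:E))%E.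
  rewrite ge0_integralZl//=; last first.
    apply/measurable_EFinP/measurableT_comp => //; exact: measurable_integrable ib.
  rewrite -(fineK fin) -/B -EFinM normrM normr_id mulrC ger0_norm//.
  exact: fine_ge0.
apply: ge0_le_integral => //.
- apply/measurable_EFinP; apply: (measurableT_comp _ (m2f x)); exact: normr_measurable.
- apply/measurable_EFinP/measurable_funM => //.
  apply: measurableT_comp => //; exact: measurable_integrable ib.
- by move=> y _; rewrite lee_fin.
Qed.

(** * Derivatives and half-line integrals *)

Section Derivatives.
Context {R : realType}.
Implicit Types (f g : R -> R) (x : R).

Lemma is_derive_addf f g x df dg : is_derive x 1 f df -> is_derive x 1 g dg ->
  is_derive x 1 (fun r => f r + g r) (df + dg).
Proof. exact: is_deriveD. Qed.

Lemma is_derive_subf f g x df dg : is_derive x 1 f df -> is_derive x 1 g dg ->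
  is_derive x 1 (fun r => f r - g r) (df - dg).
Proof. exact: is_deriveB. Qed.

Lemma is_derive_oppf f x df : is_derive x 1 f df ->
  is_derive x 1 (fun r => - f r) (- df).
Proof. exact: is_deriveN. Qed.

Lemma is_derive_mulf f g x df dg : is_derive x 1 f df -> is_derive x 1 g dg ->
  is_derive x 1 (fun r => f r * g r) (df * g x + f x * dg).
Proof.
move=> Hf Hg; apply: (is_derive_eq (is_deriveM Hf Hg)).
by rewrite /GRing.scale /= addrC; congr (_ + _); rewrite mulrC.
Qed.

Lemma is_derive_cstf (c : R) x : is_derive x 1 (fun _ => c) 0.
Proof. exact: is_derive_cst. Qed.

Lemma is_derive_idf x : is_derive x 1 (fun r => r) 1.
Proof. exact: is_derive_id. Qed.

Lemma is_derive_expnf n x : is_derive x 1 (fun r : R => r ^+ n) (n%:R * x ^+ n.-1).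
Proof.
case: n => [|n]; first by rewrite mul0r; exact: is_derive_cst.
have H := is_deriveX n.+1 (is_derive_id x (1 : R)).
have -> : (fun r : R => r ^+ n.+1) = (id : R -> R) ^+ n.+1.
  by apply/funext => r; rewrite exprfctE.
apply: (is_derive_eq H).
by rewrite /GRing.scale /= mulr1.
Qed.

Lemma is_derive_compf (h : R -> R) f x df dh :
  is_derive (f x) 1 h dh -> is_derive x 1 f df ->
  is_derive x 1 (fun r => h (f r)) (df * dh).
Proof.
move=> Hh Hf; apply: (is_derive_eq (is_derive1_comp Hh Hf)).
by rewrite mulrC.
Qed.

Lemma is_derive_cosf f x df : is_derive x 1 f df ->
  is_derive x 1 (fun r => cos (f r)) (df * - sin (f x)).
Proof. by move=> ?; apply: is_derive_compf. Qed.

Lemma is_derive_sinf f x df : is_derive x 1 f df ->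
  is_derive x 1 (fun r => sin (f r)) (df * cos (f x)).
Proof. by move=> ?; apply: is_derive_compf. Qed.

Lemma is_derive_expf f x df : is_derive x 1 f df ->
  is_derive x 1 (fun r => expR (f r)) (df * expR (f x)).
Proof. by move=> ?; apply: is_derive_compf. Qed.

Lemma is_derive_invf f x df : f x != 0 -> is_derive x 1 f df ->
  is_derive x 1 (fun r => (f r)^-1) (- df / f x ^+ 2).
Proof.
move=> fx0 Hf; apply: (is_derive_eq (is_deriveV fx0 Hf)).
by rewrite /GRing.scale /= mulNr mulrC mulNr.
Qed.

Lemma is_derive_continuous f (df : R -> R) : (forall x, is_derive x 1 f (df x)) ->
  continuous f.
Proof.
move=> H x; apply: differentiable_continuous; apply/derivable1_diffP.
by have := H x; case.
Qed.

End Derivatives.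

Ltac derive_step :=
  lazymatch goal with
  | |- is_derive _ _ ?F _ =>
    lazymatch F with
    | (fun _ => ?c) => eapply is_derive_cstf
    | (fun r => r) => eapply is_derive_idf
    | (fun r => (@?f r + @?g r)%R) => eapply (@is_derive_addf _ f g)
    | (fun r => (- @?f r)%R) => eapply (@is_derive_oppf _ f)
    | (fun r => (r ^+ ?n)%R) => eapply is_derive_expnf
    | (fun r => (@?f r * @?g r)%R) => eapply (@is_derive_mulf _ f g)
    | (fun r => cos (@?f r)) => eapply (@is_derive_cosf _ f)
    | (fun r => sin (@?f r)) => eapply (@is_derive_sinf _ f)
    | (fun r => expR (@?f r)) => eapply (@is_derive_expf _ f)
    end
  end.

Ltac derive_tac := repeat derive_step.

Section HalfLine.
Context {R : realType}.
Notation lm := (@lebesgue_measure R).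

(** Integrals over [0, +oo[ are written as integrals over the whole line against this indicator, so
    that results stated on [setT] apply directly and the growth of exp (- y r) at negative r is cut
    off. *)
Definition halfline (r : R) : R := \1_(`[0, +oo[%classic) r.

Lemma halfline_ge0E r : 0 <= r -> halfline r = 1.
Proof. by move=> r0; rewrite /halfline indicE mem_set//= in_itv/= r0. Qed.

Lemma halfline_lt0E r : r < 0 -> halfline r = 0.
Proof. by move=> r0; rewrite /halfline indicE memNset//= in_itv/= andbT; apply/negP; rewrite -ltNge. Qed.

Lemma halfline_ge0 r : 0 <= halfline r.
Proof. by rewrite /halfline indicE. Qed.

Lemma halfline_le1 r : halfline r <= 1.
Proof. by case: (ltP r 0) => r0; [rewrite halfline_lt0E|rewrite halfline_ge0E]. Qed.

Lemma measurable_halfline : measurable_fun setT halfline.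
Proof. exact: measurable_indic. Qed.

Lemma halfline_le (a b : R -> R) : (forall r, 0 <= r -> a r <= b r) ->
  forall r, halfline r * a r <= halfline r * b r.
Proof.
move=> ab r; case: (ltP r 0) => r0.
  by rewrite halfline_lt0E// !mul0r.
by rewrite halfline_ge0E// !mul1r ab.
Qed.

Lemma halfline_norm_le (a b : R -> R) : (forall r, 0 <= r -> `|a r| <= b r) ->
  forall r, `|halfline r * a r| <= halfline r * b r.
Proof.
move=> ab r; rewrite normrM ger0_norm ?halfline_ge0//.
exact: (halfline_le (a := fun r => `|a r|)).
Qed.

(** The integrand may change sign, so integrability is a hypothesis and the improper integral is the
    dominated limit of integrals over [a, a + n]; the limit of [G] along a + n is then enough. *)
Lemma Rintegral_ray_FTC (g G : R -> R) (a l : R) :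
  continuous g -> (forall x : R, is_derive x 1 G (g x)) ->
  lm.-integrable setT (fun r => (halfline (r - a) * g r)%:E) ->
  G (a + n%:R) @[n --> \oo] --> l ->
  \int[lm]_r (halfline (r - a) * g r) = l - G a.
Proof.
move=> cg dG ig cG.
have mg : measurable_fun setT g by exact: continuous_measurable_fun.
have mh : measurable_fun setT (fun r : R => halfline (r - a)).
  apply: (measurableT_comp measurable_halfline); exact: measurable_funB.
pose f_ (n : nat) (r : R) := \1_(`[a, (a + n%:R)]%classic) r * g r.
have mf n : measurable_fun setT (f_ n).
  by apply: measurable_funM => //; exact: measurable_indic.
have cv : \int[lm]_r f_ n r @[n --> \oo] --> \int[lm]_r (halfline (r - a) * g r).
  apply: (Rintegral_dominated_cvg (mu := lm) (g := fun r => `|halfline (r - a) * g r|)) => //.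
  - exact: measurable_funM.
  - apply: aeW => r; apply: cvg_near_cst.
    near=> n; rewrite /f_ /halfline !indicE; congr (_%:R * _); congr nat_of_bool.
    have rn : r <= a + n%:R.
      rewrite -lerBlDl; near: n.
      by exists (Num.Def.truncn `|r - a|).+1 => // n /= nr; rewrite (le_trans (ler_norm _))// (le_trans (ltW (truncnS_gt _)))// ler_nat.
    by apply/idP/idP; rewrite !inE/= !in_itv/= ?andbT subr_ge0 rn andbT.
  - exact: (integrable_norm (mu := lm) (f := fun r => halfline (r - a) * g r)).
  - move=> n r; rewrite /f_ !normrM ler_wpM2r// /halfline !indicE.
    case: (boolP (r \in `[a, (a + n%:R)]%classic)) => [|_]; last by rewrite normr0.
    by rewrite inE/= in_itv/= => /andP[r0 _]; rewrite mem_set//= in_itv/= subr_ge0 r0.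
have cv2 : \int[lm]_r f_ n r @[n --> \oo] --> l - G a.
  have cG0 : G (a + n%:R) - G a @[n --> \oo] --> l - G a by apply: cvgB => //; exact: cvg_cst.
  apply: cvg_trans cG0; apply: near_eq_cvg; near=> n.
  have n0 : (0 : R) < n%:R by rewrite ltr0n; near: n; exact: nbhs_infty_gt.
  have cG' : continuous G by exact: is_derive_continuous dG.
  have -> : \int[lm]_r f_ n r = \int[lm]_(r in `[a, (a + n%:R)]) g r.
    rewrite [RHS]Rintegral_mkcond; apply: eq_Rintegral => r _.
    rewrite /f_ /patch indicE; case: ifPn => _; by rewrite ?mul1r ?mul0r.
  rewrite /Rintegral (@continuous_FTC2 _ g G)//.
  - by rewrite ltrDl.
  - by apply: continuous_subspaceT.
  - split.
    + by move=> x _; have := dG x; case.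
    + by apply: cvg_at_right_filter; exact: cG'.
    + by apply: cvg_at_left_filter; exact: cG'.
  - by move=> x _; rewrite derive1E; have H := dG x; rewrite derive_val.
by apply: cvg_unique cv cv2.
Unshelve. all: by end_near. Qed.

Lemma Rintegral_halfline_FTC (g G : R -> R) (l : R) :
  continuous g -> (forall x : R, is_derive x 1 G (g x)) ->
  lm.-integrable setT (fun r => (halfline r * g r)%:E) ->
  G n%:R @[n --> \oo] --> l ->
  \int[lm]_r (halfline r * g r) = l - G 0.
Proof.
move=> cg dG ig cG; rewrite -(@Rintegral_ray_FTC g)//.
- by apply: eq_Rintegral => r _; rewrite subr0.
- by under eq_fun do rewrite subr0.
- by under eq_cvg do rewrite add0r.
Qed.

Lemma cvg_expR_mul_nat (y : R) : 0 < y -> expR (- (y * n%:R)) @[n --> \oo] --> 0.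
Proof.
move=> y0.
have -> : (fun n : nat => expR (- (y * n%:R))) = (fun n => expR (- y) ^+ n).
  by apply/funext => n; rewrite -mulNr expRM_natr.
apply: cvg_expr; rewrite ger0_norm ?expR_ge0// expR_lt1; lra.
Qed.

Lemma integrable_halfline_expR (y : R) : 0 < y ->
  lm.-integrable setT (fun r => (halfline r * expR (- (y * r)))%:E).
Proof.
move=> y0.
have dF (x : R) : is_derive x 1 (fun r => - (y^-1 * expR (- (y * r)))) (expR (- (y * x))).
  eapply is_derive_eq; first by derive_tac.
  by rewrite /=; field; rewrite gt_eqF.
have cF := is_derive_continuous dF.
have de (x : R) : is_derive x 1 (fun r => expR (- (y * r))) (- y * expR (- (y * x))).
  eapply is_derive_eq; first by derive_tac.
  by rewrite /=; ring.
have ce := is_derive_continuous de.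
have E : (\int[lm]_(r in `[0%R, +oo[) (expR (- (y * r)))%:E = 0%:E - (- (y^-1 * expR (- (y * 0))))%:E)%E.
  apply: (@ge0_continuous_FTC2y _ (fun r => expR (- (y * r))) (fun r => - (y^-1 * expR (- (y * r)))) 0 0) => //.
  - exact: continuous_subspaceT.
  - rewrite -[X in _ --> X]oppr0 -(mulr0 y^-1); apply: cvgN; apply: cvgMr.
    rewrite (_ : (fun x => expR (- (y * x))) = (fun x => expR (- x)) \o ( *%R y))//.
    apply: (cvg_comp _ _ _ (@cvgr_expR R)).
    by apply: gt0_cvgMry => //; exact: cvg_id.
  - by apply: cvg_at_right_filter; exact: cF.
  - by move=> x _; rewrite derive1E; have H := dF x; rewrite derive_val.
have mf : measurable_fun setT (fun r : R => halfline r * expR (- (y * r))).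
  apply: measurable_funM; first exact: measurable_halfline.
  exact: continuous_measurable_fun.
apply/integrableP; split; first exact/measurable_EFinP.
rewrite (_ : (\int[lm]_x _ = \int[lm]_(r in `[0%R, +oo[) (expR (- (y * r)))%:E)%E).
  by rewrite E ltry.
rewrite [RHS]integral_mkcond; apply: eq_integral => r _.
rewrite /patch; case: ifPn => [|].
  by rewrite inE/= in_itv/= andbT => r0; rewrite halfline_ge0E// mul1r ger0_norm// expR_ge0.
by rewrite notin_setE/= in_itv/= andbT => /negP; rewrite -ltNge => r0; rewrite halfline_lt0E// mul0r normr0.
Qed.

Lemma pow_le_expR (n : nat) (x : R) : 0 <= x -> x ^+ n <= n`!%:R * expR x.
Proof.
move=> x0; case: n => [|n].
  by rewrite expr0 fact0 mul1r (le_trans _ (expR_ge1Dx x))// lerDl.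
have := expR_ge1Dxn n x0 => H.
have f0 : (0 : R) < n.+1`!%:R by rewrite ltr0n fact_gt0.
rewrite mulrC -ler_pdivrMr// (le_trans _ H)// lerDr//.
Qed.

(** Half of the decay absorbs the power: the bound x^n <= n! exp x at x = y r / 2 costs n! (2/y)^n
    and leaves exp (- y r / 2). *)
Lemma pow_expR_le (n : nat) (y r : R) : 0 < y -> 0 <= r ->
  r ^+ n * expR (- (y * r)) <= n`!%:R * (2 / y) ^+ n * expR (- (y / 2 * r)).
Proof.
move=> y0 r0.
have x0 : 0 <= y / 2 * r by apply: mulr_ge0 => //; lra.
have H := pow_le_expR n x0.
have -> : expR (- (y * r)) = expR (- (y / 2 * r)) * expR (- (y / 2 * r)).
  by rewrite -expRD; congr expR; field.
have -> : r ^+ n = (2 / y) ^+ n * (y / 2 * r) ^+ n.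
  by rewrite -exprMn; congr (_ ^+ n); field; rewrite gt_eqF.
have e0 := expR_gt0 (y / 2 * r).
rewrite expRN.
have -> : n`!%:R * (2 / y) ^+ n * (expR (y / 2 * r))^-1 =
  (2 / y) ^+ n * (n`!%:R * expR (y / 2 * r)) * ((expR (y / 2 * r))^-1 * (expR (y / 2 * r))^-1).
  by field; rewrite !gt_eqF.
apply: ler_wpM2r; first by rewrite mulr_ge0// invr_ge0 ltW.
by apply: ler_wpM2l => //; rewrite exprn_ge0// divr_ge0// ltW.
Qed.

Lemma integrable_halfline_pow_expR (n : nat) (y : R) : 0 < y ->
  lm.-integrable setT (fun r => (halfline r * (r ^+ n * expR (- (y * r))))%:E).
Proof.
move=> y0; have y20 : 0 < y / 2 by lra.
have me : measurable_fun setT (fun r : R => r ^+ n * expR (- (y * r))).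
  apply: continuous_measurable_fun; apply: is_derive_continuous => x.
  by derive_tac.
apply: (integrable_bounded_by (mu := lm) (g := fun r => n`!%:R * (2 / y) ^+ n * (halfline r * expR (- (y / 2 * r))))).
- by apply: measurable_funM => //; exact: measurable_halfline.
- have := @integrableZl _ _ _ lm _ measurableT (n`!%:R * (2 / y) ^+ n) _ (integrable_halfline_expR y20).
  by [].
- move=> /= r; rewrite [leRHS]mulrCA.
  apply: (halfline_norm_le (a := fun r => r ^+ n * expR (- (y * r))) (b := fun r => n`!%:R * (2 / y) ^+ n * expR (- (y / 2 * r)))) => {}r r0.
  rewrite ger0_norm; first exact: pow_expR_le.
  by rewrite mulr_ge0 ?exprn_ge0// expR_ge0.
Qed.

Lemma cvg_pow_expR (n : nat) (y : R) (c : R -> R) : 0 < y -> (forall r, `|c r| <= 1) ->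
  k%:R ^+ n * expR (- (y * k%:R)) * c k%:R @[k --> \oo] --> 0.
Proof.
move=> y0 c1; apply: norm_cvg0.
have y20 : 0 < y / 2 by lra.
apply: (@squeeze_cvgr _ _ _ _ (cst 0) (fun k : nat => n`!%:R * (2 / y) ^+ n * expR (- (y / 2 * k%:R)))).
- apply: nearW => k; rewrite normr_ge0/= normrM.
  have k0 : (0 : R) <= k%:R by [].
  rewrite (le_trans _ (pow_expR_le n y0 k0))//.
  rewrite ger0_norm ?mulr_ge0 ?exprn_ge0 ?expR_ge0//.
  by rewrite ler_piMr// mulr_ge0 ?exprn_ge0 ?expR_ge0.
- exact: cvg_cst.
- rewrite -[X in _ --> X](mulr0 (n`!%:R * (2 / y) ^+ n)).
  by apply: cvgMr; exact: cvg_expR_mul_nat.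
Qed.

End HalfLine.

(** * Reflection and folding of the real line *)

Section WholeLine.
Context {R : realType}.
Notation lm := (@lebesgue_measure R).

Lemma Rintegral_opp (f : R -> R) : lm.-integrable setT (EFin \o f) ->
  lm.-integrable setT (EFin \o (f \o -%R)) /\
  \int[lm]_r f (- r) = \int[lm]_r f r.
Proof.
move=> intf.
have mf := measurable_integrable intf.
have mo : measurable_fun setT (-%R : R -> R) by exact: oppr_measurable.
have iN : lm.-integrable setT (EFin \o (f \o -%R)).
  apply/integrableP; split; first exact/measurable_EFinP/measurableT_comp.
  have /integrableP[_] := intf.
  rewrite (_ : (\int[lm]_x `|(EFin \o f) x| = \int[pushforward lm (-%R : R -> measurableTypeR R)]_x `|(EFin \o f) x|)%E); last first.
    by apply: eq_measure_integral => A mA _; apply/esym; exact: lebesgue_measureN.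
  rewrite ge0_integral_pushforward//=.
  by apply/measurable_EFinP; apply: measurableT_comp mf; exact: normr_measurable.
split=> //.
rewrite /Rintegral; congr fine.
rewrite (_ : (\int[lm]_x (f x)%:E = \int[pushforward lm (-%R : R -> measurableTypeR R)]_x (f x)%:E)%E); last first.
  by apply: eq_measure_integral => A mA _; apply/esym; exact: lebesgue_measureN.
rewrite integral_pushforward//=.
exact/measurable_EFinP.
Qed.

Lemma Rintegral_ae_neq0 (f g : R -> R) : measurable_fun setT f -> measurable_fun setT g ->
  (forall r, r != 0 -> f r = g r) -> \int[lm]_r f r = \int[lm]_r g r.
Proof.
move=> mf mg fg; rewrite /Rintegral; congr fine.
apply: ae_eq_integral => //; [exact/measurable_EFinP..|].
exists [set 0]; split => //; first exact: lebesgue_measure_set1.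
move=> r /= /not_implyP[_] H; apply: contrapT => r0; apply: H.
by rewrite fg//; apply/eqP.
Qed.

Lemma Rintegral_fold (f : R -> R) : lm.-integrable setT (EFin \o f) ->
  \int[lm]_r f r = \int[lm]_r (halfline r * (f r + f (- r))).
Proof.
move=> intf; have [iN EN] := Rintegral_opp intf.
have mf := measurable_integrable intf.
have mN := measurable_integrable iN.
have mh := @measurable_halfline R.
have mhN : measurable_fun setT (fun r : R => halfline (- r)).
  by apply: measurableT_comp => //; exact: oppr_measurable.
have i1 : lm.-integrable setT (EFin \o (fun r => halfline r * f r)).
  apply: (integrable_bounded_by (mu := lm) (g := fun r => `|f r|)).
  - exact: measurable_funM.
  - exact: (integrable_norm (mu := lm) (f := f)).
  - move=> r; rewrite normrM ger0_norm ?halfline_ge0//.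
    by rewrite ler_piMl// halfline_le1.
have i2 : lm.-integrable setT (EFin \o (fun r => halfline r * f (- r))).
  apply: (integrable_bounded_by (mu := lm) (g := fun r => `|f (- r)|)).
  - exact: measurable_funM.
  - exact: (integrable_norm (mu := lm) (f := f \o -%R)).
  - move=> r; rewrite normrM ger0_norm ?halfline_ge0//.
    by rewrite ler_piMl// halfline_le1.
have [i2' E2] := Rintegral_opp i2.
have -> : \int[lm]_r (halfline r * (f r + f (- r))) =
    \int[lm]_r (halfline r * f r + halfline r * f (- r)).
  by apply: eq_Rintegral => r _; rewrite mulrDr.
rewrite RintegralD// -E2 -RintegralD//.
(* Both closed half-lines contain 0, where the folded integrand counts [f 0] twice; the two sides
   agree only off that point. *)
apply: Rintegral_ae_neq0 => //.
  apply: measurable_funD; first exact: measurable_funM.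
  exact: measurable_integrable i2'.
move=> r; rewrite opprK; case: (ltgtP r 0) => // r0 _.
  by rewrite halfline_lt0E// halfline_ge0E ?mul0r ?mul1r ?add0r// oppr_ge0 ltW.
by rewrite [halfline (- r)]halfline_lt0E ?oppr_lt0// halfline_ge0E ?mul0r ?mul1r ?addr0// ltW.
Qed.

End WholeLine.

(** * Moments of the Cauchy kernel *)

Section ComplexKernels.
Context {R : realType}.
Implicit Types (z w : R[i]).

Lemma Re_mulc z w : complex.Re (z * w) =
  complex.Re z * complex.Re w - complex.Im z * complex.Im w.
Proof. by case: z w => [a b] [c d]. Qed.

Lemma Im_mulc z w : complex.Im (z * w) =
  complex.Re z * complex.Im w + complex.Im z * complex.Re w.
Proof. by case: z w => [a b] [c d]. Qed.

Lemma cabs_ge0 z : 0 <= cabs z.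
Proof. exact: sqrtr_ge0. Qed.

Lemma cabs_sqr z : cabs z ^+ 2 = complex.Re z ^+ 2 + complex.Im z ^+ 2.
Proof. by rewrite sqr_sqrtr// addr_ge0// sqr_ge0. Qed.

Lemma cabsM z w : cabs (z * w) = cabs z * cabs w.
Proof.
apply/eqP; rewrite -(@eqrXn2 _ 2)//; rewrite ?mulr_ge0 ?cabs_ge0//.
rewrite exprMn !cabs_sqr Re_mulc Im_mulc; apply/eqP; ring.
Qed.

Lemma Re_le_cabs z : `|complex.Re z| <= cabs z.
Proof.
by rewrite -sqrtr_sqr ler_wsqrtr// lerDl sqr_ge0.
Qed.

Lemma Im_le_cabs z : `|complex.Im z| <= cabs z.
Proof.
by rewrite -sqrtr_sqr ler_wsqrtr// lerDr sqr_ge0.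
Qed.

Lemma cabs_le z (c : R) : 0 <= c ->
  complex.Re z ^+ 2 + complex.Im z ^+ 2 <= c ^+ 2 -> cabs z <= c.
Proof. by move=> c0; rewrite -cabs_sqr ler_sqr ?nnegrE ?cabs_ge0. Qed.

Lemma cabsNi z : cabs (- 'i * z) = cabs z.
Proof. by rewrite cabsM /cabs/= oppr0 expr0n/= add0r sqrrN expr1n sqrtr1 mul1r. Qed.

Lemma cabsi z : cabs ('i * z) = cabs z.
Proof. by rewrite cabsM /cabs/= expr0n/= add0r expr1n sqrtr1 mul1r. Qed.

Lemma cabs_conj z : cabs (conjc z) = cabs z.
Proof. by case: z => a b; rewrite /cabs/= sqrrN. Qed.

Lemma Re_mulNi z : complex.Re (- 'i * z) = complex.Im z.
Proof. by rewrite Re_mulc/= oppr0 mul0r sub0r mulN1r opprK. Qed.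

Lemma Re_muli z : complex.Re ('i * z) = - complex.Im z.
Proof. by rewrite Re_mulc/= mul0r sub0r mul1r. Qed.

Lemma Im_mulNi z : complex.Im (- 'i * z) = - complex.Re z.
Proof. by rewrite Im_mulc/= oppr0 mul0r add0r mulN1r. Qed.

Lemma Im_muli z : complex.Im ('i * z) = complex.Re z.
Proof. by rewrite Im_mulc/= mul0r add0r mul1r. Qed.

(** Since i y - t = i (y + i t), the Cauchy kernel at z = i y is - i / (y + i t); up to constants,
    its successive derivatives in y are the powers of this inverse. *)
Definition cinvpow (n : nat) (y t : R) : R[i] := (y +i* t)^-1 ^+ n.
Arguments cinvpow : simpl never.

Lemma cinvpow1 y t : cinvpow 1 y t = (y / (y ^+ 2 + t ^+ 2)) +i* (- (t / (y ^+ 2 + t ^+ 2))).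
Proof. by rewrite /cinvpow expr1. Qed.

Lemma cinvpowS n y t : cinvpow n.+1 y t = cinvpow n y t * cinvpow 1 y t.
Proof. by rewrite /cinvpow expr1 exprSr. Qed.

Lemma sqrD_gt0 (y t : R) : 0 < y -> 0 < y ^+ 2 + t ^+ 2.
Proof. by move=> y0; rewrite ltr_wpDr ?sqr_ge0// exprn_gt0. Qed.

Lemma is_derive_cinvpow n (y t : R) : 0 < y ->
  is_derive y 1 (fun y => complex.Re (cinvpow n y t))
    (- n%:R * complex.Re (cinvpow n.+1 y t)) /\
  is_derive y 1 (fun y => complex.Im (cinvpow n y t))
    (- n%:R * complex.Im (cinvpow n.+1 y t)).
Proof.
move=> y0; have q0 := sqrD_gt0 t y0; have qN0 := lt0r_neq0 q0.
have dq : is_derive y 1 (fun y => (y ^+ 2 + t ^+ 2)^-1) (- (2 * y) / (y ^+ 2 + t ^+ 2) ^+ 2).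
  have H : is_derive y 1 (fun y => y ^+ 2 + t ^+ 2) (2 * y).
    by eapply is_derive_eq; [derive_tac|rewrite /= addr0].
  exact: is_derive_invf.
have d1 : is_derive y 1 (fun y => complex.Re (cinvpow 1 y t)) (- complex.Re (cinvpow 2 y t)).
  have -> : (fun y => complex.Re (cinvpow 1 y t)) = (fun y => y * (y ^+ 2 + t ^+ 2)^-1).
    by apply/funext => u; rewrite cinvpow1.
  apply: (is_derive_eq (is_derive_mulf (is_derive_idf y) dq)).
  by rewrite cinvpowS Re_mulc cinvpow1 /=; field.
have d2 : is_derive y 1 (fun y => complex.Im (cinvpow 1 y t)) (- complex.Im (cinvpow 2 y t)).
  have -> : (fun y => complex.Im (cinvpow 1 y t)) = (fun y => - (t * (y ^+ 2 + t ^+ 2)^-1)).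
    by apply/funext => u; rewrite cinvpow1.
  apply: (is_derive_eq (is_derive_oppf (is_derive_mulf (is_derive_cstf t y) dq))).
  by rewrite cinvpowS Im_mulc cinvpow1 /=; field.
elim: n => [|n [IHr IHi]].
  split.
    rewrite oppr0 mul0r (_ : (fun y => _) = (fun=> 1)); last by apply/funext => u; rewrite /cinvpow expr0.
    exact: is_derive_cstf.
  rewrite oppr0 mul0r (_ : (fun y => _) = (fun=> 0)); last by apply/funext => u; rewrite /cinvpow expr0.
  exact: is_derive_cstf.
split.
  have -> : (fun y => complex.Re (cinvpow n.+1 y t)) =
     (fun y => complex.Re (cinvpow n y t) * complex.Re (cinvpow 1 y t) -
               complex.Im (cinvpow n y t) * complex.Im (cinvpow 1 y t)).
    by apply/funext => u; rewrite cinvpowS Re_mulc.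
  apply: (is_derive_eq (is_derive_subf (is_derive_mulf IHr d1) (is_derive_mulf IHi d2))).
  rewrite !(cinvpowS n.+1) !(cinvpowS n) !(cinvpowS 1) !(Re_mulc, Im_mulc) -[n.+1]addn1 natrD.
  ring.
have -> : (fun y => complex.Im (cinvpow n.+1 y t)) =
   (fun y => complex.Re (cinvpow n y t) * complex.Im (cinvpow 1 y t) +
             complex.Im (cinvpow n y t) * complex.Re (cinvpow 1 y t)).
  by apply/funext => u; rewrite cinvpowS Im_mulc.
apply: (is_derive_eq (is_derive_addf (is_derive_mulf IHr d2) (is_derive_mulf IHi d1))).
rewrite !(cinvpowS n.+1) !(cinvpowS n) !(cinvpowS 1) !(Re_mulc, Im_mulc) -[n.+1]addn1 natrD.
ring.
Qed.

Lemma cabs_cinvpow1_sqr (y t : R) : 0 < y -> cabs (cinvpow 1 y t) ^+ 2 = (y ^+ 2 + t ^+ 2)^-1.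
Proof.
move=> y0; have q0 := lt0r_neq0 (sqrD_gt0 t y0).
by rewrite cabs_sqr cinvpow1 /=; field.
Qed.

(** The constant depends on the lower bound [d] of y and not on y itself, as differentiation under
    the integral sign requires. *)
Lemma cabs_cinvpow1_le (d y t : R) : 0 < d -> d <= y ->
  cabs (cinvpow 1 y t) <= (1 + d^-1) / (1 + `|t|).
Proof.
move=> d0 dy; have y0 := lt_le_trans d0 dy; have q0 := sqrD_gt0 t y0.
have t0 := normr_ge0 t.
have di : 0 < d^-1 by rewrite invr_gt0.
apply: cabs_le; first by rewrite divr_ge0//; lra.
rewrite -cabs_sqr cabs_cinvpow1_sqr// expr_div_n.
rewrite ler_pdivlMr; last by rewrite exprn_gt0//; lra.
rewrite mulrC ler_pdivrMr//.
have yd : 1 <= d^-1 * y by rewrite mulrC ler_pdivlMr// mul1r.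
rewrite -(real_normK (num_real t)).
set T := `|t| in t0 *; set e := d^-1 in yd di *.
(* With e y >= 1, this square gives 2 T <= 2 e y T <= y^2 + e^2 T^2, the cross term in the expansion
   of (1 + T)^2; the term 1 is below (e y)^2. *)
have : 0 <= (y - T * e) ^+ 2 by exact: sqr_ge0.
nra.
Qed.

(** A single factor supplies the decay 1 / (1 + |t|); each of the others is bounded by the constant
    1 + 1/d. *)
Lemma cabs_cinvpow_le n (d y t : R) : 0 < d -> d <= y ->
  cabs (cinvpow n.+1 y t) <= (1 + d^-1) ^+ n.+1 / (1 + `|t|).
Proof.
move=> d0 dy; have di : 0 < d^-1 by rewrite invr_gt0.
have t0 := normr_ge0 t.
elim: n => [|n IH]; first by rewrite expr1 cabs_cinvpow1_le.
rewrite cinvpowS cabsM exprSr -mulrA [_ * (_ / _)]mulrA mulrAC.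
have := cabs_cinvpow1_le t d0 dy.
have h1 : (1 + d^-1) / (1 + `|t|) <= 1 + d^-1 by rewrite ler_pdivrMr; [nra|lra].
move=> h; apply: ler_pM; rewrite ?cabs_ge0//.
exact: le_trans h h1.
Qed.

Lemma measurable_cinvpow n (y : R) : 0 < y ->
  measurable_fun setT (fun t => complex.Re (cinvpow n y t)) /\
  measurable_fun setT (fun t => complex.Im (cinvpow n y t)).
Proof.
move=> y0.
have mq : measurable_fun setT (fun t : R => (y ^+ 2 + t ^+ 2)^-1).
  apply: continuous_measurable_fun; apply: (@is_derive_continuous _ _ (fun t => - (2 * t) / (y ^+ 2 + t ^+ 2) ^+ 2)) => t.
  have H : is_derive t 1 (fun t => y ^+ 2 + t ^+ 2) (2 * t).
    by eapply is_derive_eq; [derive_tac|rewrite /= add0r].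
  by apply: is_derive_invf => //; rewrite gt_eqF// sqrD_gt0.
have m1 : measurable_fun setT (fun t => complex.Re (cinvpow 1 y t)).
  rewrite (_ : (fun t => _) = (fun t => y * (y ^+ 2 + t ^+ 2)^-1)); last by apply/funext => t; rewrite cinvpow1.
  exact: measurable_funM.
have m2 : measurable_fun setT (fun t => complex.Im (cinvpow 1 y t)).
  rewrite (_ : (fun t => _) = (fun t => - (t * (y ^+ 2 + t ^+ 2)^-1))); last by apply/funext => t; rewrite cinvpow1.
  by apply: measurableT_comp => //; exact: measurable_funM.
elim: n => [|n [IH1 IH2]].
  by split; [rewrite (_ : (fun t => _) = (fun=> 1))|rewrite (_ : (fun t => _) = (fun=> 0))] => //; apply/funext => t; rewrite /cinvpow expr0.
split.
  rewrite (_ : (fun t => _) = (fun t => complex.Re (cinvpow n y t) * complex.Re (cinvpow 1 y t) - complex.Im (cinvpow n y t) * complex.Im (cinvpow 1 y t))); last first.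
    by apply/funext => t; rewrite cinvpowS Re_mulc.
  by apply: measurable_funB; exact: measurable_funM.
rewrite (_ : (fun t => _) = (fun t => complex.Re (cinvpow n y t) * complex.Im (cinvpow 1 y t) + complex.Im (cinvpow n y t) * complex.Re (cinvpow 1 y t))); last first.
  by apply/funext => t; rewrite cinvpowS Im_mulc.
by apply: measurable_funD; exact: measurable_funM.
Qed.

End ComplexKernels.

(** * Derivatives of the moments and complete monotonicity *)

Section CauchyDerivatives.
Context {R : realType}.
Notation lm := (@lebesgue_measure R).
Implicit Types (f k : R -> R[i]).

Definition cmeasurable f := measurable_fun setT (fun t => complex.Re (f t)) /\
  measurable_fun setT (fun t => complex.Im (f t)).

(** This class is stable under multiplication by i and - i and under conjugation, so each result
    about [f] also serves for the companions of [f] that occur in the two conditions. *)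
Definition admissible f := cmeasurable f /\
  lm.-integrable setT (fun t : R => (cabs (f t) / (1 + `|t|))%:E).

Lemma admissibleNi f : admissible f -> admissible (fun t => - 'i * f t).
Proof.
move=> [[m1 m2] fi]; split; last first.
  by under eq_fun do rewrite cabsNi.
split.
  by under eq_fun do rewrite Re_mulNi.
by under eq_fun do rewrite Im_mulNi; exact: measurableT_comp.
Qed.

Lemma admissible_i f : admissible f -> admissible (fun t => 'i * f t).
Proof.
move=> [[m1 m2] fi]; split; last first.
  by under eq_fun do rewrite cabsi.
split.
  by under eq_fun do rewrite Re_muli; exact: measurableT_comp.
by under eq_fun do rewrite Im_muli.
Qed.

Lemma admissible_conj f : admissible f -> admissible (fun t => conjc (f t)).
Proof.
move=> [[m1 m2] fi]; split; last first.
  by under eq_fun do rewrite cabs_conj.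
split.
  rewrite (_ : (fun t => _) = (fun t => complex.Re (f t)))//.
  by apply/funext => t; case: (f t).
rewrite (_ : (fun t => _) = (fun t => - complex.Im (f t))); last first.
  by apply/funext => t; case: (f t).
exact: measurableT_comp.
Qed.

Lemma measurable_Re_mul f k : cmeasurable f -> cmeasurable k ->
  measurable_fun setT (fun t => complex.Re (f t * k t)).
Proof.
move=> [m1 m2] [m3 m4]; under eq_fun do rewrite Re_mulc.
by apply: measurable_funB; exact: measurable_funM.
Qed.

Lemma Re_mul_le f k (C : R) t : cabs (k t) <= C / (1 + `|t|) ->
  `|complex.Re (f t * k t)| <= C * (cabs (f t) / (1 + `|t|)).
Proof.
move=> h; rewrite (le_trans (Re_le_cabs _))// cabsM.
rewrite mulrCA [_ * (_ / _)]mulrA -mulrA ler_wpM2l ?cabs_ge0//.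
Qed.

Lemma integrable_dominating f (C : R) : admissible f ->
  lm.-integrable setT (EFin \o (fun t => C * (cabs (f t) / (1 + `|t|)))).
Proof. by move=> [_ fi]; exact: (integrableZl measurableT C fi). Qed.

Lemma integrable_Re_mul f k (C : R) : admissible f -> cmeasurable k ->
  (forall t, cabs (k t) <= C / (1 + `|t|)) ->
  lm.-integrable setT (EFin \o (fun t => complex.Re (f t * k t))).
Proof.
move=> af mk kC.
apply: (integrable_bounded_by (mu := lm) (g := fun t => C * (cabs (f t) / (1 + `|t|)))).
- by apply: measurable_Re_mul => //; case: af.
- exact: integrable_dominating.
- by move=> t; exact: Re_mul_le.
Qed.

(* Re k_f(iy) is [cauchy_moment f 1 y / pi], and its n-th derivative in y is
   [(-1)^n n! cauchy_moment f n.+1 y / pi]. *)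
Definition cauchy_moment f (n : nat) (y : R) : R :=
  \int[lm]_t complex.Re (f t * cinvpow n y t).

Lemma integrable_cauchy_moment f n y : admissible f -> 0 < y ->
  lm.-integrable setT (EFin \o (fun t => complex.Re (f t * cinvpow n.+1 y t))).
Proof.
move=> af y0; apply: (@integrable_Re_mul _ _ ((1 + y^-1) ^+ n.+1)) => //.
  exact: measurable_cinvpow.
by move=> t; exact: cabs_cinvpow_le.
Qed.

Lemma is_derive_cauchy_moment f n (y : R) : admissible f -> 0 < y ->
  is_derive y 1 (cauchy_moment f n.+1) (- n.+1%:R * cauchy_moment f n.+2 y).
Proof.
move=> af y0.
have y20 : 0 < y / 2 by lra.
(* On this neighbourhood of y the kernel bound holds uniformly with d = y / 2. *)
have Hin : y \in `](y / 2), (2 * y)[ by rewrite in_itv/=; apply/andP; split; lra.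
have dk (x t : R) : 0 < x -> is_derive x 1 (fun x => complex.Re (f t * cinvpow n.+1 x t))
    (- n.+1%:R * complex.Re (f t * cinvpow n.+2 x t)).
  move=> x0; have [d1 d2] := is_derive_cinvpow n.+1 t x0.
  rewrite (_ : (fun x => _) = (fun x => complex.Re (f t) * complex.Re (cinvpow n.+1 x t) - complex.Im (f t) * complex.Im (cinvpow n.+1 x t))); last first.
    by apply/funext => u; rewrite Re_mulc.
  apply: (is_derive_eq (is_derive_subf (is_derive_mulf (is_derive_cstf _ x) d1) (is_derive_mulf (is_derive_cstf _ x) d2))).
  by rewrite Re_mulc; ring.
have := @is_derive_Rintegral _ _ R lm (fun x t => complex.Re (f t * cinvpow n.+1 x t))
  (fun x t => - n.+1%:R * complex.Re (f t * cinvpow n.+2 x t))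
  (fun t => n.+1%:R * (1 + (y / 2)^-1) ^+ n.+2 * (cabs (f t) / (1 + `|t|))) y (y / 2) (2 * y) Hin.
move=> H; eapply is_derive_eq.
  eapply H.
  - move=> x; rewrite in_itv/= => /andP[yx _]; apply: integrable_cauchy_moment => //; exact: lt_trans yx.
  - move=> x t; rewrite in_itv/= => /andP[yx _]; apply: dk; exact: lt_trans yx.
  - exact: integrable_dominating.
  - move=> x t; rewrite in_itv/= => /andP[yx _].
    rewrite normrM normrN normr_nat -mulrA ler_wpM2l//.
    by apply: Re_mul_le; apply: cabs_cinvpow_le => //; exact: ltW.
rewrite /cauchy_moment RintegralZl//; exact: integrable_cauchy_moment.
Qed.

Lemma is_derive_eq_pos (g h : R -> R) (y d : R) : 0 < y ->
  (forall u, 0 < u -> g u = h u) -> is_derive y 1 g d -> is_derive y 1 h d.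
Proof.
move=> y0 gh; apply: near_eq_is_derive.
by near=> u; apply: gh; near: u; exact: lt_nbhsr.
Unshelve. all: by end_near. Qed.

(** Nothing is known about [w] on the nonpositive half-axis. A derivative at y > 0 only depends on
    values near y, so each identity on ]0, +oo[ can be differentiated again. *)
Lemma derive1n_cauchy_moment f (w : R -> R) n (y : R) : admissible f ->
  (forall y : R, 0 < y -> w y = cauchy_moment f 1 y / pi) -> 0 < y ->
  derive1n n w y = (-1) ^+ n * n`!%:R / pi * cauchy_moment f n.+1 y /\
  derivable (derive1n n w) y 1.
Proof.
move=> af wE.
have step m (u : R) : (forall y, 0 < y ->
    derive1n m w y = (-1) ^+ m * m`!%:R / pi * cauchy_moment f m.+1 y) -> 0 < u ->
    is_derive u 1 (derive1n m w) ((-1) ^+ m.+1 * m.+1`!%:R / pi * cauchy_moment f m.+2 u).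
  move=> Hm u0; have d := is_derive_cauchy_moment m af u0.
  apply: (@is_derive_eq_pos (fun y => (-1) ^+ m * m`!%:R / pi * cauchy_moment f m.+1 y)) => //.
    by move=> v v0; rewrite Hm.
  apply: (is_derive_eq (is_derive_mulf (is_derive_cstf _ _) d)).
  by rewrite mul0r add0r exprS factS natrM; ring.
have E m : forall u, 0 < u -> derive1n m w u = (-1) ^+ m * m`!%:R / pi * cauchy_moment f m.+1 u.
  elim: m => [|m IH] u u0.
    by rewrite derive1n0 wE// expr0 fact0 mul1r mul1r mulrC.
  have H := step m u IH u0.
  by rewrite derive1nS derive1E derive_val.
by move=> y0; split; [exact: E|case: (step n y (E n) y0)].
Qed.

Definition moments_ge0 f := forall n (y : R), 0 < y -> 0 <= cauchy_moment f n.+1 y.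

Lemma completely_monotonicP f (w : R -> R) : admissible f ->
  (forall y : R, 0 < y -> w y = cauchy_moment f 1 y / pi) ->
  completely_monotonic 0%E +oo%E w <-> moments_ge0 f.
Proof.
move=> af wE.
have H n y : 0 < y -> (-1) ^+ n * derive1n n w y = n`!%:R / pi * cauchy_moment f n.+1 y.
  move=> y0; rewrite (derive1n_cauchy_moment n af wE y0).1 !mulrA -exprMn mulrNN mul1r expr1n mul1r.
  by [].
have c0 n : 0 < n`!%:R / pi :> R by rewrite divr_gt0 ?pi_gt0// ltr0n fact_gt0.
split.
  move=> cm n y y0.
  have [|_] := cm n y; first by rewrite lte_fin y0 ltry.
  by rewrite H// pmulr_rge0.
move=> pos n y; rewrite lte_fin ltry andbT => y0; split.
  by have [] := derive1n_cauchy_moment n af wE y0.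
by rewrite H// pmulr_rge0// pos.
Qed.

(** A moment that vanishes on the whole half-axis has zero derivative there, and this derivative is
    a nonzero multiple of the next moment. *)
Lemma cauchy_moment_eq0 f : admissible f ->
  (forall y : R, 0 < y -> cauchy_moment f 1 y = 0) ->
  forall n y, 0 < y -> cauchy_moment f n.+1 y = 0.
Proof.
move=> af H; elim=> [|n IH] y y0; first exact: H.
have d := is_derive_cauchy_moment n af y0.
have d' : is_derive y 1 (cauchy_moment f n.+1) 0.
  apply: (is_derive_eq_pos y0 _ (is_derive_cstf 0 y)) => u u0.
  by rewrite IH.
have : - n.+1%:R * cauchy_moment f n.+2 y = 0.
  by rewrite -(@derive_val _ _ _ _ _ _ _ d) (@derive_val _ _ _ _ _ _ _ d').
by move/eqP; rewrite mulf_eq0 oppr_eq0 pnatr_eq0/= => /eqP.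
Qed.

End CauchyDerivatives.

(** * Measurability of composite expressions *)

Section Measurability.
Context {d : measure_display} {T : measurableType d} {R : realType}.
Implicit Types f g : T -> R.

Lemma measurable_cosf f : measurable_fun setT f -> measurable_fun setT (fun x => cos (f x)).
Proof.
move=> mf; apply: (measurableT_comp _ mf).
by apply: continuous_measurable_fun; exact: continuous_cos.
Qed.

Lemma measurable_sinf f : measurable_fun setT f -> measurable_fun setT (fun x => sin (f x)).
Proof.
move=> mf; apply: (measurableT_comp _ mf).
by apply: continuous_measurable_fun; exact: continuous_sin.
Qed.

Lemma measurable_expRf f : measurable_fun setT f -> measurable_fun setT (fun x => expR (f x)).
Proof. by move=> mf; apply: (measurableT_comp _ mf); exact: measurable_expR. Qed.

Lemma measurable_oppf f : measurable_fun setT f -> measurable_fun setT (fun x => - f x).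
Proof. by move=> mf; apply: (measurableT_comp _ mf); exact: oppr_measurable. Qed.

Lemma measurable_normf f : measurable_fun setT f -> measurable_fun setT (fun x => `|f x|).
Proof. by move=> mf; apply: (measurableT_comp _ mf); exact: normr_measurable. Qed.

Lemma measurable_halflinef f : measurable_fun setT f -> measurable_fun setT (fun x => halfline (f x)).
Proof. by move=> mf; apply: (measurableT_comp _ mf); exact: measurable_halfline. Qed.

Lemma measurable_expnf n f : measurable_fun setT f -> measurable_fun setT (fun x => f x ^+ n).
Proof. exact: measurable_funX. Qed.

Lemma measurable_addf f g : measurable_fun setT f -> measurable_fun setT g ->
  measurable_fun setT (fun x => f x + g x).
Proof. exact: measurable_funD. Qed.

Lemma measurable_mulf f g : measurable_fun setT f -> measurable_fun setT g ->
  measurable_fun setT (fun x => f x * g x).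
Proof. exact: measurable_funM. Qed.

End Measurability.

Ltac measurable_step :=
  lazymatch goal with
  | |- measurable_fun _ ?F =>
    lazymatch F with
    | (fun _ => ?c) => exact: measurable_cst
    | (fun r => r) => exact: measurable_id
    | (fun r => fst r) => exact: measurable_fst
    | (fun r => snd r) => exact: measurable_snd
    | (fun r => (@?f r + @?g r)%R) => apply: (measurable_addf (f := f) (g := g))
    | (fun r => (- @?f r)%R) => apply: (measurable_oppf (f := f))
    | (fun r => (@?f r ^+ ?n)%R) => apply: (@measurable_expnf _ _ _ n f)
    | (fun r => (@?f r * @?g r)%R) => apply: (measurable_mulf (f := f) (g := g))
    | (fun r => cos (@?f r)) => apply: (measurable_cosf (f := f))
    | (fun r => sin (@?f r)) => apply: (measurable_sinf (f := f))
    | (fun r => expR (@?f r)) => apply: (measurable_expRf (f := f))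
    | (fun r => (`| @?f r |)%R) => apply: (measurable_normf (f := f))
    | (fun r => halfline (@?f r)) => apply: (measurable_halflinef (f := f))
    end
  end.

Ltac measurable_tac := repeat measurable_step.

(** * Moments of a characteristic function *)

Section Fourier.
Context {R : realType}.
Notation lm := (@lebesgue_measure R).

Lemma norm_cos_le1 (x : R) : `|cos x| <= 1.
Proof. by rewrite ler_norml cos_geN1 cos_le1. Qed.

Lemma norm_sin_le1 (x : R) : `|sin x| <= 1.
Proof. by rewrite ler_norml sin_geN1 sin_le1. Qed.

Lemma integrable_halfline_gamma n (y : R) (c : R -> R) : 0 < y ->
  measurable_fun setT c -> (forall r, `|c r| <= 1) ->
  lm.-integrable setT (EFin \o (fun r => halfline r * (r ^+ n * expR (- (y * r)) * c r))).
Proof.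
move=> y0 mc c1.
apply: (integrable_bounded_by (mu := lm) (g := fun r => halfline r * (r ^+ n * expR (- (y * r))))).
- by measurable_tac.
- exact: integrable_halfline_pow_expR.
- apply: (halfline_norm_le (a := fun r => r ^+ n * expR (- (y * r)) * c r) (b := fun r => r ^+ n * expR (- (y * r)))) => r r0.
  have h : 0 <= r ^+ n * expR (- (y * r)) by rewrite mulr_ge0 ?exprn_ge0 ?expR_ge0.
  by rewrite normrM ger0_norm// ler_piMr.
Qed.

(** With w = y + i t, [gamma_cos] - i [gamma_sin] is the integral of r^n exp (- w r) over r >= 0,
    that is n! / w^(n+1). *)
Definition gamma_cos n (y t : R) : R :=
  \int[lm]_r (halfline r * (r ^+ n * expR (- (y * r)) * cos (r * t))).

Definition gamma_sin n (y t : R) : R :=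
  \int[lm]_r (halfline r * (r ^+ n * expR (- (y * r)) * sin (r * t))).

(** Integration by parts: the derivatives of r^n exp (- y r) cos (r t) and r^n exp (- y r) sin (r t)
    integrate over the half-line to minus their values at 0, and the only nonzero one is 1, for the
    cosine with n = 0. The predecessor of 0 is harmless because of the factor n. *)
Lemma gamma_fourier_rec n (y t : R) : 0 < y ->
  n%:R * gamma_cos n.-1 y t - y * gamma_cos n y t - t * gamma_sin n y t = - (n == 0)%:R /\
  n%:R * gamma_sin n.-1 y t - y * gamma_sin n y t + t * gamma_cos n y t = 0.
Proof.
move=> y0; pose C m := gamma_cos m y t; pose S m := gamma_sin m y t.
have mc : measurable_fun setT (fun r : R => cos (r * t)) by measurable_tac.
have ms : measurable_fun setT (fun r : R => sin (r * t)) by measurable_tac.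
have iC m : lm.-integrable setT (EFin \o (fun r => halfline r * (r ^+ m * expR (- (y * r)) * cos (r * t)))).
  by apply: integrable_halfline_gamma => // r; exact: norm_cos_le1.
have iS m : lm.-integrable setT (EFin \o (fun r => halfline r * (r ^+ m * expR (- (y * r)) * sin (r * t)))).
  by apply: integrable_halfline_gamma => // r; exact: norm_sin_le1.
have iZ (a : R) (h : R -> R) : lm.-integrable setT (EFin \o h) -> lm.-integrable setT (EFin \o (fun r => a * h r)).
  by move=> ih; exact: (integrableZl measurableT a ih).
pose X m r : R := r ^+ m * expR (- (y * r)) * cos (r * t).
pose Y m r : R := r ^+ m * expR (- (y * r)) * sin (r * t).
have dX (r : R) : is_derive r 1 (X n) (n%:R * X n.-1 r - y * X n r - t * Y n r).
  by rewrite /X /Y; eapply is_derive_eq; [derive_tac|rewrite /=; ring].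
have dY (r : R) : is_derive r 1 (Y n) (n%:R * Y n.-1 r - y * Y n r + t * X n r).
  by rewrite /X /Y; eapply is_derive_eq; [derive_tac|rewrite /=; ring].
have cX m : continuous (X m).
  by apply: is_derive_continuous => r; rewrite /X; derive_tac.
have cY m : continuous (Y m).
  by apply: is_derive_continuous => r; rewrite /Y; derive_tac.
have EX : \int[lm]_r (halfline r * (n%:R * X n.-1 r - y * X n r - t * Y n r)) = n%:R * C n.-1 - y * C n - t * S n.
  transitivity (\int[lm]_r (n%:R * (halfline r * X n.-1 r) - y * (halfline r * X n r) - t * (halfline r * Y n r))).
    by apply: eq_Rintegral => r _; ring.
  rewrite RintegralB//; [|exact: (integrableB measurableT (iZ _ _ (iC _)) (iZ _ _ (iC _)))|exact: (iZ _ _ (iS _))].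
  rewrite RintegralB//; [|exact: (iZ _ _ (iC _))|exact: (iZ _ _ (iC _))].
  by rewrite !RintegralZl//; [exact: iS|exact: iC|exact: iC].
have EY : \int[lm]_r (halfline r * (n%:R * Y n.-1 r - y * Y n r + t * X n r)) = n%:R * S n.-1 - y * S n + t * C n.
  transitivity (\int[lm]_r (n%:R * (halfline r * Y n.-1 r) - y * (halfline r * Y n r) + t * (halfline r * X n r))).
    by apply: eq_Rintegral => r _; ring.
  rewrite RintegralD//; [|exact: (integrableB measurableT (iZ _ _ (iS _)) (iZ _ _ (iS _)))|exact: (iZ _ _ (iC _))].
  rewrite RintegralB//; [|exact: (iZ _ _ (iS _))|exact: (iZ _ _ (iS _))].
  by rewrite !RintegralZl//; [exact: iC|exact: iS|exact: iS].
have iX : lm.-integrable setT (fun r => (halfline r * (n%:R * X n.-1 r - y * X n r - t * Y n r))%:E).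
  have := integrableB measurableT (integrableB measurableT (iZ n%:R _ (iC n.-1)) (iZ y _ (iC n))) (iZ t _ (iS n)).
  by apply: eq_integrable => // r _ /=; rewrite -!EFinB; congr EFin; rewrite /X /Y; ring.
have iY : lm.-integrable setT (fun r => (halfline r * (n%:R * Y n.-1 r - y * Y n r + t * X n r))%:E).
  have := integrableD measurableT (integrableB measurableT (iZ n%:R _ (iS n.-1)) (iZ y _ (iS n))) (iZ t _ (iC n)).
  by apply: eq_integrable => // r _ /=; rewrite -!EFinB -EFinD; congr EFin; rewrite /X /Y; ring.
have X0 : X n 0 = (n == 0)%:R.
  by rewrite /X mulr0 mul0r oppr0 expR0 cos0 !mulr1 expr0n.
have Y0 : Y n 0 = 0 by rewrite /Y mul0r sin0 mulr0.
rewrite -EX -EY; split.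
  rewrite (Rintegral_halfline_FTC (G := X n) (l := 0)) ?X0 ?sub0r//.
  - move=> r; apply: cvgB; last by apply: cvgMr; exact: cY.
    by apply: cvgB; apply: cvgMr; exact: cX.
  - apply: (cvg_pow_expR n y0 (c := fun r => cos (r * t))) => r; exact: norm_cos_le1.
rewrite (Rintegral_halfline_FTC (G := Y n) (l := 0)) ?Y0 ?subr0//.
- move=> r; apply: cvgD; last by apply: cvgMr; exact: cX.
  by apply: cvgB; apply: cvgMr; exact: cY.
- apply: (cvg_pow_expR n y0 (c := fun r => sin (r * t))) => r; exact: norm_sin_le1.
Qed.

(** The recursion is a linear 2 x 2 system of determinant y^2 + t^2; solving it amounts to
    multiplying by 1 / (y + i t) at each step. *)
Lemma gamma_fourier n (y t : R) : 0 < y ->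
  gamma_cos n y t = n`!%:R * complex.Re (cinvpow n.+1 y t) /\
  gamma_sin n y t = - (n`!%:R * complex.Im (cinvpow n.+1 y t)).
Proof.
move=> y0.
have q0 : y ^+ 2 + t ^+ 2 != 0 by rewrite gt_eqF// sqrD_gt0.
have solve (a b c s : R) : a = y * c + t * s -> b = y * s - t * c ->
    c = (a * y - b * t) / (y ^+ 2 + t ^+ 2) /\ s = (a * t + b * y) / (y ^+ 2 + t ^+ 2).
  by move=> -> ->; split; field.
elim: n => [|n [IHc IHs]].
  have [e1 e2] := gamma_fourier_rec 0 t y0.
  have h1 : 1 = y * gamma_cos 0 y t + t * gamma_sin 0 y t by simpl in e1; lra.
  have h2 : 0 = y * gamma_sin 0 y t - t * gamma_cos 0 y t by simpl in e2; lra.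
  have [-> ->] := solve _ _ _ _ h1 h2.
  by rewrite fact0 cinvpow1; split; rewrite /=; field.
have [e1 e2] := gamma_fourier_rec n.+1 t y0.
have z : (n.+1 == 0%N) = false by [].
rewrite [n.+1.-1]/= IHc IHs ?z ?mulr0n ?oppr0 in e1 e2.
have h1 : n.+1%:R * (n`!%:R * complex.Re (cinvpow n.+1 y t)) = y * gamma_cos n.+1 y t + t * gamma_sin n.+1 y t by lra.
have h2 : n.+1%:R * - (n`!%:R * complex.Im (cinvpow n.+1 y t)) = y * gamma_sin n.+1 y t - t * gamma_cos n.+1 y t by lra.
have [-> ->] := solve _ _ _ _ h1 h2.
rewrite (cinvpowS n.+1) Re_mulc Im_mulc factS natrM cinvpow1.
move: (complex.Re (cinvpow n.+1 y t)) (complex.Im (cinvpow n.+1 y t)) => a b.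
by split; rewrite /=; field.
Qed.

(** Superposes Re (z exp (- i q t)) over q with the weight q^n exp (- y q); [c] is room for the
    damping factor, which does not depend on q. *)
Lemma gamma_fourier_Re n (y t c : R) (z : R[i]) : 0 < y ->
  \int[lm]_q (halfline q * (q ^+ n * expR (- (y * q))) *
     ((complex.Re z * cos (q * t) + complex.Im z * sin (q * t)) * c)) =
  n`!%:R * (complex.Re (z * cinvpow n.+1 y t) * c).
Proof.
move=> y0.
have mc : measurable_fun setT (fun r : R => cos (r * t)) by measurable_tac.
have ms : measurable_fun setT (fun r : R => sin (r * t)) by measurable_tac.
have iC : lm.-integrable setT (EFin \o (fun r => halfline r * (r ^+ n * expR (- (y * r)) * cos (r * t)))).
  by apply: integrable_halfline_gamma => // r; exact: norm_cos_le1.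
have iS : lm.-integrable setT (EFin \o (fun r => halfline r * (r ^+ n * expR (- (y * r)) * sin (r * t)))).
  by apply: integrable_halfline_gamma => // r; exact: norm_sin_le1.
transitivity (\int[lm]_q
   (c * complex.Re z * (halfline q * (q ^+ n * expR (- (y * q)) * cos (q * t))) +
    c * complex.Im z * (halfline q * (q ^+ n * expR (- (y * q)) * sin (q * t))))).
  by apply: eq_Rintegral => q _; ring.
rewrite RintegralD//; [|exact: (integrableZl measurableT _ iC)|exact: (integrableZl measurableT _ iS)].
rewrite !RintegralZl//.
have [Ec Es] := gamma_fourier n t y0; rewrite /gamma_cos /gamma_sin in Ec Es; rewrite Ec Es.
by rewrite Re_mulc; ring.
Qed.

Lemma integrable_expR_norm (e : R) : 0 < e ->
  lm.-integrable setT (EFin \o (fun t => expR (- (e * `|t|)))).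
Proof.
move=> e0.
have i1 := integrable_halfline_expR e0.
have [i2 _] := Rintegral_opp (f := fun r => halfline r * expR (- (e * r))) i1.
apply: (integrable_bounded_by (mu := lm) (g := fun t => halfline t * expR (- (e * t)) + halfline (- t) * expR (- (e * - t)))).
- by measurable_tac.
- exact: (integrableD measurableT i1 i2).
- move=> t /=; rewrite ger0_norm ?expR_ge0//; case: (ltP t 0) => t0.
    rewrite ltr0_norm// halfline_lt0E// halfline_ge0E; last by rewrite oppr_ge0 ltW.
    by rewrite mul0r add0r mul1r.
  rewrite ger0_norm// halfline_ge0E// mul1r lerDl.
  by rewrite mulr_ge0 ?halfline_ge0 ?expR_ge0.
Qed.

Lemma integrable_mul_expR_norm (e : R) (c : R -> R) (M : R) : 0 < e ->
  measurable_fun setT c -> (forall t, `|c t| <= M) ->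
  lm.-integrable setT (EFin \o (fun t => c t * expR (- (e * `|t|)))).
Proof.
move=> e0 mc cM.
apply: (integrable_bounded_by (mu := lm) (g := fun t => M * expR (- (e * `|t|)))).
- by measurable_tac.
- exact: (integrableZl measurableT M (integrable_expR_norm e0)).
- by move=> t; rewrite normrM [`|expR _|]ger0_norm ?expR_ge0// ler_wpM2r ?expR_ge0.
Qed.

(** The Fourier transform of the damping factor is 2 pi times a Poisson kernel: this is the source
    of positivity for characteristic functions. *)
Lemma cos_expR_norm_integral (e c : R) : 0 < e ->
  \int[lm]_t (cos (t * c) * expR (- (e * `|t|))) = 2 * e / (e ^+ 2 + c ^+ 2).
Proof.
move=> e0.
have mc : measurable_fun setT (fun t : R => cos (t * c)) by measurable_tac.
rewrite Rintegral_fold; last first.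
  by apply: (integrable_mul_expR_norm (M := 1)) => // t; exact: norm_cos_le1.
transitivity (\int[lm]_r (2 * (halfline r * (r ^+ 0 * expR (- (e * r)) * cos (r * c))))).
  apply: eq_Rintegral => r _; case: (ltP r 0) => r0.
    by rewrite halfline_lt0E// !mul0r mulr0.
  by rewrite mulNr cosN normrN ger0_norm// expr0; ring.
rewrite RintegralZl//; last by apply: integrable_halfline_gamma => // r; exact: norm_cos_le1.
have [E _] := gamma_fourier 0 c e0; rewrite /gamma_cos in E; rewrite E.
by rewrite cinvpow1/= fact0 mul1r mulrA.
Qed.

Lemma sin_expR_norm_integral (e c : R) : 0 < e ->
  \int[lm]_t (sin (t * c) * expR (- (e * `|t|))) = 0.
Proof.
move=> e0.
have mc : measurable_fun setT (fun t : R => sin (t * c)) by measurable_tac.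
rewrite Rintegral_fold; last first.
  by apply: (integrable_mul_expR_norm (M := 1)) => // t; exact: norm_sin_le1.
transitivity (\int[lm]_r 0).
  by apply: eq_Rintegral => r _; rewrite mulNr sinN normrN; ring.
by rewrite /Rintegral integral0.
Qed.

End Fourier.

(** * Nonnegativity of the moments from that of damped transforms *)

Section Direct.
Context {R : realType}.
Notation lm := (@lebesgue_measure R).
Implicit Types f g : R -> R[i].

Lemma norm_mul_expR_norm_le (a e t : R) : 0 <= e -> `|a * expR (- (e * `|t|))| <= `|a|.
Proof.
move=> e0; rewrite normrM ler_piMr// ger0_norm ?expR_ge0// expR_le1 oppr_le0.
exact: mulr_ge0.
Qed.

(** The bound on [g] and the damping together make the double integral in q and t absolutely
    convergent. Once the q-integral has been carried out, the kernel decays in t on its own and the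
    damping can be removed. *)
Lemma moments_ge0_of_fourier g (M : R) : admissible g ->
  (forall t, cabs (g t) <= M) ->
  (forall e q, 0 < e -> 0 <= \int[lm]_t
     ((complex.Re (g t) * cos (q * t) + complex.Im (g t) * sin (q * t)) * expR (- (e * `|t|)))) ->
  moments_ge0 g.
Proof.
move=> ag gM H0 n y y0; have [[m1 m2] gi] := ag.
(* [H0] is hidden under an existential so that [//] does not try to apply it. *)
have := ex_intro (fun=> _) tt H0; move=> HB {H0}.
have M0 : 0 <= M by rewrite (le_trans _ (gM 0))// cabs_ge0.
have gRe t : `|complex.Re (g t)| <= M by rewrite (le_trans (Re_le_cabs _)).
have gIm t : `|complex.Im (g t)| <= M by rewrite (le_trans (Im_le_cabs _)).
have [mk1 mk2] := measurable_cinvpow n.+1 y0.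
have mg := measurable_Re_mul (conj m1 m2) (measurable_cinvpow n.+1 y0).
have trig_le q t : `|complex.Re (g t) * cos (q * t) + complex.Im (g t) * sin (q * t)| <= 2 * M.
  rewrite (le_trans (ler_normD _ _))// !normrM mulr_natl mulr2n.
  by apply: lerD; rewrite -[leRHS]mulr1; apply: ler_pM; rewrite ?norm_cos_le1 ?norm_sin_le1.
pose J (e : R) := \int[lm]_t (complex.Re (g t * cinvpow n.+1 y t) * expR (- (e * `|t|))).
have J0 e : 0 < e -> 0 <= J e.
  move=> e0.
  pose F (q t : R) := halfline q * (q ^+ n * expR (- (y * q))) *
     ((complex.Re (g t) * cos (q * t) + complex.Im (g t) * sin (q * t)) * expR (- (e * `|t|))).
  have Fb q t : `|F q t| <= halfline q * (q ^+ n * expR (- (y * q))) * (2 * M * expR (- (e * `|t|))).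
    rewrite /F normrM ger0_norm; last first.
      case: (ltP q 0) => q0; first by rewrite halfline_lt0E// mul0r.
      by rewrite !mulr_ge0 ?halfline_ge0 ?exprn_ge0 ?expR_ge0.
    case: (ltP q 0) => q0; first by rewrite halfline_lt0E// !mul0r.
    apply: ler_wpM2l; first by rewrite !mulr_ge0 ?halfline_ge0 ?exprn_ge0 ?expR_ge0.
    rewrite normrM [`|expR _|]ger0_norm ?expR_ge0//; apply: ler_wpM2r; first exact: expR_ge0.
    exact: trig_le.
  have mF : measurable_fun setT (fun z : measurableTypeR R * measurableTypeR R => F z.1 z.2).
    rewrite /F; measurable_tac.
    - exact: (measurableT_comp m1 measurable_snd).
    - exact: (measurableT_comp m2 measurable_snd).
  have Fub := @Rintegral_Fubini_prod _ _ _ _ R lm lm F _ _ mF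
     (integrable_halfline_pow_expR n y0) (integrableZl measurableT (2 * M) (integrable_expR_norm e0)) Fb.
  have EJ : \int[lm]_t \int[lm]_q F q t = n`!%:R * J e.
    transitivity (\int[lm]_t (n`!%:R * (complex.Re (g t * cinvpow n.+1 y t) * expR (- (e * `|t|))))); last first.
      apply: RintegralZl; first exact: measurableT.
      apply: (integrable_bounded_by (mu := lm) (g := fun t => `|complex.Re (g t * cinvpow n.+1 y t)|)).
      - by measurable_tac.
      - by apply: (integrable_norm (mu := lm)); exact: integrable_cauchy_moment.
      - by move=> t; apply: norm_mul_expR_norm_le; exact: ltW.
    apply: eq_Rintegral => t _.
    exact: gamma_fourier_Re.
  have nf : 0 < n`!%:R :> R by rewrite ltr0n fact_gt0.
  rewrite -(pmulr_rge0 _ nf) -EJ -Fub; clear EJ Fub mF Fb.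
  apply: Rintegral_ge0 => q _; rewrite /F RintegralZl//; last first.
    apply: (integrable_mul_expR_norm (M := 2 * M)) => //.
      by measurable_tac.
  case: (ltP q 0) => q0; first by rewrite halfline_lt0E// !mul0r.
  by rewrite !mulr_ge0 ?halfline_ge0 ?exprn_ge0 ?expR_ge0//; case: HB => _; apply.
(* The undamped integrand is integrable by admissibility and dominates all the damped ones. *)
have cv : J k.+1%:R^-1 @[k --> \oo] --> cauchy_moment g n.+1 y.
  apply: (Rintegral_dominated_cvg (mu := lm) (g := fun t => `|complex.Re (g t * cinvpow n.+1 y t)|)) => //.
  - by move=> k; measurable_tac.
  - apply: aeW => t /=.
    have h : expR (- (k.+1%:R^-1 * `|t|)) @[k --> \oo] --> expR (- (0 * `|t|)).
      apply: continuous_cvg; first exact: continuous_expR.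
      by apply: cvgN; apply: cvgMl; exact: cvg_harmonic.
    rewrite mul0r oppr0 expR0 in h.
    by rewrite -[X in _ --> X]mulr1; apply: cvgMr.
  - by apply: (integrable_norm (mu := lm)); exact: integrable_cauchy_moment.
  - by move=> k t; exact: norm_mul_expR_norm_le.
rewrite -(cvg_lim _ cv)//; apply: limr_ge; first by apply/cvg_ex; eexists; exact: cv.
by apply: nearW => k; apply: J0.
Qed.

(** The damped transform of [f] at q is the [sigma]-average of 2 e / (e^2 + (s - q)^2), hence
    nonnegative. For - i f and i f the averaged quantity is a sine transform of an even function,
    which is 0; both signs of inequality then hold. *)
Lemma characteristic_function_moments f : admissible f -> characteristic_function f ->
  [/\ moments_ge0 f, moments_ge0 (fun t => - 'i * f t) & moments_ge0 (fun t => 'i * f t)].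
Proof.
move=> af [sigma fE]; have [[m1 m2] gi] := af.
have mc (t : R) : measurable_fun setT (fun s : R => cos (t * s)) by measurable_tac.
have ms (t : R) : measurable_fun setT (fun s : R => sin (t * s)) by measurable_tac.
have isig (h : R -> R) : measurable_fun setT h -> (forall s, `|h s| <= 1) -> sigma.-integrable setT (EFin \o h).
  move=> mh h1; apply: (integrable_bounded_by (mu := sigma) (g := fun=> 1)) => //.
  exact: finite_measure_integrable_cst.
have ReE t : complex.Re (f t) = Rintegral sigma setT (fun s => cos (t * s)).
  by rewrite fE.
have ImE t : complex.Im (f t) = Rintegral sigma setT (fun s => sin (t * s)).
  by rewrite fE.
have bound (h : R -> R) : measurable_fun setT h -> (forall s, `|h s| <= 1) -> `|Rintegral sigma setT h| <= 1.
  move=> mh h1; rewrite (le_trans (le_normr_Rintegral _ (isig _ mh h1)))//.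
  have -> : 1 = Rintegral sigma setT (fun=> 1).
    rewrite Rintegral_cst// mul1r; transitivity (fine (1%E : \bar R)) => //; congr fine; apply/esym; exact: probability_setT.
  apply: le_Rintegral => //.
  + by apply: (isig (fun x => `|h x|)); [measurable_tac|move=> s; rewrite normr_id].
  + by apply: (isig (fun x => 1)) => // s; rewrite normr1.
have fb t : cabs (f t) <= 2.
  apply: cabs_le => //.
  have h1 : `|complex.Re (f t)| <= 1 by rewrite ReE; apply: bound => // s; exact: norm_cos_le1.
  have h2 : `|complex.Im (f t)| <= 1 by rewrite ImE; apply: bound => // s; exact: norm_sin_le1.
  rewrite -(real_normK (num_real (complex.Re (f t)))) -(real_normK (num_real (complex.Im (f t)))).
  have := normr_ge0 (complex.Re (f t)); have := normr_ge0 (complex.Im (f t)); nra.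
have mm (e q : R) : measurable_fun setT (fun z : measurableTypeR R * R => cos (z.1 * (z.2 - q)) * expR (- (e * `|z.1|))) /\
   measurable_fun setT (fun z : measurableTypeR R * R => sin (z.1 * (z.2 - q)) * expR (- (e * `|z.1|))).
  by split; measurable_tac.
have one_int : sigma.-integrable setT (EFin \o (fun=> 1 : R)) by apply: isig => // s; rewrite normr1.
have Ecos (e q : R) : 0 < e -> \int[lm]_t ((complex.Re (f t) * cos (q * t) + complex.Im (f t) * sin (q * t)) * expR (- (e * `|t|))) =
    Rintegral sigma setT (fun s => 2 * e / (e ^+ 2 + (s - q) ^+ 2)).
  move=> e0.
  transitivity (\int[lm]_t Rintegral sigma setT (fun s => cos (t * (s - q)) * expR (- (e * `|t|)))).
    apply: eq_Rintegral => t _.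
    rewrite RintegralZr//; last first.
      by apply: isig => [|s]; [measurable_tac|exact: norm_cos_le1].
    congr (_ * _); rewrite ReE ImE -!RintegralZr//; [|by apply: isig => // s; exact: norm_sin_le1|by apply: isig => // s; exact: norm_cos_le1].
    rewrite -RintegralD//.
    + apply: eq_Rintegral => s _; rewrite mulrBr cosB [t * q]mulrC; ring.
    + have := integrableZr measurableT (cos (q * t)) (isig _ (mc t) (fun s => norm_cos_le1 _)).
      by [].
    + have := integrableZr measurableT (sin (q * t)) (isig _ (ms t) (fun s => norm_sin_le1 _)).
      by [].
  rewrite (@Rintegral_Fubini_prod _ _ _ _ R lm sigma _ (fun t => expR (- (e * `|t|))) (fun=> 1) (mm e q).1 (integrable_expR_norm e0) one_int); last first.
    move=> t s; rewrite mulr1 normrM [`|expR _|]ger0_norm ?expR_ge0//.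
    by rewrite ler_piMl ?expR_ge0 ?norm_cos_le1.
  by apply: eq_Rintegral => s _; rewrite cos_expR_norm_integral.
have Esin (e q : R) : 0 < e -> \int[lm]_t ((complex.Im (f t) * cos (q * t) - complex.Re (f t) * sin (q * t)) * expR (- (e * `|t|))) = 0.
  move=> e0.
  transitivity (\int[lm]_t Rintegral sigma setT (fun s => sin (t * (s - q)) * expR (- (e * `|t|)))).
    apply: eq_Rintegral => t _.
    rewrite RintegralZr//; last first.
      by apply: isig => [|s]; [measurable_tac|exact: norm_sin_le1].
    congr (_ * _); rewrite ReE ImE -!RintegralZr//; [|by apply: isig => // s; exact: norm_cos_le1|by apply: isig => // s; exact: norm_sin_le1].
    rewrite -RintegralB//.
    + apply: eq_Rintegral => s _; rewrite mulrBr sinB [t * q]mulrC; ring.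
    + have := integrableZr measurableT (cos (q * t)) (isig _ (ms t) (fun s => norm_sin_le1 _)).
      by [].
    + have := integrableZr measurableT (sin (q * t)) (isig _ (mc t) (fun s => norm_cos_le1 _)).
      by [].
  rewrite (@Rintegral_Fubini_prod _ _ _ _ R lm sigma _ (fun t => expR (- (e * `|t|))) (fun=> 1) (mm e q).2 (integrable_expR_norm e0) one_int); last first.
    move=> t s; rewrite mulr1 normrM [`|expR _|]ger0_norm ?expR_ge0//.
    by rewrite ler_piMl ?expR_ge0 ?norm_sin_le1.
  transitivity (Rintegral sigma setT (fun=> 0)).
    by apply: eq_Rintegral => s _; rewrite sin_expR_norm_integral.
  by rewrite /Rintegral integral0.
split.
- apply: (moments_ge0_of_fourier af fb) => e q e0; rewrite Ecos//.
  apply: Rintegral_ge0 => s _; rewrite divr_ge0//; first by rewrite mulr_ge0// ltW.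
  by rewrite addr_ge0// sqr_ge0.
- apply: (@moments_ge0_of_fourier _ 2 (admissibleNi af)) => [t|e q e0]; first by rewrite cabsNi.
  rewrite le_eqVlt; apply/orP; left; apply/eqP/esym; rewrite -[RHS](Esin e q e0).
  by apply: eq_Rintegral => t _; rewrite Re_mulNi Im_mulNi mulNr.
- apply: (@moments_ge0_of_fourier _ 2 (admissible_i af)) => [t|e q e0]; first by rewrite cabsi.
  rewrite le_eqVlt; apply/orP; left; apply/eqP/esym; rewrite -[RHS]oppr0 -[in RHS](Esin e q e0).
  rewrite -mulN1r -RintegralZl//; last first.
    apply: (integrable_mul_expR_norm (M := 4)) => //; first by measurable_tac.
    move=> t; rewrite (le_trans (ler_normB _ _))// !normrM.
    have h1 := le_trans (Re_le_cabs (f t)) (fb t).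
    have h2 := le_trans (Im_le_cabs (f t)) (fb t).
    have h3 := norm_cos_le1 (q * t); have h4 := norm_sin_le1 (q * t).
    have := normr_ge0 (complex.Re (f t)); have := normr_ge0 (complex.Im (f t)).
    have := normr_ge0 (cos (q * t)); have := normr_ge0 (sin (q * t)); nra.
  by apply: eq_Rintegral => t _; rewrite Re_muli Im_muli; ring.
Qed.

End Direct.

(** * The distribution function built from the moments *)

Section Elementary.
Context {R : realType}.

Lemma norm_sub0_le (g dg : R -> R) (B x : R) : (forall u : R, is_derive u 1 g (dg u)) ->
  (forall u, `|u| <= `|x| -> `|dg u| <= B) -> `|g x - g 0| <= B * `|x|.
Proof.
move=> dgP gB; have cg := is_derive_continuous dgP.
case: (leP 0 x) => x0.
  have [|c + ->] := @MVT_segment R g dg 0 x x0 (fun u _ => dgP u); first exact: continuous_subspaceT.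
  rewrite in_itv/= => /andP[c0 cx]; rewrite subr0 normrM ler_wpM2r// gB//.
  by rewrite !ger0_norm.
have [|c + E] := @MVT_segment R g dg x 0 (ltW x0) (fun u _ => dgP u); first exact: continuous_subspaceT.
rewrite in_itv/= => /andP[cx c0]; rewrite distrC E sub0r normrM normrN ler_wpM2r// gB//.
by rewrite !ler0_norm ?lerN2 // ltW.
Qed.

Lemma norm_sin_le (x : R) : `|sin x| <= `|x|.
Proof.
have := @norm_sub0_le sin cos 1 x (fun u => is_derive_sin u) (fun u _ => norm_cos_le1 u).
by rewrite sin0 subr0 mul1r.
Qed.

(** A third-order error survives multiplication by n: applied at th / n, it leaves an error of order
    1 / n^2. *)
Lemma norm_atan_sub_le (x : R) : `|atan x - x| <= x ^+ 2 * `|x|.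
Proof.
have dF (u : R) : is_derive u 1 (fun u => atan u - u) ((1 + u ^+ 2)^-1 - 1).
  by apply: is_derive_subf (is_derive_idf u).
have := @norm_sub0_le _ _ (x ^+ 2) x dF; rewrite atan0 !subr0; apply => u ux.
have u2 : 0 <= u ^+ 2 by exact: sqr_ge0.
have ux2 : u ^+ 2 <= x ^+ 2.
  by rewrite -(real_normK (num_real u)) -(real_normK (num_real x)) ler_sqr ?nnegrE.
have -> : (1 + u ^+ 2)^-1 - 1 = - (u ^+ 2 / (1 + u ^+ 2)).
  by field; rewrite gt_eqF//; lra.
rewrite normrN ger0_norm; last by rewrite divr_ge0//; lra.
rewrite ler_pdivrMr; last by lra.
nra.
Qed.

Lemma cvg_nat_atan (th : R) : n.+1%:R * atan (th / n.+1%:R) @[n --> \oo] --> th.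
Proof.
apply/subr_cvg0; apply: norm_cvg0.
apply: (@squeeze_cvgr _ _ _ _ (cst 0) (fun n : nat => th ^+ 2 * `|th| * n.+1%:R^-1)).
- apply: nearW => n; rewrite normr_ge0/=.
  have N0 : (0 : R) < n.+1%:R by [].
  have N1 : (1 : R) <= n.+1%:R by rewrite ler1n.
  have -> : n.+1%:R * atan (th / n.+1%:R) - th = n.+1%:R * (atan (th / n.+1%:R) - th / n.+1%:R).
    by field; rewrite gt_eqF.
  rewrite normrM ger0_norm//.
  have H := norm_atan_sub_le (th / n.+1%:R).
  rewrite (le_trans (ler_wpM2l (ltW N0) H))// normrM [`|_^-1|]ger0_norm ?invr_ge0//.
  have -> : n.+1%:R * ((th / n.+1%:R) ^+ 2 * (`|th| / n.+1%:R)) = th ^+ 2 * `|th| * (n.+1%:R^-1 * n.+1%:R^-1).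
    by field; rewrite gt_eqF.
  apply: ler_wpM2l; first by rewrite mulr_ge0// sqr_ge0.
  by rewrite ler_piMr ?invr_ge0// invf_le1.
- exact: cvg_cst.
- rewrite -[X in _ --> X](mulr0 (th ^+ 2 * `|th|)).
  by apply: cvgMr; exact: cvg_harmonic.
Qed.

Lemma cos_atan_sqr (x : R) : cos (atan x) ^+ 2 = (1 + x ^+ 2)^-1.
Proof. by rewrite cos_atan exprVn sqr_sqrtr// addr_ge0// sqr_ge0. Qed.

Lemma cos_atan_gt0 (x : R) : 0 < cos (atan x).
Proof. by rewrite cos_atan invr_gt0 sqrtr_gt0 ltr_wpDr// sqr_ge0. Qed.

Lemma sin_atan (x : R) : sin (atan x) = x * cos (atan x).
Proof. by rewrite -{2}(atanK x) /tan divfK// gt_eqF// cos_atan_gt0. Qed.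

(** With x = th / N and N = n + 1, one has cos (atan x) >= cos (atan x)^2 = 1 / (1 + x^2) >= exp (-
    x^2), so the N-th power lies between 1 - th^2 / N and 1. *)
Lemma cvg_cos_atan_pow (th : R) : cos (atan (th / n.+1%:R)) ^+ n.+1 @[n --> \oo] --> (1 : R).
Proof.
apply: (@squeeze_cvgr _ _ _ _ (fun n : nat => 1 - th ^+ 2 * n.+1%:R^-1) (cst 1)).
- apply: nearW => n /=.
  have N0 : (0 : R) < n.+1%:R by [].
  set x := th / n.+1%:R; have c0 := cos_atan_gt0 x; have c1 := cos_le1 (atan x).
  apply/andP; split; last by rewrite exprn_ile1// ltW.
  have u0 : 0 <= x ^+ 2 by exact: sqr_ge0.
  have h1 : expR (- x ^+ 2) <= cos (atan x).
    apply: (@le_trans _ _ (cos (atan x) ^+ 2)); last by rewrite expr2 ler_piMl// ltW.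
    rewrite cos_atan_sqr expRN lef_pV2 ?posrE ?expR_gt0//; last by lra.
    exact: expR_ge1Dx.
  apply: (@le_trans _ _ (expR (- x ^+ 2) ^+ n.+1)); last by rewrite lerXn2r ?nnegrE ?expR_ge0// ltW.
  rewrite -expRM_natr (le_trans _ (expR_ge1Dx _))// lerD2l.
  by rewrite mulNr lerN2 /x; rewrite le_eqVlt; apply/orP; left; apply/eqP; field; rewrite gt_eqF.
- rewrite -[X in _ --> X]subr0 -(mulr0 (th ^+ 2)); apply: cvgB; first exact: cvg_cst.
  by apply: cvgMr; exact: cvg_harmonic.
- exact: cvg_cst.
Qed.

Lemma polar_pow (c phi : R) n : ((c * cos phi) +i* (- (c * sin phi))) ^+ n =
  (c ^+ n * cos (n%:R * phi)) +i* (- (c ^+ n * sin (n%:R * phi))).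
Proof.
elim: n => [|n IH]; first by rewrite !expr0 mul0r cos0 sin0 mulr0 mulr1 oppr0.
rewrite exprSr IH -[n.+1]addn1 natrD mulrDl mul1r cosD sinD addn1 exprSr.
by apply/eqP; rewrite eq_complex; apply/andP; split; apply/eqP; rewrite /=; ring.
Qed.

Lemma cabsD (z w : R[i]) : cabs (z + w) <= cabs z + cabs w.
Proof.
apply: cabs_le; first by rewrite addr_ge0 ?cabs_ge0.
have H : complex.Re z * complex.Re w + complex.Im z * complex.Im w <= cabs z * cabs w.
  rewrite -(cabs_conj w) -cabsM (le_trans _ (Re_le_cabs _))// (le_trans _ (ler_norm _))//.
  by rewrite Re_mulc; case: w => c d /=; rewrite mulrN opprK.
have -> : complex.Re (z + w) = complex.Re z + complex.Re w by case: z {H} w => [? ?] [? ?].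
have -> : complex.Im (z + w) = complex.Im z + complex.Im w by case: z {H} w => [? ?] [? ?].
have := cabs_sqr z; have := cabs_sqr w; nra.
Qed.

Lemma cabs_real (x : R) : cabs x%:C = `|x|.
Proof. by rewrite /cabs/= expr0n addr0 sqrtr_sqr. Qed.

Lemma cabs0 : cabs (0 : R[i]) = 0.
Proof. by have := cabs_real 0; rewrite normr0. Qed.

Lemma cabsX (z : R[i]) n : cabs (z ^+ n) = cabs z ^+ n.
Proof.
elim: n => [|n IH]; first by rewrite !expr0 (_ : 1 = 1%:C)// cabs_real normr1.
by rewrite !exprS cabsM IH.
Qed.

Lemma cabs_sum n (F : nat -> R[i]) : cabs (\sum_(k < n) F k) <= \sum_(k < n) cabs (F k).
Proof.
elim: n => [|n IH]; first by rewrite !big_ord0 cabs0.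
by rewrite !big_ord_recr/= (le_trans (cabsD _ _))// lerD2r.
Qed.

(** Adds the bound [s], good near the origin, to the bound 2 / T, good at infinity. The same
    constant then serves the step kernel and all its approximations. *)
Lemma le_kernel_bound (x s T : R) : x <= s -> 0 <= T -> x * T <= 2 -> x <= (s + 2) / (1 + T).
Proof. by move=> xs T0 xT; rewrite ler_pdivlMr; [nra|lra]. Qed.

End Elementary.

(** * The cumulative function as a limit of Taylor polynomials *)

Section CumulativeFunction.
Context {R : realType}.
Notation lm := (@lebesgue_measure R).
Implicit Types f : R -> R[i].

(* (1 - exp (- i s t)) / (i t), with value 0 at t = 0 *)
Definition step_kernel (s t : R) : R[i] :=
  (sin (s * t) / t) +i* (- ((1 - cos (s * t)) / t)).

Lemma step_kernel0 t : step_kernel 0 t = 0.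
Proof. by rewrite /step_kernel mul0r sin0 cos0 subrr !mul0r oppr0. Qed.

(** The modulus is 2 |sin (s t / 2)| / |t|, the length of a chord of the unit circle divided by |t|:
    at most |s|, and at most 2 / |t|. *)
Lemma cabs_step_kernel (s t : R) : cabs (step_kernel s t) <= (`|s| + 2) / (1 + `|t|).
Proof.
have [->|t0] := eqVneq t 0.
  rewrite /step_kernel invr0 !mulr0 oppr0 -[0 +i* 0]/(0 : R[i]) cabs0 divr_ge0//.
have half : cos (s * t) = 1 - 2 * sin (s * t / 2) ^+ 2.
  have -> : s * t = s * t / 2 + s * t / 2 by field.
  rewrite cosD; have := cos2Dsin2 ((s * t / 2 + s * t / 2) / 2).
  have -> : (s * t / 2 + s * t / 2) / 2 = s * t / 2 by field.
  by move=> h; nra.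
have sq : complex.Re (step_kernel s t) ^+ 2 + complex.Im (step_kernel s t) ^+ 2 = (2 * sin (s * t / 2) / t) ^+ 2.
  rewrite /step_kernel/=.
  have e : sin (s * t) ^+ 2 = 1 - cos (s * t) ^+ 2 by have := cos2Dsin2 (s * t); lra.
  transitivity ((sin (s * t) ^+ 2 + (1 - cos (s * t)) ^+ 2) / t ^+ 2); first by field.
  by rewrite e half; field.
apply: le_kernel_bound => //.
  apply: cabs_le => //; rewrite sq (real_normK (num_real s)) -(real_normK (num_real s)) -[leLHS]real_normK ?num_real//.
  rewrite ler_sqr ?nnegrE// !normrM normfV ler_pdivrMr ?normr_gt0//.
  have := norm_sin_le (s * t / 2); rewrite !normrM normfV.
  rewrite [`|2|]ger0_norm//; set a := `|sin _|; set b := `|s|; set c := `|t|; nra.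
rewrite -(ler_pdivlMr _ _ (_ : 0 < `|t|)) ?normr_gt0//.
apply: cabs_le; first by rewrite divr_ge0.
rewrite sq -[leLHS]real_normK ?num_real// ler_sqr ?nnegrE ?divr_ge0// !normrM normfV.
by rewrite ler_wpM2r ?invr_ge0// ger0_norm// ler_piMr// norm_sin_le1.
Qed.

(** A pointwise limit of continuous functions, including at t = 0, where the approximants and the
    inverse of 0 are all 0. *)
Lemma measurable_invr : measurable_fun setT (fun t : R => t^-1).
Proof.
apply: (@measurable_fun_cvg _ _ R setT (fun n (t : R) => t / (t ^+ 2 + n.+1%:R^-1))) => [n|t _].
  apply: measurable_mulf => //; apply: continuous_measurable_fun.
  have p (t : R) : 0 < t ^+ 2 + n.+1%:R^-1 by rewrite ltr_wpDl ?sqr_ge0// invr_gt0.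
  apply: (@is_derive_continuous _ _ (fun t => - (2 * t) / (t ^+ 2 + n.+1%:R^-1) ^+ 2)) => t.
  apply: is_derive_invf; first by rewrite gt_eqF.
  by eapply is_derive_eq; [derive_tac|rewrite /= addr0].
have [->|t0] := eqVneq t 0.
  by under eq_cvg do rewrite mul0r; rewrite invr0; exact: cvg_cst.
rewrite (_ : t^-1 = t / (t ^+ 2 + 0)); last by field.
apply: cvgMr; apply: cvgV; first by rewrite addr0 sqrf_eq0.
by apply: cvgD; [exact: cvg_cst|exact: cvg_harmonic].
Qed.

Lemma measurable_step_kernel (s : R) : cmeasurable (step_kernel s).
Proof.
have mV := measurable_invr.
by split; rewrite /step_kernel/=; measurable_tac.
Qed.

Definition cumul f (s : R) : R := \int[lm]_t complex.Re (f t * step_kernel s t).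

Lemma integrable_cumul f s : admissible f ->
  lm.-integrable setT (EFin \o (fun t => complex.Re (f t * step_kernel s t))).
Proof.
move=> af; apply: (integrable_Re_mul af (measurable_step_kernel s)).
by move=> t; exact: cabs_step_kernel.
Qed.

Lemma cumul0 f : cumul f 0 = 0.
Proof.
rewrite /cumul (_ : (fun t => _) = (fun=> 0)) ?/Rintegral ?integral0//.
by apply/funext => t; rewrite step_kernel0 mulr0.
Qed.

Lemma cumul_continuous f : admissible f -> continuous (cumul f).
Proof.
move=> af s.
(* The constant |s| + 3 bounds |x| + 2 over the window of radius 1 around s. *)
have H := @continuity_under_integral R _ _ lm (fun s t => complex.Re (f t * step_kernel s t)) setT measurableT
  (s - 1) (s + 1) _ _ (fun t => (`|s| + 3) * (cabs (f t) / (1 + `|t|))) _ _ s.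
apply: H.
- by move=> x _; exact: integrable_cumul.
- apply: aeW => t _ x _.
  have cc : continuous (fun s => complex.Re (f t * step_kernel s t)).
    rewrite (_ : (fun s => _) = (fun s => complex.Re (f t) * (sin (s * t) * t^-1) + complex.Im (f t) * ((1 - cos (s * t)) * t^-1))); last first.
      by apply/funext => u; rewrite Re_mulc/= mulrN opprK.
    by apply: is_derive_continuous => u; derive_tac.
  exact: cc.
- exact: integrable_dominating.
- move=> x; rewrite /= in_itv/= => /andP[x1 x2]; apply: aeW => t _.
  apply: Re_mul_le; rewrite (le_trans (cabs_step_kernel _ _))//.
  apply: ler_wpM2r; first by rewrite invr_ge0; have := normr_ge0 t; lra.
  have : `|x| <= `|s| + `|x - s| by rewrite (le_trans _ (ler_normD _ _))// addrC subrK.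
  have : `|x - s| <= 1 by rewrite ler_norml; apply/andP; split; lra.
  lra.
- by rewrite inE/= in_itv/=; apply/andP; split; lra.
Qed.

(** The Taylor polynomial of v -> 1 / (v + i t) about v = y, truncated to degrees below n and
    evaluated at v = 0. *)
Definition taylor_kernel n (y t : R) : R[i] := \sum_(k < n) (y%:C ^+ k * cinvpow k.+1 y t).

(** A geometric sum of ratio y / w, where w = y + i t and 1 - y / w = i t / w. The factor i t is
    kept on the left so that t = 0 need not be excluded. *)
Lemma taylor_kernelE n (y t : R) : 0 < y ->
  taylor_kernel n y t * ('i * t%:C) = 1 - (y%:C * cinvpow 1 y t) ^+ n.
Proof.
move=> y0.
have w0 : y +i* t != 0 by rewrite eq_complex/= negb_and gt_eqF.
pose w := (y +i* t)^-1.
have e1 : cinvpow 1 y t = w by rewrite /cinvpow expr1.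
have ew : 1 - y%:C * w = 'i * t%:C * w.
  apply: (mulIf w0); rewrite mulrBl -!mulrA mulVf// !mulr1 mul1r.
  by apply/eqP; rewrite eq_complex/=; apply/andP; split; apply/eqP; ring.
rewrite e1 -opprB subrX1 -mulNr opprB ew /taylor_kernel mulr_suml mulr_sumr.
apply: eq_bigr => k _; rewrite exprMn /cinvpow -/w exprS.
by move: (w ^+ k) (y%:C ^+ k) => a b; ring.
Qed.

Lemma cabs_rotation (y t : R) : 0 < y -> cabs (cinvpow 1 y t) <= y^-1.
Proof.
move=> y0; apply: cabs_le; first by rewrite invr_ge0 ltW.
rewrite -cabs_sqr cabs_cinvpow1_sqr// exprVn lef_pV2 ?posrE ?sqrD_gt0 ?exprn_gt0//.
by rewrite lerDl sqr_ge0.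
Qed.

(** The ratio y / w has modulus at most 1. Hence the n + 1 terms are at most 1 / y each, with sum (n
    + 1) / y = s, while [taylor_kernelE] bounds the product with |t| by 2. The result is uniform in
    n, ready for dominated convergence. *)
Lemma cabs_taylor_kernel n (s t : R) : 0 < s ->
  cabs (taylor_kernel n.+1 (n.+1%:R / s) t) <= (s + 2) / (1 + `|t|).
Proof.
move=> s0; set y := n.+1%:R / s.
have y0 : 0 < y by rewrite divr_gt0.
have r1 : cabs (y%:C * cinvpow 1 y t) <= 1.
  rewrite cabsM cabs_real gtr0_norm// (le_trans (ler_wpM2l (ltW y0) (cabs_rotation t y0)))//.
  by rewrite divff// gt_eqF.
apply: le_kernel_bound => //.
  rewrite (le_trans (cabs_sum _ (fun k => y%:C ^+ k * cinvpow k.+1 y t)))//.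
  apply: (@le_trans _ _ (\sum_(k < n.+1) y^-1)).
    apply: ler_sum => k _; rewrite cinvpowS mulrA cabsM -[leRHS]mul1r.
    apply: ler_pM; rewrite ?cabs_ge0 ?cabs_rotation//.
    rewrite (_ : _ * _ = (y%:C * cinvpow 1 y t) ^+ k); last by rewrite exprMn /cinvpow expr1.
    by rewrite cabsX exprn_ile1 ?cabs_ge0.
  by rewrite sumr_const card_ord -[leLHS]mulr_natr /y invf_div -mulrA mulVf ?mulr1.
have E : cabs (taylor_kernel n.+1 y t) * `|t| = cabs (1 - (y%:C * cinvpow 1 y t) ^+ n.+1).
  by rewrite -taylor_kernelE// cabsM cabsi cabs_real.
rewrite E (le_trans (cabsD _ _))//.
have -> : cabs (1 : R[i]) = 1 by rewrite /cabs/= expr0n expr1n addr0 sqrtr1.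
have -> : forall z : R[i], cabs (- z) = cabs z by move=> [a b]; rewrite /cabs/= !sqrrN.
have : cabs ((y%:C * cinvpow 1 y t) ^+ n.+1) <= 1 by rewrite cabsX exprn_ile1 ?cabs_ge0.
lra.
Qed.

(** With N = n + 1 and tan a = s t / N, the ratio is 1 / (1 + i tan a) = cos a exp (- i a); its N-th
    power has modulus [C n], tending to 1, and argument - [A n], tending to - s t. At t = 0 the
    Taylor kernels equal s whereas the step kernel is 0, so this point is excluded. *)
Lemma cvg_taylor_kernel (s t : R) : 0 < s -> t != 0 ->
  complex.Re (taylor_kernel n.+1 (n.+1%:R / s) t) @[n --> \oo] --> complex.Re (step_kernel s t) /\
  complex.Im (taylor_kernel n.+1 (n.+1%:R / s) t) @[n --> \oo] --> complex.Im (step_kernel s t).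
Proof.
move=> s0 t0.
pose C n := cos (atan (s * t / n.+1%:R)) ^+ n.+1.
pose A n := n.+1%:R * atan (s * t / n.+1%:R).
have cC : C n @[n --> \oo] --> (1 : R) by exact: cvg_cos_atan_pow.
have cA : A n @[n --> \oo] --> s * t by exact: cvg_nat_atan.
have E n : taylor_kernel n.+1 (n.+1%:R / s) t = (C n * sin (A n) / t) +i* (- ((1 - C n * cos (A n)) / t)).
  have N0 : (0 : R) < n.+1%:R by [].
  have y0 : 0 < n.+1%:R / s :> R by rewrite divr_gt0.
  have := taylor_kernelE n.+1 t y0.
  have -> : (n.+1%:R / s)%:C * cinvpow 1 (n.+1%:R / s) t =
    (cos (atan (s * t / n.+1%:R)) * cos (atan (s * t / n.+1%:R))) +i*
    (- (cos (atan (s * t / n.+1%:R)) * sin (atan (s * t / n.+1%:R)))).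
    rewrite sin_atan mulrCA -expr2 cos_atan_sqr cinvpow1.
    have q0 : n.+1%:R ^+ 2 + (s * t) ^+ 2 != 0 :> R by rewrite gt_eqF// sqrD_gt0.
    apply/eqP; rewrite eq_complex/=; apply/andP; split; apply/eqP; by (field; rewrite ?(gt_eqF s0) //= -/(1 + n%:R : R) nat1r (gt_eqF N0) q0).
  rewrite polar_pow -/(C n) -/(A n).
  case: (taylor_kernel _ _ _) => a b /eqP; rewrite eq_complex/= => /andP[/eqP h1 /eqP h2].
  apply/eqP; rewrite eq_complex/=; apply/andP; split; apply/eqP.
    by apply: (mulIf t0); rewrite divfK//; lra.
  by apply: (mulIf t0); rewrite mulNr divfK//; lra.
have h1 : C n * sin (A n) / t @[n --> \oo] --> 1 * sin (s * t) / t.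
  apply: cvgMl; apply: cvgM => //.
  by apply: continuous_cvg => //; exact: continuous_sin.
have h2 : - ((1 - C n * cos (A n)) / t) @[n --> \oo] --> - ((1 - 1 * cos (s * t)) / t).
  apply: cvgN; apply: cvgMl; apply: cvgB; first exact: cvg_cst.
  by apply: cvgM => //; apply: continuous_cvg => //; exact: continuous_cos.
rewrite mul1r in h1; rewrite mul1r in h2; split.
  rewrite (_ : (fun n => _) = (fun n => C n * sin (A n) / t)); first exact: h1.
  by apply/funext => n; rewrite E.
rewrite (_ : (fun n => _) = (fun n => - ((1 - C n * cos (A n)) / t))); first exact: h2.
by apply/funext => n; rewrite E.
Qed.

Lemma measurable_taylor_kernel n (y : R) : 0 < y -> cmeasurable (taylor_kernel n y).
Proof.
move=> y0; elim: n => [|n [IH1 IH2]].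
  rewrite (_ : taylor_kernel 0 y = (fun=> 0)); last by apply/funext => t; rewrite /taylor_kernel big_ord0.
  by split.
have [m1 m2] := measurable_cinvpow n.+1 y0.
have e (t : R) : taylor_kernel n.+1 y t = taylor_kernel n y t + (y ^+ n)%:C * cinvpow n.+1 y t.
  by rewrite /taylor_kernel big_ord_recr/= rmorphXn.
split.
  rewrite (_ : (fun t => _) = (fun t => complex.Re (taylor_kernel n y t) + y ^+ n * complex.Re (cinvpow n.+1 y t))); first by measurable_tac.
  by apply/funext => t; rewrite e; case: (taylor_kernel n y t) => a b; case: (cinvpow _ _ _) => c d /=; rewrite mul0r subr0.
rewrite (_ : (fun t => _) = (fun t => complex.Im (taylor_kernel n y t) + y ^+ n * complex.Im (cinvpow n.+1 y t))); first by measurable_tac.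
by apply/funext => t; rewrite e; case: (taylor_kernel n y t) => a b; case: (cinvpow _ _ _) => c d /=; rewrite mul0r addr0.
Qed.

(* Differentiating in y telescopes to [- n y^(n-1) * cauchy_moment f n.+1 y], so nonnegative
   moments make this nonincreasing in y; with y = n/s its kernel tends to [step_kernel s]. *)
Definition taylor_moment f n (y : R) : R := \sum_(k < n) y ^+ k * cauchy_moment f k.+1 y.

Lemma taylor_momentE f n y : admissible f -> 0 < y ->
  lm.-integrable setT (EFin \o (fun t => complex.Re (f t * taylor_kernel n y t))) /\
  taylor_moment f n y = \int[lm]_t complex.Re (f t * taylor_kernel n y t).
Proof.
move=> af y0; elim: n => [|n [IHi IH]].
  rewrite (_ : (fun t => _) = (fun=> 0)); last first.
    by apply/funext => t; rewrite /taylor_kernel big_ord0 mulr0.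
  split; first exact: integrable0.
  by rewrite /taylor_moment big_ord0 /Rintegral integral0.
have im := integrable_cauchy_moment n af y0.
rewrite (_ : (fun t => _) = (fun t => complex.Re (f t * taylor_kernel n y t) + y ^+ n * complex.Re (f t * cinvpow n.+1 y t))); last first.
  apply/funext => t; rewrite /taylor_kernel big_ord_recr/= -rmorphXn mulrDr mulrCA.
  by case: (f t * _) => a b; case: (f t * _) => c d /=; rewrite mul0r subr0.
split; first exact: (integrableD measurableT IHi (integrableZl measurableT (y ^+ n) im)).
rewrite RintegralD//; last exact: (integrableZl measurableT (y ^+ n) im).
by rewrite RintegralZl// -IH /taylor_moment big_ord_recr.
Qed.

Lemma is_derive_taylor_moment f n (y : R) : admissible f -> 0 < y ->
  is_derive y 1 (taylor_moment f n) (- (n%:R * y ^+ n.-1 * cauchy_moment f n.+1 y)).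
Proof.
move=> af y0; elim: n => [|n IH].
  rewrite !mul0r oppr0 (_ : taylor_moment f 0 = (fun=> 0)); first exact: is_derive_cstf.
  by apply/funext => u; rewrite /taylor_moment big_ord0.
rewrite (_ : taylor_moment f n.+1 = (fun u => taylor_moment f n u + u ^+ n * cauchy_moment f n.+1 u)); last first.
  by apply/funext => u; rewrite /taylor_moment big_ord_recr.
apply: (is_derive_eq (is_derive_addf IH (is_derive_mulf (is_derive_expnf n y) (is_derive_cauchy_moment n af y0)))).
by rewrite /= -[n.+1]addn1 natrD; ring.
Qed.

Lemma taylor_moment_nincr f n (a b : R) : admissible f -> moments_ge0 f ->
  0 < a -> a <= b -> taylor_moment f n b <= taylor_moment f n a.
Proof.
move=> af pf a0 ab.
have d (u : R) : a <= u -> is_derive u 1 (taylor_moment f n) (- (n%:R * u ^+ n.-1 * cauchy_moment f n.+1 u)).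
  by move=> au; apply: is_derive_taylor_moment => //; exact: lt_le_trans au.
apply: (@ler0_derive1_nincr _ _ a b) => //.
- by move=> u; rewrite in_itv/= => /andP[/ltW au _]; have [] := d u au.
- move=> u; rewrite in_itv/= => /andP[/ltW au _]; have H := d u au.
  have u0 := lt_le_trans a0 au.
  by rewrite derive1E derive_val oppr_le0 mulr_ge0 ?pf// mulr_ge0// exprn_ge0// ltW.
- apply: derivable_within_continuous => u; rewrite in_itv/= => /andP[au _].
  by have [] := d u au.
Qed.

Lemma cvg_taylor_moment f (s : R) : admissible f -> 0 < s ->
  taylor_moment f n.+1 (n.+1%:R / s) @[n --> \oo] --> cumul f s.
Proof.
move=> af s0.
have y0 n : 0 < n.+1%:R / s :> R by rewrite divr_gt0.
under eq_cvg do rewrite (taylor_momentE _ af (y0 _)).2.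
have mf := af.1.
apply: (Rintegral_dominated_cvg (mu := lm) (g := fun t => (s + 2) * (cabs (f t) / (1 + `|t|)))).
- by move=> n; apply: measurable_Re_mul => //; exact: measurable_taylor_kernel.
- by apply: measurable_Re_mul => //; exact: measurable_step_kernel.
- exists [set 0]; split => //; first exact: lebesgue_measure_set1.
  move=> t /= H; apply: contrapT => /eqP t0; apply: H.
  have [h1 h2] := cvg_taylor_kernel s0 t0.
  under eq_cvg do rewrite Re_mulc.
  by rewrite Re_mulc; apply: cvgB; apply: cvgMr.
- exact: integrable_dominating.
- by move=> n t; apply: Re_mul_le; exact: cabs_taylor_kernel.
Qed.

Lemma cumul_ndecr f (a b : R) : admissible f -> moments_ge0 f ->
  0 <= a -> a <= b -> cumul f a <= cumul f b.
Proof.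
move=> af pf.
have pos u v : 0 < u -> u <= v -> cumul f u <= cumul f v.
  move=> u0 uv; have v0 := lt_le_trans u0 uv.
  apply: (ler_cvg_to (cvg_taylor_moment af u0) (cvg_taylor_moment af v0)).
  apply: nearW => n; apply: taylor_moment_nincr => //; first by rewrite divr_gt0.
  by rewrite ler_wpM2l// lef_pV2.
(* No y = n / s corresponds to s = 0; this endpoint is reached by continuity along 1 / (n + 1). *)
rewrite le_eqVlt => /predU1P[<-|a0]; last exact: pos.
rewrite le_eqVlt => /predU1P[<-//|b0].
have c1 : cumul f n.+1%:R^-1 @[n --> \oo] --> cumul f 0.
  by apply: continuous_cvg; [exact: cumul_continuous|exact: cvg_harmonic].
apply: (ler_cvg_to c1 (cvg_cst (cumul f b))).
near=> n; apply: pos => //; near: n.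
have := @cvg_harmonic R; move/cvgrPdist_lt => /(_ _ b0).
apply: filterS => n; rewrite sub0r normrN => h; apply/ltW.
by rewrite (le_lt_trans (ler_norm _)).
Unshelve. all: by end_near. Qed.

(** The cumulative functions of - i f and i f are opposite to each other, and both start at 0 and
    are nondecreasing. The one of - i f is the imaginary part of the integral of f against the step
    kernel, which is therefore real. *)
Lemma cumulNi_eq0 f (s : R) : admissible f -> moments_ge0 (fun t => - 'i * f t) ->
  moments_ge0 (fun t => 'i * f t) -> 0 <= s -> cumul (fun t => - 'i * f t) s = 0.
Proof.
move=> af p1 p2 s0; apply/eqP; rewrite eq_le; apply/andP; split.
  have := cumul_ndecr (admissible_i af) p2 (lexx 0) s0; rewrite cumul0.
  have -> : cumul (fun t => 'i * f t) s = - cumul (fun t => - 'i * f t) s.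
    rewrite /cumul -[RHS]mulN1r -RintegralZl//; last exact: integrable_cumul (admissibleNi af).
    apply: eq_Rintegral => t _; rewrite !mulNr mul1r.
    by case: ('i * f t * step_kernel s t) => a b /=; rewrite opprK.
  by rewrite oppr_ge0.
by have := cumul_ndecr (admissibleNi af) p1 (lexx 0) s0; rewrite cumul0.
Qed.

End CumulativeFunction.

(** * Laplace transform of the Stieltjes measure *)

Section StieltjesLaplace.
Context {R : realType}.
Notation lm := (@lebesgue_measure R).

Lemma stieltjes_measure_exists (F : R -> R) : {homo F : a b / a <= b} -> continuous F ->
  exists mu : {sigma_finite_measure set (measurableTypeR R) -> \bar R},
    forall a b, a <= b -> mu `]a, b]%classic = (F b - F a)%:E.
Proof.
move=> ndF cF.
have rcF : right_continuous F by exact: right_continuousW.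
pose mF := isCumulative.Build _ _ _ F ndF rcF.
pose cF' : cumulative R R := HB.pack F mF.
exists (lebesgue_stieltjes_measure cF') => a b ab.
rewrite /= /lebesgue_stieltjes_measure /measure_extension measurable_mu_extE/=; last exact: is_ocitv.
by rewrite wlength_itv_bnd.
Qed.

Definition posline (s : R) : R := 1 - halfline (- s).

Lemma posline_gt0E s : 0 < s -> posline s = 1.
Proof. by move=> s0; rewrite /posline halfline_lt0E ?oppr_lt0// subr0. Qed.

Lemma posline_le0E s : s <= 0 -> posline s = 0.
Proof. by move=> s0; rewrite /posline halfline_ge0E ?oppr_ge0// subrr. Qed.

Lemma measurable_posline : measurable_fun setT posline.
Proof. by rewrite /posline; measurable_tac. Qed.

Lemma posline_ge0 s : 0 <= posline s.
Proof. by case: (ltP 0 s) => s0; [rewrite posline_gt0E|rewrite posline_le0E]. Qed.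

Lemma posline_halflineE (s r : R) : posline s * halfline (r - s) = \1_(`]0, r]%classic) s.
Proof.
rewrite indicE; case: (ltP 0 s) => s0; last first.
  by rewrite posline_le0E// mul0r memNset//= in_itv/=; apply/negP; rewrite negb_and -leNgt s0.
rewrite posline_gt0E// mul1r; case: (leP s r) => sr.
  by rewrite halfline_ge0E ?subr_ge0// mem_set//= in_itv/= s0 sr.
by rewrite halfline_lt0E ?subr_lt0// memNset//= in_itv/=; apply/negP; rewrite negb_and -[X in _ || X]ltNge sr orbT.
Qed.

Lemma integrable_halfline_affine_expR (y : R) : 0 < y ->
  lm.-integrable setT (EFin \o (fun r => halfline r * ((r + 2) * expR (- (y * r))))).
Proof.
move=> y0.
have i1 := integrable_halfline_pow_expR 1 y0.
have i0 := integrableZl measurableT (2 : R) (integrable_halfline_pow_expR 0 y0).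
have := integrableD measurableT i1 i0.
by apply: eq_integrable => // r _ /=; rewrite -EFinD; congr EFin; rewrite expr1 expr0; ring.
Qed.

(** Integration by parts in Stieltjes form. As h' = - c and h tends to 0, h(s) is the integral of c
    over [s, +oo[; Fubini on the region 0 < s <= r then replaces the measure by its distribution
    function. Linear growth of [F] against exponential decay of [c] gives absolute convergence. *)
Lemma stieltjes_laplace (mu : {sigma_finite_measure set (measurableTypeR R) -> \bar R})
    (F c h : R -> R) (D K y : R) :
  continuous F -> (forall r, 0 <= r -> mu `]0, r]%classic = (F r)%:E) ->
  (forall r, 0 <= r -> 0 <= F r <= D * (r + 2)) ->
  0 < y -> continuous c -> (forall r : R, is_derive r 1 h (- c r)) ->
  (forall r, 0 <= r -> `|c r| <= K * expR (- (y * r))) ->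
  (forall s, h (s + n%:R) @[n --> \oo] --> 0) ->
  mu.-integrable setT (EFin \o (fun s => posline s * h s)) /\
  Rintegral mu setT (fun s => posline s * h s) = \int[lm]_r (halfline r * (c r * F r)).
Proof.
move=> cF muF FD y0 cc dh cK h0.
have mc : measurable_fun setT c by exact: continuous_measurable_fun.
have mF : measurable_fun setT F by exact: continuous_measurable_fun.
have mp := measurable_posline.
have K0 : 0 <= K.
  by have := cK 0 (lexx _); rewrite mulr0 oppr0 expR0 mulr1; apply: le_trans.
pose N s r := c r * (posline s * halfline (r - s)).
have mN : measurable_fun setT (fun z : measurableTypeR R * measurableTypeR R => N z.1 z.2).
  rewrite /N; measurable_tac.
  - exact: (measurableT_comp mc measurable_snd).
  - exact: (measurableT_comp mp measurable_fst).
have muI r : (\int[mu]_s (\1_(`]0, r]%classic) s)%:E = (halfline r * F r)%:E)%E.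
  rewrite integral_indic// setIT; case: (leP 0 r) => r0.
    by rewrite halfline_ge0E// mul1r; exact: muF.
  by rewrite set_itv_ge ?bnd_simp -?leNgt ?ltW// measure0 halfline_lt0E// mul0r.
have normN r : (\int[mu]_s `|N s r|%:E = (halfline r * (`|c r| * F r))%:E)%E.
  transitivity (\int[mu]_s (`|c r|%:E * (\1_(`]0, r]%classic) s)%:E))%E.
    apply: eq_integral => s _; rewrite /N posline_halflineE -EFinM normrM; congr (_ * _)%:E.
    by rewrite ger0_norm// indicE.
  rewrite ge0_integralZl//; last by apply/measurable_EFinP; exact: measurable_indic.
  by rewrite muI -EFinM mulrCA.
have iD : lm.-integrable setT (EFin \o (fun r => halfline r * (`|c r| * F r))).
  apply: (integrable_bounded_by (mu := lm) (g := fun r => K * D * (halfline r * ((r + 2) * expR (- (y * r)))))).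
  - by measurable_tac.
  - exact: (integrableZl measurableT (K * D) (integrable_halfline_affine_expR y0)).
  - move=> r; rewrite [leRHS]mulrCA.
    apply: (halfline_norm_le (a := fun r => `|c r| * F r) (b := fun r => K * D * ((r + 2) * expR (- (y * r))))) => {}r r0.
    have /andP[F0 F1] := FD r r0.
    rewrite normrM normr_id (ger0_norm F0).
    have -> : K * D * ((r + 2) * expR (- (y * r))) = (K * expR (- (y * r))) * (D * (r + 2)) by ring.
    by apply: ler_pM => //; exact: cK.
have mN' : measurable_fun setT (fun z : measurableTypeR R * measurableTypeR R => (N z.1 z.2)%:E).
  exact/measurable_EFinP.
have iN : (mu \x lm)%E.-integrable setT (fun z => (N z.1 z.2)%:E).
  apply/(integrable21ltyP _ _ mN') => /=.
  have /integrableP[_] := iD; apply: le_lt_trans.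
  rewrite le_eqVlt; apply/orP; left; apply/eqP/eq_integral => r _.
  have E := normN r; transitivity ((halfline r * (`|c r| * F r))%:E) => //=.
  have h1 : 0 <= halfline r * (`|c r| * F r) by rewrite -lee_fin -E; apply: integral_ge0.
  by rewrite (ger0_norm h1).
have N_r s : lm.-integrable setT (EFin \o N s).
  apply: (integrable_bounded_by (mu := lm) (g := fun r => K * (halfline r * expR (- (y * r))))).
  - exact: (measurableT_comp mN (pair1_measurable s)).
  - exact: (integrableZl measurableT K (integrable_halfline_expR y0)).
  - move=> r; rewrite /N normrM posline_halflineE indicE.
    case: (boolP (s \in `]0, r]%classic)) => [|_]; last first.
      by rewrite normr0 mulr0 mulr_ge0// mulr_ge0 ?halfline_ge0 ?expR_ge0.
    rewrite inE/= in_itv/= => /andP[s0 sr]; have r0 := le_trans (ltW s0) sr.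
    by rewrite normr1 mulr1 halfline_ge0E// mul1r cK.
have N_s r : mu.-integrable setT (EFin \o N ^~ r).
  apply/integrableP; split.
    apply/measurable_EFinP; exact: (measurableT_comp mN (pair2_measurable r)).
  by rewrite (normN r) ltry.
have Nr_int s : \int[lm]_r N s r = posline s * h s.
  case: (leP s 0) => s0.
    rewrite posline_le0E// mul0r -[RHS](_ : \int[lm]_r 0 = 0); last by rewrite /Rintegral integral0.
    by apply: eq_Rintegral => r _; rewrite /N posline_le0E// mul0r mulr0.
  transitivity (\int[lm]_r (halfline (r - s) * c r)).
    by apply: eq_Rintegral => r _; rewrite /N posline_gt0E// mul1r mulrC.
  have dG (r : R) : is_derive r 1 (fun r => - h r) (c r).
    by rewrite -[c r]opprK; apply: is_derive_oppf; exact: dh.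
  have iG : lm.-integrable setT (fun r => (halfline (r - s) * c r)%:E).
    have := N_r s; apply: eq_integrable => // r _ /=.
    by rewrite /N posline_gt0E// mul1r mulrC.
  have lim : - h (s + n%:R) @[n --> \oo] --> - 0 by apply: cvgN.
  by rewrite (Rintegral_ray_FTC cc dG iG lim) posline_gt0E// oppr0 sub0r opprK mul1r.
have Ns_int r : Rintegral mu setT (N ^~ r) = halfline r * (c r * F r).
  rewrite /N RintegralZl//; last first.
    apply/integrableP; split; first by apply/measurable_EFinP; measurable_tac.
    under eq_integral.
      move=> s _; rewrite /= ger0_norm; last by rewrite mulr_ge0 ?posline_ge0 ?halfline_ge0.
      rewrite posline_halflineE.
      over.
    by rewrite muI ltry.
  have -> : Rintegral mu setT (fun s => posline s * halfline (r - s)) = halfline r * F r.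
    rewrite /Rintegral; under eq_integral do rewrite posline_halflineE.
    by rewrite muI.
  by rewrite mulrCA.
split.
  have := integrable_fubini_F iN; apply: eq_integrable => // s _ /=.
  rewrite /fubini_F/= -Nr_int /Rintegral fineK//.
  exact: (integrable_fin_num measurableT (N_r s)).
transitivity (Rintegral mu setT (fun s => \int[lm]_r N s r)).
  by apply: eq_Rintegral => s _; rewrite Nr_int.
rewrite (Rintegral_Fubini iN N_r N_s).
by apply: eq_Rintegral => r _; rewrite Ns_int.
Qed.

End StieltjesLaplace.

(** * Complex exponential kernels and the half-line measures *)

Section LaplaceKernel.
Context {R : realType}.
Notation lm := (@lebesgue_measure R).
Implicit Types f : R -> R[i].

(** The bound is hidden so that boundedness of trigonometric expressions can be composed without
    tracking constants. *)
Definition bounded_real (b : R -> R) := exists M, forall r, `|b r| <= M.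

Lemma bounded_real_cst c : bounded_real (fun=> c).
Proof. by exists `|c|. Qed.

Lemma bounded_real_cos g : bounded_real (fun r => cos (g r)).
Proof. by exists 1 => r; exact: norm_cos_le1. Qed.

Lemma bounded_real_sin g : bounded_real (fun r => sin (g r)).
Proof. by exists 1 => r; exact: norm_sin_le1. Qed.

Lemma bounded_real_add a b : bounded_real a -> bounded_real b -> bounded_real (fun r => a r + b r).
Proof. by move=> [M aM] [N bN]; exists (M + N) => r; rewrite (le_trans (ler_normD _ _))// lerD. Qed.

Lemma bounded_real_opp a : bounded_real a -> bounded_real (fun r => - a r).
Proof. by move=> [M aM]; exists M => r; rewrite normrN. Qed.

Lemma bounded_real_mul a b : bounded_real a -> bounded_real b -> bounded_real (fun r => a r * b r).
Proof. by move=> [M aM] [N bN]; exists (M * N) => r; rewrite normrM; apply: ler_pM. Qed.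

Lemma cvg_expR_bounded (y s : R) (b : R -> R) : 0 < y -> bounded_real b ->
  expR (- (y * (s + n%:R))) * b (s + n%:R) @[n --> \oo] --> 0.
Proof.
move=> y0 [M bM]; apply: norm_cvg0.
apply: (@squeeze_cvgr _ _ _ _ (cst 0) (fun n : nat => expR (- (y * s)) * M * expR (- (y * n%:R)))).
- apply: nearW => n; rewrite normr_ge0/= normrM ger0_norm ?expR_ge0//.
  rewrite mulrDr opprD expRD mulrAC ler_wpM2r ?expR_ge0//.
  by rewrite ler_wpM2l ?expR_ge0.
- exact: cvg_cst.
- rewrite -[X in _ --> X](mulr0 (expR (- (y * s)) * M)); apply: cvgMr.
  exact: cvg_expR_mul_nat.
Qed.

Definition exp_cos (y x r : R) := expR (- (y * r)) * cos (x * r).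
Definition exp_sin (y x r : R) := expR (- (y * r)) * sin (x * r).

(* - d/dr of exp (- (y - i x) r) *)
Definition exp_kernel (y x r : R) : R[i] :=
  (y * exp_cos y x r + x * exp_sin y x r) +i* (y * exp_sin y x r - x * exp_cos y x r).

Lemma is_derive_exp_cos (y x r : R) : is_derive r 1 (exp_cos y x) (- complex.Re (exp_kernel y x r)).
Proof.
rewrite /exp_kernel /exp_cos /exp_sin.
by eapply is_derive_eq; [derive_tac|rewrite /=; ring].
Qed.

Lemma is_derive_exp_sin (y x r : R) : is_derive r 1 (exp_sin y x) (- complex.Im (exp_kernel y x r)).
Proof.
rewrite /exp_kernel /exp_cos /exp_sin.
by eapply is_derive_eq; [derive_tac|rewrite /=; ring].
Qed.

Lemma cabs_exp_kernel y x r : 0 < y -> cabs (exp_kernel y x r) <= (y + `|x|) * expR (- (y * r)).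
Proof.
move=> y0; apply: cabs_le; first by rewrite mulr_ge0 ?expR_ge0// addr_ge0// ltW.
rewrite /exp_kernel /exp_cos /exp_sin/=; set e := expR _; set C := cos _; set S := sin _.
have cs : C ^+ 2 + S ^+ 2 = 1 by exact: cos2Dsin2.
have -> : (y * (e * C) + x * (e * S)) ^+ 2 + (y * (e * S) - x * (e * C)) ^+ 2 =
  (y ^+ 2 + x ^+ 2) * e ^+ 2 * (C ^+ 2 + S ^+ 2) by ring.
rewrite cs mulr1 exprMn ler_wpM2r ?sqr_ge0// -(real_normK (num_real x)).
have := normr_ge0 x; nra.
Qed.

Lemma continuous_exp_kernel y x : continuous (fun r => complex.Re (exp_kernel y x r)) /\
  continuous (fun r => complex.Im (exp_kernel y x r)).
Proof.
by split; apply: is_derive_continuous => r; rewrite /exp_kernel /exp_cos /exp_sin/=; derive_tac.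
Qed.

(** By parts: [exp_kernel] is minus the derivative of exp (- (y - i x) r), the step kernel vanishes
    at r = 0 and has derivative exp (- i r t). What remains is the integral of exp (- (y + i (t -
    x)) r), namely 1 / (y + i (t - x)). *)
Lemma exp_step_kernel_integral (y x t : R) : 0 < y -> t != 0 ->
  \int[lm]_r (halfline r * complex.Re (exp_kernel y x r * step_kernel r t)) =
    complex.Re (cinvpow 1 y (t - x)) /\
  \int[lm]_r (halfline r * complex.Im (exp_kernel y x r * step_kernel r t)) =
    complex.Im (cinvpow 1 y (t - x)).
Proof.
move=> y0 t0.
have q0 := sqrD_gt0 (t - x) y0; have qN0 := lt0r_neq0 q0.
have bnd r : 0 <= r -> cabs (exp_kernel y x r * step_kernel r t) <= (y + `|x|) * ((r + 2) * expR (- (y * r))).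
  move=> r0; rewrite cabsM mulrCA mulrC.
  apply: ler_pM; rewrite ?cabs_ge0 ?cabs_exp_kernel//.
  rewrite (le_trans (cabs_step_kernel _ _))// (ger0_norm r0) ler_pdivrMr.
    by have := normr_ge0 t; nra.
  by have := normr_ge0 t; lra.
pose g1 r := (y * exp_cos y x r + x * exp_sin y x r) * (sin (r * t) * t^-1) +
  (y * exp_sin y x r - x * exp_cos y x r) * ((1 - cos (r * t)) * t^-1).
pose g2 r := (y * exp_sin y x r - x * exp_cos y x r) * (sin (r * t) * t^-1) -
  (y * exp_cos y x r + x * exp_sin y x r) * ((1 - cos (r * t)) * t^-1).
have E1 r : complex.Re (exp_kernel y x r * step_kernel r t) = g1 r.
  by rewrite Re_mulc /g1 /= mulrN opprK.
have E2 r : complex.Im (exp_kernel y x r * step_kernel r t) = g2 r.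
  by rewrite Im_mulc /g2 /= mulrN addrC.
have c1 : continuous g1.
  by apply: is_derive_continuous => r; rewrite /g1 /exp_cos /exp_sin; derive_tac.
have c2 : continuous g2.
  by apply: is_derive_continuous => r; rewrite /g2 /exp_cos /exp_sin; derive_tac.
have integ (g : R -> R) : continuous g -> (forall r, 0 <= r -> `|g r| <= (y + `|x|) * ((r + 2) * expR (- (y * r)))) ->
    lm.-integrable setT (EFin \o (fun r => halfline r * g r)).
  move=> cg gb.
  apply: (integrable_bounded_by (mu := lm) (g := fun r => (y + `|x|) * (halfline r * ((r + 2) * expR (- (y * r)))))).
  - apply: measurable_funM; [exact: measurable_halfline|exact: continuous_measurable_fun].
  - exact: (integrableZl measurableT (y + `|x|) (integrable_halfline_affine_expR y0)).
  - move=> r; rewrite [leRHS]mulrCA.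
    exact: (halfline_norm_le (b := fun r => (y + `|x|) * ((r + 2) * expR (- (y * r))))).
(* Writing E(r) for exp (- (y - i x) r) and v for y + i (t - x), an antiderivative is - E(r)
   [step_kernel r t] - exp (- v r) / v. The real and imaginary parts of its product with exp (y r)
   are [b1] and [b2], with the angle (t - x) r expanded. *)
pose b1 r := - (cos (x * r) * (sin (r * t) * t^-1) + sin (x * r) * ((1 - cos (r * t)) * t^-1)) +
  (- y * (cos (r * t) * cos (x * r) + sin (r * t) * sin (x * r)) +
   (t - x) * (sin (r * t) * cos (x * r) - cos (r * t) * sin (x * r))) * (y ^+ 2 + (t - x) ^+ 2)^-1.
pose b2 r := - (sin (x * r) * (sin (r * t) * t^-1) - cos (x * r) * ((1 - cos (r * t)) * t^-1)) +
  (y * (sin (r * t) * cos (x * r) - cos (r * t) * sin (x * r)) +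
   (t - x) * (cos (r * t) * cos (x * r) + sin (r * t) * sin (x * r))) * (y ^+ 2 + (t - x) ^+ 2)^-1.
have bb1 : bounded_real b1.
  by rewrite /b1; do ?[apply: bounded_real_add|apply: bounded_real_opp|apply: bounded_real_cos|apply: bounded_real_sin|apply: bounded_real_cst|apply: bounded_real_mul].
have bb2 : bounded_real b2.
  by rewrite /b2; do ?[apply: bounded_real_add|apply: bounded_real_opp|apply: bounded_real_cos|apply: bounded_real_sin|apply: bounded_real_cst|apply: bounded_real_mul].
have lim0 b : bounded_real b -> expR (- (y * n%:R)) * b n%:R @[n --> \oo] --> 0.
  move=> bb; have := cvg_expR_bounded 0 y0 bb.
  by under eq_cvg do rewrite add0r.
split.
  transitivity (\int[lm]_r (halfline r * g1 r)); first by apply: eq_Rintegral => r _; rewrite E1.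
  have dG (r : R) : is_derive r 1 (fun r => expR (- (y * r)) * b1 r) (g1 r).
    rewrite /b1 /g1 /exp_cos /exp_sin.
    by eapply is_derive_eq; [derive_tac|rewrite /=; field; rewrite t0 qN0].
  rewrite (Rintegral_halfline_FTC c1 dG _ (lim0 _ bb1)).
  - rewrite /b1 mulr0 oppr0 expR0 !(mulr0, mul0r) cos0 sin0 cinvpow1 /=.
    by field; rewrite t0 qN0.
  - apply: integ => // r r0; rewrite -E1 (le_trans (Re_le_cabs _))//; exact: bnd.
transitivity (\int[lm]_r (halfline r * g2 r)); first by apply: eq_Rintegral => r _; rewrite E2.
have dG (r : R) : is_derive r 1 (fun r => expR (- (y * r)) * b2 r) (g2 r).
  rewrite /b2 /g2 /exp_cos /exp_sin.
  by eapply is_derive_eq; [derive_tac|rewrite /=; field; rewrite t0 qN0].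
rewrite (Rintegral_halfline_FTC c2 dG _ (lim0 _ bb2)).
- rewrite /b2 mulr0 oppr0 expR0 !(mulr0, mul0r) cos0 sin0 cinvpow1 /=.
  by field; rewrite t0 qN0.
- apply: integ => // r r0; rewrite -E2 (le_trans (Im_le_cabs _))//; exact: bnd.
Qed.

Lemma cabs_cinvpow_shift (y x t : R) : 0 < y ->
  cabs (cinvpow 1 y (t - x)) <= (1 + y^-1) * (1 + `|x|) / (1 + `|t|).
Proof.
move=> y0; rewrite (le_trans (cabs_cinvpow1_le (t - x) y0 (lexx y)))// -mulrA.
have yi : 0 < y^-1 by rewrite invr_gt0.
have h : `|t| <= `|t - x| + `|x| by rewrite (le_trans _ (ler_normD _ _))// subrK.
have h1 := normr_ge0 (t - x); have h2 := normr_ge0 x; have h3 := normr_ge0 t.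
apply: ler_wpM2l; first by lra.
rewrite -[_^-1]mul1r ler_pdivrMr; last by lra.
rewrite mulrAC ler_pdivlMr; last by lra.
nra.
Qed.

Lemma measurable_cinvpow_shift (y x : R) : 0 < y -> cmeasurable (fun t => cinvpow 1 y (t - x)).
Proof.
move=> y0; have [m1 m2] := measurable_cinvpow 1 y0.
have ms : measurable_fun setT (fun t : R => t - x) by measurable_tac.
by split; [exact: (measurableT_comp m1 ms)|exact: (measurableT_comp m2 ms)].
Qed.

Lemma integrable_cinvpow_shift f y x : admissible f -> 0 < y ->
  lm.-integrable setT (EFin \o (fun t => complex.Re (f t * cinvpow 1 y (t - x)))).
Proof.
move=> af y0; apply: (integrable_Re_mul af (measurable_cinvpow_shift x y0)) => t.
exact: cabs_cinvpow_shift.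
Qed.

Lemma Rintegral_linear_sub (a b : R) (g1 g2 : R -> R) :
  lm.-integrable setT (EFin \o g1) -> lm.-integrable setT (EFin \o g2) ->
  \int[lm]_t (a * g1 t - b * g2 t) = a * \int[lm]_t g1 t - b * \int[lm]_t g2 t.
Proof.
move=> i1 i2.
rewrite RintegralB//; [|exact: (integrableZl measurableT _ i1)|exact: (integrableZl measurableT _ i2)].
by rewrite RintegralZl// RintegralZl.
Qed.

(** At t = 0 the step kernel is 0 by convention and the left side vanishes; the last factor records
    this exception, which disappears on integrating in t. *)
Lemma exp_step_kernel_mul_integral (z : R[i]) (y x t : R) : 0 < y ->
  \int[lm]_r (halfline r * complex.Re (z * (exp_kernel y x r * step_kernel r t))) =
  complex.Re (z * cinvpow 1 y (t - x)) * (1 - \1_[set 0 : R] t).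
Proof.
move=> y0.
have [ck1 ck2] := continuous_exp_kernel y x.
have mk1 : measurable_fun setT (fun r => complex.Re (exp_kernel y x r)) by exact: continuous_measurable_fun.
have mk2 : measurable_fun setT (fun r => complex.Im (exp_kernel y x r)) by exact: continuous_measurable_fun.
have ia := integrableZl measurableT (y + `|x|) (integrable_halfline_affine_expR y0).
have [->|t0] := eqVneq t 0.
  rewrite indicE mem_set// subrr mulr0 -[RHS](_ : \int[lm]_r 0 = 0); last by rewrite /Rintegral integral0.
  apply: eq_Rintegral => r _; rewrite (_ : step_kernel r 0 = 0) ?mulr0//.
  by rewrite /step_kernel invr0 !mulr0 oppr0.
rewrite indicE memNset ?subr0 ?mulr1; last by move=> /= /eqP; apply/negP.
have [e1 e2] := exp_step_kernel_integral x y0 t0.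
have bnd r : halfline r * cabs (exp_kernel y x r * step_kernel r t) <= (y + `|x|) * (halfline r * ((r + 2) * expR (- (y * r)))).
  rewrite [leRHS]mulrCA; apply: (halfline_le (a := fun r => cabs (exp_kernel y x r * step_kernel r t)) (b := fun r => (y + `|x|) * ((r + 2) * expR (- (y * r))))) => {}r r0.
  rewrite cabsM mulrCA mulrC.
  apply: ler_pM; rewrite ?cabs_ge0 ?cabs_exp_kernel//.
  rewrite (le_trans (cabs_step_kernel _ _))// (ger0_norm r0) ler_pdivrMr.
    by have := normr_ge0 t; nra.
  by have := normr_ge0 t; lra.
have mst : measurable_fun setT (fun r : R => complex.Re (step_kernel r t)) /\ measurable_fun setT (fun r : R => complex.Im (step_kernel r t)).
  by split; rewrite /step_kernel/=; measurable_tac.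
have [ms1 ms2] := mst.
have i1 : lm.-integrable setT (EFin \o (fun r => halfline r * complex.Re (exp_kernel y x r * step_kernel r t))).
  apply: (integrable_bounded_by (mu := lm) _ ia).
    by apply: measurable_mulf; [exact: measurable_halfline|apply: measurable_Re_mul].
  by move=> r; rewrite (le_trans _ (bnd r))// normrM (ger0_norm (halfline_ge0 r)) ler_wpM2l ?halfline_ge0// Re_le_cabs.
have i2 : lm.-integrable setT (EFin \o (fun r => halfline r * complex.Im (exp_kernel y x r * step_kernel r t))).
  apply: (integrable_bounded_by (mu := lm) _ ia).
    apply: measurable_mulf; first exact: measurable_halfline.
    rewrite (_ : (fun r => _) = (fun r => complex.Re (exp_kernel y x r) * complex.Im (step_kernel r t) +
      complex.Im (exp_kernel y x r) * complex.Re (step_kernel r t))); first by measurable_tac.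
    by apply/funext => r; rewrite Im_mulc.
  by move=> r; rewrite (le_trans _ (bnd r))// normrM (ger0_norm (halfline_ge0 r)) ler_wpM2l ?halfline_ge0// Im_le_cabs.
transitivity (\int[lm]_r (complex.Re z * (halfline r * complex.Re (exp_kernel y x r * step_kernel r t)) -
    complex.Im z * (halfline r * complex.Im (exp_kernel y x r * step_kernel r t)))).
  by apply: eq_Rintegral => r _; rewrite [complex.Re (z * _)]Re_mulc; ring.
by rewrite (Rintegral_linear_sub _ _ i1 i2) e1 e2 Re_mulc.
Qed.

(** With the complex cumulative function Z = [cumul f] + i [cumul] (- i f), the integrand on the
    left is the real part of [exp_kernel] times Z; Fubini brings the r-integral inside. *)
Lemma cumul_laplace f (y x : R) : admissible f -> 0 < y ->
  \int[lm]_r (halfline r * (complex.Re (exp_kernel y x r) * cumul f r -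
    complex.Im (exp_kernel y x r) * cumul (fun t => - 'i * f t) r)) =
  \int[lm]_t complex.Re (f t * cinvpow 1 y (t - x)).
Proof.
move=> af y0; have [[m1 m2] fi] := af.
have [ck1 ck2] := continuous_exp_kernel y x.
have mk1 : measurable_fun setT (fun r => complex.Re (exp_kernel y x r)) by exact: continuous_measurable_fun.
have mk2 : measurable_fun setT (fun r => complex.Im (exp_kernel y x r)) by exact: continuous_measurable_fun.
pose N r t := halfline r * complex.Re (f t * (exp_kernel y x r * step_kernel r t)).
have Nb r t : `|N r t| <= (y + `|x|) * (halfline r * ((r + 2) * expR (- (y * r)))) * (cabs (f t) / (1 + `|t|)).
  rewrite /N; case: (ltP r 0) => r0; first by rewrite halfline_lt0E// !mul0r normr0 mulr0 mul0r.
  rewrite halfline_ge0E// !mul1r.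
  apply: (Re_mul_le f (k := fun t => exp_kernel y x r * step_kernel r t)); rewrite cabsM.
  rewrite (_ : _ * _ / _ = ((y + `|x|) * expR (- (y * r))) * ((r + 2) / (1 + `|t|))); last by ring.
  apply: ler_pM; rewrite ?cabs_ge0 ?cabs_exp_kernel//.
  by rewrite (le_trans (cabs_step_kernel _ _))// (ger0_norm r0).
have mE : measurable_fun setT (fun z : measurableTypeR R * measurableTypeR R => z.2^-1).
  exact: (measurableT_comp (@measurable_invr R) measurable_snd).
have mN : measurable_fun setT (fun z : measurableTypeR R * measurableTypeR R => N z.1 z.2).
  rewrite (_ : (fun z => _) = (fun z => halfline z.1 *
     (complex.Re (f z.2) * (complex.Re (exp_kernel y x z.1) * complex.Re (step_kernel z.1 z.2) -
        complex.Im (exp_kernel y x z.1) * complex.Im (step_kernel z.1 z.2)) -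
      complex.Im (f z.2) * (complex.Re (exp_kernel y x z.1) * complex.Im (step_kernel z.1 z.2) +
        complex.Im (exp_kernel y x z.1) * complex.Re (step_kernel z.1 z.2))))); last first.
    by apply/funext => z; rewrite /N Re_mulc [complex.Re (_ * _)]Re_mulc Im_mulc.
  have a1 : measurable_fun setT (fun z : measurableTypeR R * measurableTypeR R => complex.Re (f z.2)) := measurableT_comp m1 measurable_snd.
  have a2 : measurable_fun setT (fun z : measurableTypeR R * measurableTypeR R => complex.Im (f z.2)) := measurableT_comp m2 measurable_snd.
  have a3 : measurable_fun setT (fun z : measurableTypeR R * measurableTypeR R => complex.Re (exp_kernel y x z.1)) := measurableT_comp mk1 measurable_fst.
  have a4 : measurable_fun setT (fun z : measurableTypeR R * measurableTypeR R => complex.Im (exp_kernel y x z.1)) := measurableT_comp mk2 measurable_fst.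
  have a5 : measurable_fun setT (fun z : measurableTypeR R * measurableTypeR R => complex.Re (step_kernel z.1 z.2)).
    by rewrite /step_kernel/=; measurable_tac.
  have a6 : measurable_fun setT (fun z : measurableTypeR R * measurableTypeR R => complex.Im (step_kernel z.1 z.2)).
    by rewrite /step_kernel/=; measurable_tac.
  by measurable_tac.
have ia := integrableZl measurableT (y + `|x|) (integrable_halfline_affine_expR y0).
have Fub := @Rintegral_Fubini_prod _ _ _ _ R lm lm N _ _ mN ia fi Nb.
have inner_t r : \int[lm]_t N r t = halfline r * (complex.Re (exp_kernel y x r) * cumul f r -
    complex.Im (exp_kernel y x r) * cumul (fun t => - 'i * f t) r).
  have i1 := integrable_cumul r af; have i2 := integrable_cumul r (admissibleNi af).
  transitivity (\int[lm]_t (halfline r * complex.Re (exp_kernel y x r) * complex.Re (f t * step_kernel r t) -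
     halfline r * complex.Im (exp_kernel y x r) * complex.Re (- 'i * f t * step_kernel r t))).
    apply: eq_Rintegral => t _; rewrite /N mulrCA -[- 'i * f t * _]mulrA Re_mulNi.
    by rewrite [complex.Re (exp_kernel _ _ _ * _)]Re_mulc; ring.
  rewrite (Rintegral_linear_sub _ _ i1 i2) -/(cumul f r) -/(cumul (fun t => - 'i * f t) r).
  by ring.
have inner_r t : \int[lm]_r N r t = complex.Re (f t * cinvpow 1 y (t - x)) * (1 - \1_[set 0 : R] t).
  exact: exp_step_kernel_mul_integral.
transitivity (\int[lm]_r \int[lm]_t N r t).
  by apply: eq_Rintegral => r _; rewrite inner_t.
rewrite Fub; transitivity (\int[lm]_t (complex.Re (f t * cinvpow 1 y (t - x)) * (1 - \1_[set 0 : R] t))).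
  by apply: eq_Rintegral => t _; rewrite inner_r.
have mw := measurable_integrable (integrable_cinvpow_shift x af y0).
clear Fub ia mN inner_t inner_r Nb.
apply: Rintegral_ae_neq0; [|exact: mw|].
  apply: measurable_mulf; first exact: mw.
  by apply: measurable_funB; [exact: measurable_cst|exact: measurable_indic].
by move=> t t0; rewrite indicE memNset ?subr0 ?mulr1//= => /eqP; apply/negP.
Qed.

Lemma cumul_growth f : admissible f ->
  forall r, 0 <= r -> `|cumul f r| <= \int[lm]_t (cabs (f t) / (1 + `|t|)) * (r + 2).
Proof.
move=> af r r0; have [_ fi] := af.
rewrite (le_trans (le_normr_Rintegral _ (integrable_cumul r af)))// mulrC -RintegralZl//.
apply: le_Rintegral => //.
- exact: (integrable_norm (mu := lm) (f := fun t => complex.Re (f t * step_kernel r t)) (integrable_cumul r af)).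
- exact: (integrable_dominating (r + 2) af).
- move=> t _; apply: Re_mul_le.
  by rewrite (le_trans (cabs_step_kernel _ _))// (ger0_norm r0).
Qed.

(** In complex form, the integral of exp (- (y - i x) s) is (2 pi)^(-1) times that of f(t) / (y + i
    (t - x)), the normalisation being that of Fourier inversion. The almost everywhere clause says
    that [mu] lives on ]0, +oo[ and later removes the factor [posline]. *)
Lemma laplace_measure_exists f : admissible f -> moments_ge0 f ->
  moments_ge0 (fun t => - 'i * f t) -> moments_ge0 (fun t => 'i * f t) ->
  exists mu : {sigma_finite_measure set (measurableTypeR R) -> \bar R},
    {ae mu, forall s, posline s = 1} /\
    forall y x, 0 < y ->
      [/\ mu.-integrable setT (EFin \o (fun s => posline s * exp_cos y x s)),
          mu.-integrable setT (EFin \o (fun s => posline s * exp_sin y x s)),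
          Rintegral mu setT (fun s => posline s * exp_cos y x s) =
            (2 * pi)^-1 * \int[lm]_t complex.Re (f t * cinvpow 1 y (t - x)) &
          Rintegral mu setT (fun s => posline s * exp_sin y x s) =
            (2 * pi)^-1 * \int[lm]_t complex.Im (f t * cinvpow 1 y (t - x))].
Proof.
move=> af p0 p1 p2.
have pi2 : 0 < (2 * pi)^-1 :> R by rewrite invr_gt0 mulr_gt0// pi_gt0.
(* The argument (s + |s|) / 2 is the positive part of s, so [F] is constant on the negative
   half-line and no mass is put there. *)
pose F (s : R) := (2 * pi)^-1 * cumul f ((s + `|s|) / 2).
have Fpos (s : R) : 0 <= s -> F s = (2 * pi)^-1 * cumul f s.
  by move=> s0; rewrite /F ger0_norm//; congr (_ * cumul f _); field.
have Fneg (s : R) : s <= 0 -> F s = 0.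
  by move=> s0; rewrite /F ler0_norm// subrr mul0r cumul0 mulr0.
have ndF : {homo F : a b / a <= b}.
  move=> a b ab; rewrite /F; apply: ler_wpM2l; first exact: ltW.
  apply: cumul_ndecr => //.
    by rewrite divr_ge0//; have := ler_norm (- a); rewrite normrN; lra.
  rewrite ler_wpM2r// ; have h := ler_norm b.
  case: (leP 0 a) => a0; first by rewrite !ger0_norm//; [lra|exact: le_trans ab].
  rewrite (ltr0_norm a0) subrr.
  by have := ler_norm (- b); rewrite normrN; lra.
have cF : continuous F.
  move=> s; rewrite /F; apply: cvgMr.
  apply: continuous_cvg; first exact: cumul_continuous.
  by apply: cvgMl; apply: cvgD; [exact: cvg_id|exact: norm_continuous].
have [mu muF] := stieltjes_measure_exists ndF cF; exists mu.
have muF0 r : 0 <= r -> mu `]0, r]%classic = (F r)%:E.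
  by move=> r0; rewrite muF// (Fneg 0)// subr0.
pose D := (2 * pi)^-1 * \int[lm]_t (cabs (f t) / (1 + `|t|)).
have FD r : 0 <= r -> 0 <= F r <= D * (r + 2).
  move=> r0; rewrite Fpos//; apply/andP; split.
    by apply: mulr_ge0; [exact: ltW|rewrite -(cumul0 f); apply: cumul_ndecr].
  rewrite /D -mulrA; apply: ler_wpM2l; first exact: ltW.
  by rewrite (le_trans (ler_norm _))// cumul_growth.
split.
  (* The half-line ]-oo, 0] is covered by countably many intervals on which [F] has no increment. *)
  have neg : mu.-negligible (\bigcup_n `](- n%:R), 0]%classic).
    apply: negligible_bigcup => n; exists `](- n%:R), 0]%classic; split => //.
    transitivity ((F 0 - F (- n%:R))%:E); first by apply: muF; rewrite oppr_le0.
    by rewrite !Fneg ?oppr_le0// subrr.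
  apply: negligibleS neg => s /= ns; have s0 : s <= 0.
    by rewrite leNgt; apply/negP => s0; apply: ns; rewrite posline_gt0E.
  exists (Num.Def.truncn (- s)).+1 => //=; rewrite in_itv/= s0 andbT ltrNl.
  exact: truncnS_gt.
move=> y x y0.
have [ck1 ck2] := continuous_exp_kernel y x.
have lim_cos s : exp_cos y x (s + n%:R) @[n --> \oo] --> 0.
  exact: (cvg_expR_bounded s y0 (bounded_real_cos ( *%R x))).
have lim_sin s : exp_sin y x (s + n%:R) @[n --> \oo] --> 0.
  exact: (cvg_expR_bounded s y0 (bounded_real_sin ( *%R x))).
have [] := stieltjes_laplace (K := y + `|x|) cF muF0 FD y0 ck1 (is_derive_exp_cos y x) _ lim_cos.
  by move=> r _; rewrite (le_trans (Re_le_cabs _))// cabs_exp_kernel.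
move=> i1 e1.
have [] := stieltjes_laplace (K := y + `|x|) cF muF0 FD y0 ck2 (is_derive_exp_sin y x) _ lim_sin.
  by move=> r _; rewrite (le_trans (Im_le_cabs _))// cabs_exp_kernel.
move=> i2 e2.
have mc1 : measurable_fun setT (cumul f).
  by apply: continuous_measurable_fun; exact: cumul_continuous.
have mk1 : measurable_fun setT (fun r => complex.Re (exp_kernel y x r)) by exact: continuous_measurable_fun.
have mk2 : measurable_fun setT (fun r => complex.Im (exp_kernel y x r)) by exact: continuous_measurable_fun.
have ik (k : R -> R) : measurable_fun setT k -> (forall r, `|k r| <= cabs (exp_kernel y x r)) ->
    lm.-integrable setT (EFin \o (fun r => halfline r * (k r * cumul f r))).
  move=> mk kb; set I := \int[lm]_t (cabs (f t) / (1 + `|t|)).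
  apply: (integrable_bounded_by (mu := lm) (g := fun r => (y + `|x|) * I * (halfline r * ((r + 2) * expR (- (y * r)))))).
  - by apply: measurable_mulf; [exact: measurable_halfline|exact: measurable_mulf].
  - exact: (integrableZl measurableT ((y + `|x|) * I) (integrable_halfline_affine_expR y0)).
  - move=> r; rewrite [leRHS]mulrCA.
    apply: (halfline_norm_le (a := fun r => k r * cumul f r) (b := fun r => (y + `|x|) * I * ((r + 2) * expR (- (y * r))))) => {}r r0.
    rewrite normrM (_ : _ * I * _ = ((y + `|x|) * expR (- (y * r))) * (I * (r + 2))); last by ring.
    apply: ler_pM => //; last exact: cumul_growth.
    by rewrite (le_trans (kb r))// cabs_exp_kernel.
split=> //.
- rewrite e1 -cumul_laplace// -RintegralZl//; last first.
    have := ik _ mk1 (fun r => Re_le_cabs _); apply: eq_integrable => // r _ /=; congr EFin.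
    case: (ltP r 0) => r0; first by rewrite halfline_lt0E// !mul0r.
    by rewrite (cumulNi_eq0 af p1 p2 r0) mulr0 subr0.
  apply: eq_Rintegral => r _; case: (ltP r 0) => r0; first by rewrite halfline_lt0E// !mul0r mulr0.
  by rewrite (cumulNi_eq0 af p1 p2 r0) mulr0 subr0 Fpos//; ring.
- rewrite e2.
  (* The imaginary part is the real part for - i f. Its own cumulative function vanishes, and only
     that of (- i)(- i) f = - f contributes. *)
  have -> : \int[lm]_t complex.Im (f t * cinvpow 1 y (t - x)) = \int[lm]_t complex.Re (- 'i * f t * cinvpow 1 y (t - x)).
    by apply: eq_Rintegral => t _; rewrite -mulrA Re_mulNi.
  have cN r : cumul (fun t => - 'i * (- 'i * f t)) r = - cumul f r.
    rewrite /cumul -[RHS]mulN1r -RintegralZl//; last exact: integrable_cumul.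
    apply: eq_Rintegral => t _; rewrite -!mulrA Re_mulNi Im_mulNi.
    by rewrite mulN1r.
  rewrite -cumul_laplace//; last exact: admissibleNi.
  rewrite -RintegralZl//; last first.
    have := ik _ mk2 (fun r => Im_le_cabs _); apply: eq_integrable => // r _ /=; congr EFin.
    case: (ltP r 0) => r0; first by rewrite halfline_lt0E// !mul0r.
    by rewrite (cumulNi_eq0 af p1 p2 r0) cN; ring.
  apply: eq_Rintegral => r _; case: (ltP r 0) => r0; first by rewrite halfline_lt0E// !mul0r mulr0.
  by rewrite (cumulNi_eq0 af p1 p2 r0) cN Fpos//; ring.
Qed.

End LaplaceKernel.

(** * Poisson approximation and inversion *)

Section Poisson.
Context {R : realType}.
Notation lm := (@lebesgue_measure R).

Lemma integrable_oneDsqrV : lm.-integrable setT (EFin \o (fun t : R => (1 + t ^+ 2)^-1)).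
Proof.
have p (t : R) : 0 < 1 + t ^+ 2 by rewrite ltr_pwDl// sqr_ge0.
have ct : continuous (fun t : R => (1 + t ^+ 2)^-1).
  apply: (@is_derive_continuous _ _ (fun t => - (2 * t) / (1 + t ^+ 2) ^+ 2)) => t.
  apply: is_derive_invf; first by rewrite gt_eqF.
  by eapply is_derive_eq; [derive_tac|rewrite /= add0r].
apply/integrableP; split; first by apply/measurable_EFinP; exact: continuous_measurable_fun.
rewrite (_ : (\int[lm]_t _ = \int[lm]_t ((1 + t ^+ 2)^-1)%:E)%E); last first.
  by apply: eq_integral => t _ /=; rewrite ger0_norm// invr_ge0 ltW.
rewrite ge0_symfun_integralT//.
- by rewrite -set_itvcy integral0y_oneDsqr -EFinM ltry.
- by move=> t; rewrite invr_ge0 ltW.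
- by move=> t; rewrite /= sqrrN.
Qed.

Lemma Re_cinvpow_shift (y x t : R) :
  complex.Re (cinvpow 1 y (t - x)) = y / (y ^+ 2 + (t - x) ^+ 2).
Proof. by rewrite cinvpow1. Qed.

Lemma poisson_ge0 (y x t : R) : 0 < y -> 0 <= complex.Re (cinvpow 1 y (t - x)).
Proof. by move=> y0; rewrite Re_cinvpow_shift divr_ge0 ?ltW// sqrD_gt0. Qed.

Lemma integrable_poisson (y x : R) : 0 < y ->
  lm.-integrable setT (EFin \o (fun t => complex.Re (cinvpow 1 y (t - x)))).
Proof.
move=> y0; set C := (1 + y^-1) * (1 + `|x|).
apply: (integrable_bounded_by (mu := lm) (g := fun t => y * C ^+ 2 * (1 + t ^+ 2)^-1)).
- exact: (measurable_cinvpow_shift x y0).1.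
- exact: (integrableZl measurableT (y * C ^+ 2) integrable_oneDsqrV).
- move=> t; rewrite ger0_norm ?poisson_ge0//.
  have -> : complex.Re (cinvpow 1 y (t - x)) = y * cabs (cinvpow 1 y (t - x)) ^+ 2.
    by rewrite cabs_cinvpow1_sqr// Re_cinvpow_shift.
  rewrite -mulrA; apply: ler_wpM2l; first exact: ltW.
  have h := cabs_cinvpow_shift x t y0; rewrite -/C in h.
  have C0 : 0 <= C.
    by rewrite /C mulr_ge0 ?addr_ge0// invr_ge0 ltW.
  have t0 := normr_ge0 t.
  have h2 : cabs (cinvpow 1 y (t - x)) ^+ 2 <= (C / (1 + `|t|)) ^+ 2.
    by rewrite ler_sqr ?nnegrE ?cabs_ge0// divr_ge0//; lra.
  rewrite (le_trans h2)// expr_div_n; apply: ler_wpM2l; first exact: sqr_ge0.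
  rewrite -(real_normK (num_real t)) lef_pV2 ?posrE; first by nra.
    by rewrite exprn_gt0//; lra.
  by have := sqr_ge0 `|t|; lra.
Qed.

Lemma cvg_atan_affine (y a : R) : 0 < y -> atan ((n%:R - a) / y) @[n --> \oo] --> pi / 2.
Proof.
move=> y0; apply: (cvg_comp (fun n : nat => (n%:R - a) / y) (@atan R) _ (@cvgy_atan R)).
apply/cvgryPge => A; near=> n; rewrite ler_pdivlMr// lerBrDr; near: n.
exact: nbhs_infty_ger.
Unshelve. all: by end_near. Qed.

(** Folding turns the centre x into the two centres x and - x; the arctangents cancel at 0 by
    oddness and each tends to pi / 2 at infinity. *)
Lemma poisson_total (y x : R) : 0 < y ->
  \int[lm]_t complex.Re (cinvpow 1 y (t - x)) = pi.
Proof.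
move=> y0.
have q (a t : R) : 0 < y ^+ 2 + (t - a) ^+ 2 by exact: sqrD_gt0.
pose g (a t : R) := y * (y ^+ 2 + (t - a) ^+ 2)^-1.
have cg a : continuous (g a).
  apply: (@is_derive_continuous _ _ (fun t => y * (- (2 * (t - a)) / (y ^+ 2 + (t - a) ^+ 2) ^+ 2))) => t.
  have dq : is_derive t 1 (fun t => y ^+ 2 + (t - a) ^+ 2) (2 * (t - a)).
    have -> : (fun t => y ^+ 2 + (t - a) ^+ 2) = (fun t => y ^+ 2 + (t - a) * (t - a)).
      by apply/funext => u; rewrite expr2.
    by eapply is_derive_eq; [derive_tac|rewrite /=; ring].
  have -> : g a = (fun t => y * (y ^+ 2 + (t - a) ^+ 2)^-1) by [].
  have di := is_derive_invf (f := fun t => y ^+ 2 + (t - a) ^+ 2) (lt0r_neq0 (q a t)) dq.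
  by eapply is_derive_eq; [exact: (is_derive_mulf (is_derive_cstf y t) di)|rewrite /= mul0r add0r].
have dG (a t : R) : is_derive t 1 (fun t => atan ((t - a) / y)) (g a t).
  have dl : is_derive t 1 (fun t => (t - a) / y) y^-1.
    by eapply is_derive_eq; [derive_tac|rewrite /=; ring].
  have da : is_derive ((t - a) / y) 1 (@atan R) (1 + ((t - a) / y) ^+ 2)^-1 by exact: is_derive1_atan.
  eapply is_derive_eq; first by eapply is_derive_compf; [exact: da|exact: dl].
  have yN := lt0r_neq0 y0; have := lt0r_neq0 (q a t); rewrite /g.
  have -> : 1 + ((t - a) / y) ^+ 2 = (y ^+ 2 + (t - a) ^+ 2) / y ^+ 2 by field.
  by set Q := y ^+ 2 + _ => QN; field; apply/andP.
have E t : complex.Re (cinvpow 1 y (t - x)) + complex.Re (cinvpow 1 y (- t - x)) = g x t + g (- x) t.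
  by rewrite !Re_cinvpow_shift /g opprK -opprD sqrrN.
have ip := integrable_poisson x y0.
rewrite Rintegral_fold//.
transitivity (\int[lm]_r (halfline r * (g x r + g (- x) r))).
  by apply: eq_Rintegral => r _; rewrite E.
have c2 : continuous (fun r => g x r + g (- x) r) by move=> r; apply: cvgD; exact: cg.
have d2 (r : R) : is_derive r 1 (fun r => atan ((r - x) / y) + atan ((r - (- x)) / y)) (g x r + g (- x) r).
  exact: (is_derive_addf (dG x r) (dG (- x) r)).
have lim : atan ((n%:R - x) / y) + atan ((n%:R - (- x)) / y) @[n --> \oo] --> pi / 2 + pi / 2.
  by apply: cvgD; exact: cvg_atan_affine.
rewrite (Rintegral_halfline_FTC c2 d2 _ lim); last first.
  have [iN _] := Rintegral_opp ip.
  apply: (integrable_bounded_by (mu := lm) (g := fun t => complex.Re (cinvpow 1 y (t - x)) + complex.Re (cinvpow 1 y (- t - x)))).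
  - by apply: measurable_mulf; [exact: measurable_halfline|exact: continuous_measurable_fun].
  - exact: (integrableD measurableT ip iN).
  - move=> t; rewrite E normrM (ger0_norm (halfline_ge0 t)) -E ger0_norm; last by rewrite addr_ge0// poisson_ge0.
    by rewrite ler_piMl ?halfline_le1// addr_ge0// poisson_ge0.
rewrite sub0r sub0r opprK mulNr atanN addNr subr0.
by field.
Qed.

(** An approximate identity. At distance at least d from x, the kernel of height y is at most y (1 +
    1/d^2) times the kernel of height 1, so a fixed integrable function controls the tail with a
    factor tending to 0. *)
Lemma poisson_cvg (u : R -> R) (M x : R) : continuous u -> (forall t, `|u t| <= M) ->
  pi^-1 * \int[lm]_t (u t * complex.Re (cinvpow 1 n.+1%:R^-1 (t - x))) @[n --> \oo] --> u x.
Proof.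
move=> cu uM.
have p0 := pi_gt0 R.
have M0 : 0 <= M by rewrite (le_trans _ (uM 0)).
have mu' : measurable_fun setT u by exact: continuous_measurable_fun.
apply/cvgrPdist_le => e e0.
have e20 : 0 < e / 2 by lra.
have := cu x; move/cvgrPdist_le => /(_ _ e20) [d /= d0 ud].
pose C := 2 * M * (1 + (d ^+ 2)^-1).
have d2 : 0 < d ^+ 2 by rewrite exprn_gt0.
have C0 : 0 <= C by rewrite /C mulr_ge0 ?mulr_ge0// addr_ge0// invr_ge0 ltW.
have bound y t : 0 < y -> `|(u t - u x) * complex.Re (cinvpow 1 y (t - x))| <=
    e / 2 * complex.Re (cinvpow 1 y (t - x)) + C * y * complex.Re (cinvpow 1 1 (t - x)).
  move=> y0; have P0 := poisson_ge0 x t y0; have P1 := poisson_ge0 x t (@ltr01 R).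
  rewrite normrM (ger0_norm P0).
  have [xt|tx] := ltP `|x - t| d.
    rewrite -[leLHS]addr0; apply: lerD; last by rewrite mulr_ge0// mulr_ge0// ltW.
    by apply: ler_wpM2r => //; rewrite distrC; exact: ud.
  rewrite -[leLHS]add0r; apply: lerD; first by rewrite mulr_ge0// ltW.
  have h : `|u t - u x| <= 2 * M.
    by rewrite (le_trans (ler_normB _ _))// mulr_natl mulr2n lerD.
  rewrite (le_trans (ler_wpM2r P0 h))// /C -!mulrA; apply: ler_wpM2l => //.
  apply: ler_wpM2l => //; rewrite !Re_cinvpow_shift expr1n.
  have dt : d ^+ 2 <= (t - x) ^+ 2.
    by rewrite -(real_normK (num_real (t - x))) distrC ler_sqr ?nnegrE// ltW.
  have t20 : 0 < (t - x) ^+ 2 by exact: lt_le_trans dt.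
  rewrite mulrCA; apply: ler_wpM2l; first exact: ltW.
  rewrite mul1r ler_pdivlMr; last by lra.
  rewrite mulrC ler_pdivrMr; last by rewrite addr_gt0// exprn_gt0.
  have y2 := sqr_ge0 y.
  have di : 0 < (d ^+ 2)^-1 by rewrite invr_gt0.
  (* Hence 1 + (t - x)^2 <= (1 + 1/d^2) (t - x)^2, the origin of the constant in [C]. *)
  have dt1 : 1 <= (d ^+ 2)^-1 * (t - x) ^+ 2 by rewrite mulrC ler_pdivlMr// mul1r.
  nra.
near=> n.
set y := n.+1%:R^-1.
have y0 : 0 < y by rewrite invr_gt0.
have ip := integrable_poisson x y0.
have i1 := integrable_poisson x (@ltr01 R).
have iu : lm.-integrable setT (EFin \o (fun t => u t * complex.Re (cinvpow 1 y (t - x)))).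
  apply: (integrable_bounded_by (mu := lm) (g := fun t => M * complex.Re (cinvpow 1 y (t - x)))).
  - by apply: measurable_mulf => //; exact: measurable_integrable ip.
  - exact: (integrableZl measurableT M ip).
  - by move=> t; rewrite normrM (ger0_norm (poisson_ge0 x t y0)) ler_wpM2r// poisson_ge0.
have iD : lm.-integrable setT (EFin \o (fun t => (u t - u x) * complex.Re (cinvpow 1 y (t - x)))).
  have := integrableB measurableT iu (integrableZl measurableT (u x) ip).
  by apply: eq_integrable => // t _ /=; rewrite -EFinB mulrBl.
have ED : \int[lm]_t ((u t - u x) * complex.Re (cinvpow 1 y (t - x))) =
    \int[lm]_t (u t * complex.Re (cinvpow 1 y (t - x))) - u x * pi.
  rewrite -(poisson_total x y0) -RintegralZl// -RintegralB//; last exact: (integrableZl measurableT (u x) ip).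
  by apply: eq_Rintegral => t _; rewrite mulrBl.
have -> : u x - pi^-1 * \int[lm]_t (u t * complex.Re (cinvpow 1 y (t - x))) =
    - (pi^-1 * \int[lm]_t ((u t - u x) * complex.Re (cinvpow 1 y (t - x)))).
  rewrite ED; set I := \int[lm]_t _; have pn : pi != 0 :> R by rewrite gt_eqF.
  by rewrite mulrBr mulrCA mulVf// mulr1 opprB.
rewrite normrN normrM gtr0_norm ?invr_gt0// mulrC ler_pdivrMr//.
rewrite (le_trans (le_normr_Rintegral measurableT iD))//.
have iB := integrableD measurableT (integrableZl measurableT (e / 2) ip) (integrableZl measurableT (C * y) i1).
apply: (@le_trans _ _ (\int[lm]_t (e / 2 * complex.Re (cinvpow 1 y (t - x)) + C * y * complex.Re (cinvpow 1 1 (t - x))))).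
  apply: le_Rintegral => //.
  - exact: (integrable_norm (mu := lm) (f := fun t => (u t - u x) * complex.Re (cinvpow 1 y (t - x))) iD).
  - by move=> t _; exact: bound.
rewrite RintegralD//; [|exact: (integrableZl measurableT (e / 2) ip)|exact: (integrableZl measurableT (C * y) i1)].
rewrite RintegralZl// RintegralZl// !poisson_total// -mulrDl; apply: ler_wpM2r; first exact: ltW.
suff : C * y <= e / 2 by lra.
rewrite /y; near: n.
have : C * harmonic n @[n --> \oo] --> C * 0 by apply: cvgMr; exact: cvg_harmonic.
rewrite mulr0 => /cvgrPdist_le /(_ _ e20); apply: filterS => n.
by rewrite sub0r normrN => h; rewrite (le_trans (ler_norm _)).
Unshelve. all: by end_near. Qed.

End Poisson.

Lemma ae_eq_Rintegral (d : measure_display) (T : measurableType d) (R : realType)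
    (mu : {measure set T -> \bar R}) (P : T -> Prop) (g k : T -> R) :
  measurable_fun setT g -> mu.-integrable setT (EFin \o k) ->
  {ae mu, forall s, P s} -> (forall s, P s -> g s = k s) ->
  mu.-integrable setT (EFin \o g) /\ Rintegral mu setT g = Rintegral mu setT k.
Proof.
move=> mg ik aeP gk; have mk := measurable_integrable ik.
have mg' : measurable_fun setT (EFin \o g) by exact/measurable_EFinP.
have mk' : measurable_fun setT (EFin \o k) by exact/measurable_EFinP.
split.
  apply/integrableP; split => //; have /integrableP[_] := ik.
  rewrite (@ae_eq_integral _ _ _ mu setT (abse \o (EFin \o g)) (abse \o (EFin \o k)))//; [exact: measurableT_comp..|].
  by apply: filterS aeP => s Ps _ /=; rewrite gk.
rewrite /Rintegral; congr fine; apply: ae_eq_integral => //.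
by apply: filterS aeP => s Ps _ /=; rewrite gk.
Qed.

Section MeasureProbability.
Context {R : realType} (nu : {measure set R -> \bar R}) (nu1 : nu setT = 1%E).

Definition measure_probability of nu setT = 1%E : set R -> \bar R := nu.
Local Notation P := (measure_probability nu1).
HB.instance Definition _ := Measure.on P.
HB.instance Definition _ := @Measure_isProbability.Build _ _ _ P nu1.

End MeasureProbability.

(** * Assembly of the measure, Fourier inversion and the equivalence *)

Section Inversion.
Context {R : realType}.
Notation lm := (@lebesgue_measure R).
Implicit Types f : R -> R[i].

(** The measure is [mup] plus the image of [mum] under reflection, so that a measure on the positive
    half-line can stand for the negative part. *)
Lemma fold_measure_exists (mup mum : {measure set (measurableTypeR R) -> \bar R}) :
  exists nu : {measure set R -> \bar R},
    (forall g : R -> R, measurable_fun setT g -> (forall s, 0 <= g s) ->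
      (\int[nu]_s (g s)%:E = \int[mup]_s (g s)%:E + \int[mum]_s (g (- s))%:E)%E) /\
    (forall g : R -> R, measurable_fun setT g ->
      mup.-integrable setT (EFin \o g) -> mum.-integrable setT (EFin \o (g \o -%R)) ->
      nu.-integrable setT (EFin \o g) /\
      Rintegral nu setT g = Rintegral mup setT g + Rintegral mum setT (g \o -%R)).
Proof.
have mid : measurable_fun setT (idfun : measurableTypeR R -> R) by exact: measurable_id.
have mopp : measurable_fun setT (-%R : measurableTypeR R -> R) by exact: oppr_measurable.
unshelve epose (nup := (pushforward mup (idfun : measurableTypeR R -> R) : {measure set R -> \bar R})).
  exact: mid.
unshelve epose (num := (pushforward mum (-%R : measurableTypeR R -> R) : {measure set R -> \bar R})).
  exact: mopp.
exists (measure_add nup num).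
have Epos (g : R -> \bar R) : measurable_fun setT g -> (forall s, 0 <= g s)%E ->
    (\int[measure_add nup num]_s g s = \int[mup]_s g s + \int[mum]_s g (- s)%R)%E.
  move=> mg g0; rewrite ge0_integral_measure_add//; congr (_ + _)%E.
    exact: (ge0_integral_pushforward mid mup measurableT mg (fun x _ => g0 x)).
  exact: (ge0_integral_pushforward mopp mum measurableT mg (fun x _ => g0 x)).
split=> [g mg g0|g mg ip im].
  by rewrite Epos//; exact/measurable_EFinP.
have mgE : measurable_fun setT (EFin \o g) by exact/measurable_EFinP.
have ip' : nup.-integrable setT (EFin \o g) by exact: (integrable_pushforward mid mgE ip).
have im' : num.-integrable setT (EFin \o g) by exact: (integrable_pushforward mopp mgE im).
split.
  apply/integrableP; split => //.
  rewrite Epos//; last exact: measurableT_comp.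
  have /integrableP[_ h1] := ip; have /integrableP[_ h2] := im.
  exact: lte_add_pinfty.
rewrite /Rintegral integral_measure_add// fineD; last 2 first.
- exact: (integrable_fin_num measurableT ip').
- exact: (integrable_fin_num measurableT im').
congr (fine _ + fine _).
- exact: (integral_pushforward mid mgE ip measurableT).
- exact: (integral_pushforward mopp mgE im measurableT).
Qed.

(** Adding the contributions of f and its conjugate leaves only the real part of the Cauchy kernel,
    which is pi times the Poisson kernel; the factor 2 turns 1 / (2 pi) into 1 / pi. The sine is odd
    under reflection, hence a difference in the companion identity for imaginary parts. *)
Lemma Re_add_conj (z w : R[i]) : complex.Re (z * w) + complex.Re (conjc z * w) = 2 * (complex.Re z * complex.Re w).
Proof. by case: z w => [a b] [c d] /=; ring. Qed.

Lemma Im_sub_conj (z w : R[i]) : complex.Im (z * w) - complex.Im (conjc z * w) = 2 * (complex.Im z * complex.Re w).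
Proof. by case: z w => [a b] [c d] /=; ring. Qed.

Lemma integrable_Im_cinvpow_shift f y x : admissible f -> 0 < y ->
  lm.-integrable setT (EFin \o (fun t => complex.Im (f t * cinvpow 1 y (t - x)))).
Proof.
move=> af y0; have := integrable_cinvpow_shift x (admissibleNi af) y0.
by apply: eq_integrable => // t _ /=; rewrite -mulrA Re_mulNi.
Qed.

Lemma poisson_measure_exists f : admissible f ->
  [/\ moments_ge0 f, moments_ge0 (fun t => - 'i * f t) & moments_ge0 (fun t => 'i * f t)] ->
  [/\ moments_ge0 (fun t => conjc (f t)), moments_ge0 (fun t => - 'i * conjc (f t)) &
     moments_ge0 (fun t => 'i * conjc (f t))] ->
  exists nu : {measure set R -> \bar R}, forall y x, 0 < y ->
    [/\ nu.-integrable setT (EFin \o (fun s => expR (- (y * `|s|)) * cos (x * s))),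
        Rintegral nu setT (fun s => expR (- (y * `|s|)) * cos (x * s)) =
          pi^-1 * \int[lm]_t (complex.Re (f t) * complex.Re (cinvpow 1 y (t - x))) &
        Rintegral nu setT (fun s => expR (- (y * `|s|)) * sin (x * s)) =
          pi^-1 * \int[lm]_t (complex.Im (f t) * complex.Re (cinvpow 1 y (t - x)))].
Proof.
move=> af [p1 p2 p3] [q1 q2 q3].
have ac := admissible_conj af.
have [mup [aep Hp]] := laplace_measure_exists af p1 p2 p3.
have [mum [aem Hm]] := laplace_measure_exists ac q1 q2 q3.
have [nu [_ Hnu]] := fold_measure_exists mup mum.
exists nu => y x y0.
have [ip1 ip2 ep1 ep2] := Hp y x y0.
have [im1 im2 em1 em2] := Hm y x y0.
have mcos : measurable_fun setT (fun s : R => expR (- (y * `|s|)) * cos (x * s)) by measurable_tac.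
have msin : measurable_fun setT (fun s : R => expR (- (y * `|s|)) * sin (x * s)) by measurable_tac.
have mcosN : measurable_fun setT (fun s : R => expR (- (y * `|- s|)) * cos (x * - s)) by measurable_tac.
have msinN : measurable_fun setT (fun s : R => expR (- (y * `|- s|)) * sin (x * - s)) by measurable_tac.
have pos (s : R) : posline s = 1 -> 0 < s.
  by move=> h; rewrite ltNge; apply/negP => s0; move: h; rewrite posline_le0E// => /eqP; rewrite eq_sym oner_eq0.
have Ecos s : posline s = 1 -> expR (- (y * `|s|)) * cos (x * s) = posline s * exp_cos y x s.
  by move=> h; rewrite h mul1r gtr0_norm ?pos.
have Esin s : posline s = 1 -> expR (- (y * `|s|)) * sin (x * s) = posline s * exp_sin y x s.
  by move=> h; rewrite h mul1r gtr0_norm ?pos.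
have EcosN s : posline s = 1 -> expR (- (y * `|- s|)) * cos (x * - s) = posline s * exp_cos y x s.
  by move=> h; rewrite normrN mulrN cosN Ecos.
have EsinN s : posline s = 1 -> expR (- (y * `|- s|)) * sin (x * - s) = - 1 * (posline s * exp_sin y x s).
  by move=> h; rewrite normrN [x * - s]mulrN sinN mulrN Esin// mulN1r.
have [jp1 fp1] := @ae_eq_Rintegral _ (measurableTypeR R) R mup _ (fun s : R => expR (- (y * `|s|)) * cos (x * s)) _ mcos ip1 aep Ecos.
have [jp2 fp2] := @ae_eq_Rintegral _ (measurableTypeR R) R mup _ (fun s : R => expR (- (y * `|s|)) * sin (x * s)) _ msin ip2 aep Esin.
have [jm1 fm1] := @ae_eq_Rintegral _ (measurableTypeR R) R mum _ (fun s : R => expR (- (y * `|- s|)) * cos (x * - s)) _ mcosN im1 aem EcosN.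
have [jm2 fm2] := @ae_eq_Rintegral _ (measurableTypeR R) R mum _ (fun s : R => expR (- (y * `|- s|)) * sin (x * - s)) _ msinN (integrableZl measurableT (- 1) im2) aem EsinN.
have [n1 e1] := Hnu _ mcos jp1 jm1.
have [n2 e2] := Hnu _ msin jp2 jm2.
have pn : pi != 0 :> R by rewrite gt_eqF// pi_gt0.
have i1 := integrable_cinvpow_shift x af y0.
have i2 := integrable_cinvpow_shift x ac y0.
have k1 := integrable_Im_cinvpow_shift x af y0.
have k2 := integrable_Im_cinvpow_shift x ac y0.
have half (a b u : R -> R) : lm.-integrable setT (EFin \o a) -> lm.-integrable setT (EFin \o b) ->
    (forall t, a t + b t = 2 * u t) ->
    (2 * pi)^-1 * Rintegral lm setT a + (2 * pi)^-1 * Rintegral lm setT b = pi^-1 * Rintegral lm setT u.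
  move=> ia ib abu.
  have -> : Rintegral lm setT u = Rintegral lm setT (fun t => 2^-1 * (a t + b t)).
    by apply: eq_Rintegral => t _; rewrite abu mulKf.
  rewrite RintegralZl//; last exact: (integrableD measurableT ia ib).
  rewrite RintegralD//.
  by rewrite -mulrDr invfM mulrA [2^-1 * _]mulrC.
split.
- exact: n1.
- rewrite e1 fp1 [X in _ + X]fm1 ep1 em1.
  by apply: half => // t; exact: Re_add_conj.
- rewrite e2 fp2 [X in _ + X]fm2 RintegralZl// ep2 em2 mulrCA -[X in _ + _ * X]RintegralZl//.
  apply: half => //; first exact: (integrableZl measurableT (- 1) k2).
  by move=> t; rewrite -Im_sub_conj mulN1r.
Qed.

(** Only damped integrals against [nu] are controlled at the outset, so [nu] is not yet known to be
    finite. Monotone convergence at x = 0 comes first and gives total mass [f 0] = 1; the constant 1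
    is then integrable and dominates at every other x. *)
Lemma bounded_continuous_inversion (nu : {measure set R -> \bar R}) (f : R -> R[i]) (M : R) :
  (forall t, cabs (f t) <= M) ->
  continuous (fun t => complex.Re (f t)) -> continuous (fun t => complex.Im (f t)) -> f 0 = 1 ->
  (forall y x, 0 < y ->
    [/\ nu.-integrable setT (EFin \o (fun s => expR (- (y * `|s|)) * cos (x * s))),
        Rintegral nu setT (fun s => expR (- (y * `|s|)) * cos (x * s)) =
          pi^-1 * \int[lm]_t (complex.Re (f t) * complex.Re (cinvpow 1 y (t - x))) &
        Rintegral nu setT (fun s => expR (- (y * `|s|)) * sin (x * s)) =
          pi^-1 * \int[lm]_t (complex.Im (f t) * complex.Re (cinvpow 1 y (t - x)))]) ->
  characteristic_function f.
Proof.
move=> fM cre cim f0 H.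
have yn n : 0 < n.+1%:R^-1 :> R by rewrite invr_gt0.
have cvgre x := poisson_cvg (x := x) cre (fun t => le_trans (Re_le_cabs (f t)) (fM t)).
have cvgim x := poisson_cvg (x := x) cim (fun t => le_trans (Im_le_cabs (f t)) (fM t)).
pose e n (s : R) := expR (- (n.+1%:R^-1 * `|s|)).
have mE n : measurable_fun setT (e n) by rewrite /e; measurable_tac.
have cE s : e n s @[n --> \oo] --> (1 : R).
  rewrite -[X in _ --> X](expR0); apply: continuous_cvg; first exact: continuous_expR.
  rewrite -[X in _ --> X]oppr0; apply: cvgN.
  rewrite -[X in _ --> X](mul0r `|s|); apply: cvgMl; exact: cvg_harmonic.
have e_ge0 n s : 0 <= e n s by exact: expR_ge0.
have e_le1 n s : e n s <= 1.
  by rewrite /e -[leRHS]expR0 ler_expR oppr_le0 mulr_ge0// ltW.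
have e_nd s : nondecreasing_seq (fun n => (e n s)%:E).
  move=> m n mn; rewrite lee_fin ler_expR lerN2; apply: ler_wpM2r => //.
  by rewrite lef_pV2 ?posrE// ler_nat.
(* Integrability at x = 0 lets the real-valued integral be read back as the extended one on which
   monotone convergence acts. *)
have E0 n : (\int[nu]_s (e n s)%:E = (pi^-1 * \int[lm]_t (complex.Re (f t) * complex.Re (cinvpow 1 n.+1%:R^-1 (t - 0))))%:E)%E.
  have [i1 <- _] := H _ 0 (yn n).
  have -> : (fun s : R => expR (- (n.+1%:R^-1 * `|s|)) * cos (0 * s)) = e n.
    by apply/funext => s; rewrite mul0r cos0 mulr1.
  rewrite /Rintegral fineK//; apply: integrable_fin_num => //.
  by apply: eq_integrable i1 => // s _ /=; rewrite mul0r cos0 mulr1.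
have nu1 : nu setT = 1%E.
  have c1 : (fun n => \int[nu]_s (e n s)%:E)%E @ \oo --> nu setT.
    have -> : nu setT = (\int[nu]_s (limn (fun n => (e n s)%:E)))%E.
      rewrite -[LHS]mul1e -integral_cst//; apply: eq_integral => s _.
      by apply/esym/cvg_lim => //; apply: cvg_EFin; [by apply: nearW|exact: cE].
    apply: cvg_monotone_convergence => //.
    - by move=> n; exact/measurable_EFinP.
    - by move=> n s _; rewrite lee_fin.
  have c2 : (fun n => \int[nu]_s (e n s)%:E)%E @ \oo --> 1%:E.
    rewrite (_ : (fun n => _) = (fun n => (pi^-1 * \int[lm]_t (complex.Re (f t) * complex.Re (cinvpow 1 n.+1%:R^-1 (t - 0))))%:E)); last first.
      by apply/funext => n; exact: E0.
    by apply: cvg_EFin; [by apply: nearW|have := cvgre 0; rewrite f0].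
  exact: (cvg_unique _ c1 c2).
pose P : probability R R := measure_probability nu1.
exists P => x.
have iP1 : P.-integrable setT (EFin \o (fun=> 1 : R)) by exact: finite_measure_integrable_cst.
have lim (k : R -> R) : measurable_fun setT k -> (forall s, `|k s| <= 1) ->
    Rintegral nu setT (fun s => e n s * k s) @[n --> \oo] --> Rintegral P setT k.
  move=> mk k1.
  apply: (@Rintegral_dominated_cvg _ _ R P (fun n s => e n s * k s) k (fun=> 1)) => //.
  - by move=> n; exact: measurable_mulf.
  - apply: aeW => s; rewrite -[X in _ --> X](mul1r (k s)); apply: cvgMl; exact: cE.
  - by move=> n s; rewrite normrM -[leRHS]mul1r ler_pM// ger0_norm.
have mc : measurable_fun setT (fun s : R => cos (x * s)) by measurable_tac.
have ms : measurable_fun setT (fun s : R => sin (x * s)) by measurable_tac.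
have Lc := lim _ mc (fun s => norm_cos_le1 _).
have Ls := lim _ ms (fun s => norm_sin_le1 _).
have Ec : complex.Re (f x) = Rintegral P setT (fun s => cos (x * s)).
  apply: (cvg_unique _ _ Lc) => //.
  rewrite (_ : (fun n => _) = (fun n => pi^-1 * \int[lm]_t (complex.Re (f t) * complex.Re (cinvpow 1 n.+1%:R^-1 (t - x))))).
    exact: cvgre.
  by apply/funext => n; have [] := H _ x (yn n).
have Es : complex.Im (f x) = Rintegral P setT (fun s => sin (x * s)).
  apply: (cvg_unique _ _ Ls) => //.
  rewrite (_ : (fun n => _) = (fun n => pi^-1 * \int[lm]_t (complex.Im (f t) * complex.Re (cinvpow 1 n.+1%:R^-1 (t - x))))).
    exact: cvgim.
  by apply/funext => n; have [] := H _ x (yn n).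
by rewrite /cintegral /expi /= -Ec -Es; case: (f x).
Qed.

(** The measure is reflected about 0. This reduces the condition on the negative half-axis to the
    one on the positive half-axis. *)
Lemma characteristic_function_conj f : characteristic_function f ->
  characteristic_function (fun t => conjc (f t)).
Proof.
move=> [sigma fE].
have mopp : measurable_fun setT (-%R : R -> R) by exact: oppr_measurable.
unshelve epose (nu := (pushforward sigma (-%R : R -> R) : {measure set R -> \bar R})).
  exact: mopp.
have nu1 : nu setT = 1%E by exact: (@probability_setT _ _ _ sigma).
exists (measure_probability nu1) => x.
have E (k : R -> R) : continuous k -> (exists c, forall t, `|k t| <= c) ->
    Rintegral nu setT k = Rintegral sigma setT (k \o -%R).
  move=> ck [c kc]; have mk : measurable_fun setT k by exact: continuous_measurable_fun.
  have mkE : measurable_fun setT (EFin \o k) by exact/measurable_EFinP.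
  rewrite /Rintegral; congr fine.
  apply: (integral_pushforward mopp mkE _ measurableT).
  apply: (integrable_bounded_by (mu := sigma) (g := fun=> c)) => //.
  - exact: measurableT_comp.
  - exact: finite_measure_integrable_cst.
rewrite fE /cintegral /expi /=; congr (_ +i* _).
  rewrite [RHS](E (fun t => cos (x * t))).
  - by apply: eq_Rintegral => t _ /=; rewrite mulrN cosN.
  - by move=> t; apply: continuous_comp; [exact: mulrl_continuous|exact: continuous_cos].
  - by exists 1 => t; exact: norm_cos_le1.
rewrite [RHS](E (fun t => sin (x * t))).
- rewrite -[LHS]mulN1r -RintegralZl//.
    by apply: eq_Rintegral => t _ /=; rewrite mulrN sinN mulN1r.
  apply: (integrable_bounded_by (mu := sigma) (g := fun=> 1)) => //.
  + by measurable_tac.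
  + exact: finite_measure_integrable_cst.
  + by move=> t; exact: norm_sin_le1.
- by move=> t; apply: continuous_comp; [exact: mulrl_continuous|exact: continuous_sin].
- by exists 1 => t; exact: norm_sin_le1.
Qed.

Lemma Re_div_upper (z : R[i]) (y t : R) : 0 < y ->
  complex.Re (z / (y*i - t%:C)) = complex.Re (- 'i * z * cinvpow 1 y t).
Proof.
move=> y0; have q0 := lt0r_neq0 (sqrD_gt0 t y0).
case: z => a b; rewrite -mulrA Re_mulNi cinvpow1 /=.
by rewrite !(add0r, sub0r, subr0) sqrrN [t ^+ 2 + _]addrC; field.
Qed.

Lemma Im_div_upper (z : R[i]) (y t : R) : 0 < y ->
  complex.Im (z / (y*i - t%:C)) = - complex.Re (z * cinvpow 1 y t).
Proof.
move=> y0; have q0 := lt0r_neq0 (sqrD_gt0 t y0).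
case: z => a b; rewrite cinvpow1 /=.
by rewrite !(add0r, sub0r, subr0) sqrrN [t ^+ 2 + _]addrC; field.
Qed.

Lemma div_lower (z : R[i]) (y t : R) :
  z / ((- y)*i - t%:C) = conjc (conjc z / (y*i - t%:C)).
Proof.
case: z => a b; apply/eqP; rewrite eq_complex /=.
by rewrite !(add0r, sub0r, subr0, sqrrN); apply/andP; split; apply/eqP; ring.
Qed.

Lemma Re_conj (z : R[i]) : complex.Re (conjc z) = complex.Re z.
Proof. by case: z. Qed.

Lemma Im_conj (z : R[i]) : complex.Im (conjc z) = - complex.Im z.
Proof. by case: z. Qed.

Lemma cauchy_transformE f z : cauchy_transform f z =
  - (\int[lm]_t complex.Im (f t / (z - t%:C)) / pi) +i* (\int[lm]_t complex.Re (f t / (z - t%:C)) / pi).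
Proof.
have pn : pi != 0 :> R by rewrite gt_eqF// pi_gt0.
rewrite /cauchy_transform /cintegral; apply/eqP; rewrite eq_complex /=.
have -> : pi / (pi ^+ 2 + 0 ^+ 2) = pi^-1 :> R by rewrite expr0n/= addr0 expr2 invfM mulVKf.
by rewrite !(mul0r, mulr0, oppr0, mul1r, sub0r, add0r) ![pi^-1 * _]mulrC !eqxx.
Qed.

Lemma cauchy_transform_upper f (y : R) : admissible f -> 0 < y ->
  complex.Re (cauchy_transform f (y*i)) = cauchy_moment f 1 y / pi /\
  complex.Im (cauchy_transform f (y*i)) = cauchy_moment (fun t => - 'i * f t) 1 y / pi.
Proof.
move=> af y0; rewrite cauchy_transformE /=; split.
  rewrite (_ : \int[lm]_t _ = \int[lm]_t (- 1 * complex.Re (f t * cinvpow 1 y t))).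
    by rewrite RintegralZl ?mulN1r ?mulNr ?opprK//; exact: integrable_cauchy_moment.
  by apply: eq_Rintegral => t _; rewrite Im_div_upper// mulN1r.
by congr (_ / _); apply: eq_Rintegral => t _; rewrite Re_div_upper.
Qed.

(** Conjugating the kernel shows that k_f (- i y) is minus the conjugate of the transform of conj f
    at i y; this accounts for the minus sign in the second condition. *)
Lemma cauchy_transform_lower f (y : R) : admissible f -> 0 < y ->
  complex.Re (cauchy_transform f ((- y)*i)) = - (cauchy_moment (fun t => conjc (f t)) 1 y / pi) /\
  complex.Im (cauchy_transform f ((- y)*i)) = cauchy_moment (fun t => - 'i * conjc (f t)) 1 y / pi.
Proof.
move=> af y0; rewrite cauchy_transformE /=; split.
  congr (- (_ / _)); apply: eq_Rintegral => t _.
  by rewrite div_lower Im_conj Im_div_upper// opprK.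
by congr (_ / _); apply: eq_Rintegral => t _; rewrite div_lower Re_conj Re_div_upper.
Qed.

Lemma cauchy_moment_i f n (y : R) : admissible f -> 0 < y ->
  cauchy_moment (fun t => 'i * f t) n.+1 y = - cauchy_moment (fun t => - 'i * f t) n.+1 y.
Proof.
move=> af y0; rewrite /cauchy_moment -[RHS]mulN1r -RintegralZl//.
  by apply: eq_Rintegral => t _; rewrite -!mulrA Re_mulNi Re_muli mulN1r.
exact: integrable_cauchy_moment (admissibleNi af) y0.
Qed.

(** Reality of the transform is an equation on the first moment only; differentiation spreads it to
    all moments. It is recorded as two inequalities so that the monotonicity of [cumul] applies to
    both signs. *)
Lemma moments_real f : admissible f ->
  (forall y, 0 < y -> cauchy_moment (fun t => - 'i * f t) 1 y = 0) <->
  moments_ge0 (fun t => - 'i * f t) /\ moments_ge0 (fun t => 'i * f t).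
Proof.
move=> af; split.
  move=> /(cauchy_moment_eq0 (admissibleNi af)) H; split=> n y y0; first by rewrite H.
  by rewrite cauchy_moment_i// H// oppr0.
move=> [h1 h2] y y0; apply/eqP; rewrite eq_le h1// andbT.
by have := h2 0%N y y0; rewrite cauchy_moment_i// oppr_ge0.
Qed.

End Inversion.

Theorem theorem3 (R : realType) (f : R -> R[i]) :
  (exists M : R, forall t : R, cabs (f t) <= M) ->
  continuous (fun t => complex.Re (f t)) ->
  continuous (fun t => complex.Im (f t)) ->
  f 0 = 1 ->
  (@lebesgue_measure R).-integrable setT
     (fun t : R => (cabs (f t) / (1 + `|t|))%:E) ->
  characteristic_function f <->
  ((forall y : R, 0 < y -> complex.Im (cauchy_transform f (y*i)) = 0) /\
   completely_monotonic 0%E +oo%E (fun y : R => complex.Re (cauchy_transform f (y*i))))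
  /\
  ((forall y : R, y < 0 -> complex.Im (cauchy_transform f (y*i)) = 0) /\
   absolutely_monotonic -oo%E 0%E (fun y : R => - complex.Re (cauchy_transform f (y*i)))).
Proof.
move=> [M fM] cre cim f0 fi.
have af : admissible f by split=> //; split; exact: continuous_measurable_fun.
have ac := admissible_conj af.
have pn : pi^-1 != 0 :> R by rewrite invr_eq0 gt_eqF// pi_gt0.
have upper : ((forall y : R, 0 < y -> complex.Im (cauchy_transform f (y*i)) = 0) /\
   completely_monotonic 0%E +oo%E (fun y : R => complex.Re (cauchy_transform f (y*i)))) <->
   [/\ moments_ge0 f, moments_ge0 (fun t => - 'i * f t) & moments_ge0 (fun t => 'i * f t)].
  have cmP := completely_monotonicP af (fun y y0 => (cauchy_transform_upper af y0).1).
  have reP := moments_real af.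
  split=> [[im0 /cmP p]|[p1 p2 p3]].
    have [|p2 p3] := reP.1; last by split.
    move=> y y0; have := im0 y y0; rewrite (cauchy_transform_upper af y0).2.
    by move/eqP; rewrite mulf_eq0 (negbTE pn) orbF => /eqP.
  split; last exact/cmP.
  by move=> y y0; rewrite (cauchy_transform_upper af y0).2 (reP.2 (conj p2 p3))// mul0r.
have lower : ((forall y : R, y < 0 -> complex.Im (cauchy_transform f (y*i)) = 0) /\
   absolutely_monotonic -oo%E 0%E (fun y : R => - complex.Re (cauchy_transform f (y*i)))) <->
   [/\ moments_ge0 (fun t => conjc (f t)), moments_ge0 (fun t => - 'i * conjc (f t)) &
      moments_ge0 (fun t => 'i * conjc (f t))].
  have cmP : absolutely_monotonic -oo%E 0%E (fun y : R => - complex.Re (cauchy_transform f (y*i))) <->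
      moments_ge0 (fun t => conjc (f t)).
    (* Substituting - y moves the condition to ]0, +oo[, where the two minus signs cancel and leave
       the moments of conj f. *)
    rewrite /absolutely_monotonic oppe0; apply: (completely_monotonicP ac) => y y0.
    by rewrite (cauchy_transform_lower af y0).1 opprK.
  have reP := moments_real ac.
  split=> [[im0 /cmP p]|[p1 p2 p3]].
    have [|p2 p3] := reP.1; last by split.
    move=> y y0; have := im0 (- y); rewrite oppr_lt0 => /(_ y0).
    rewrite (cauchy_transform_lower af y0).2.
    by move/eqP; rewrite mulf_eq0 (negbTE pn) orbF => /eqP.
  split; last exact/cmP.
  move=> y y0; have y1 : 0 < - y by rewrite oppr_gt0.
  by rewrite -[y]opprK (cauchy_transform_lower af y1).2 (reP.2 (conj p2 p3))// mul0r.
split=> [cf|[/upper p /lower q]].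
  split; first by apply/upper; exact: characteristic_function_moments.
  by apply/lower; apply: characteristic_function_moments => //; exact: characteristic_function_conj.
have [nu Hnu] := poisson_measure_exists af p q.
exact: (bounded_continuous_inversion fM cre cim f0 Hnu).
Qed.
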